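(* Let $(A,\rho)$ be a transitive anchored vector bundle over a connected smooth manifold $M$, and let $\nabla$ be an $A$-connection on a vector bundle $F\to M$. Let $\Pi(F)=\{s\in\Gamma(F)\mid \nabla_a s=0 \text{ for all } a\in\Gamma(A)\}$ be the space of global parallel sections, and for $p\in M$ let $F_p^{\operatorname{Hol}_p^A(\nabla)}=\{v\in F_p\mid h(v)=v \text{ for all } h\in \operatorname{Hol}_p^A(\nabla)\}$. Then for every $p\in M$ the evaluation map $$\operatorname{ev}_p:\Pi(F)\to F_p^{\operatorname{Hol}_p^A(\nabla)},\qquad s\mapsto s(p),$$ is an isomorphism.
   Context: All bundles, sections and curves are smooth. An anchored vector bundle over $M$ is a vector bundle $A\to M$ with a vector bundle morphism $\rho:A\to TM$ (the anchor); it is transitive if $\rho$ is surjective. An $A$-connection on a vector bundle $F\to M$ is an $\mathbb R$-bilinear operation $(X,s)\mapsto\nabla_X s$, $\Gamma(A)\times\Gamma(F)\to\Gamma(F)$, with $\nabla_{fX}s=f\nabla_Xs$ and $\nabla_X(fs)=(\rho(X)f)s+f\nabla_Xs$ for $f\in C^\infty(M)$. An $A$-path is a smooth curve $a:[0,1]\to A$ covering a smooth curve $\gamma:[0,1]\to M$ with $\rho(a(t))=\dot\gamma(t)$ for all $t$. Along an $A$-path, $\nabla$ induces a covariant derivative $D^a_t$ on $\Gamma(\gamma^*F)$; in local frames $\{e_\alpha\}$ of $A$ and $\{s_i\}$ of $F$, with $a(t)=a^\alpha(t)e_\alpha(\gamma(t))$, $u(t)=u^i(t)s_i(\gamma(t))$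 and $\nabla_{e_\alpha}s_j=\Gamma^i_{\alpha j}s_i$, $$D_t^au=\Big(\frac{du^i}{dt}+a^\alpha(t)u^j(t)\Gamma^i_{\alpha j}(\gamma(t))\Big)s_i(\gamma(t)).$$ A section $u$ of $\gamma^*F$ is parallel along $a$ if $D^a_tu=0$; for each $v\in F_{\gamma(0)}$ there is a unique parallel $u$ with $u(0)=v$, and $P_a:F_{\gamma(0)}\to F_{\gamma(1)}$, $v\mapsto u(1)$, is the parallel transport along $a$. An $A$-loop at $p$ is an $A$-path whose base curve $\gamma$ begins and ends at $p$. The holonomy group is $\operatorname{Hol}_p^A(\nabla)=\{P_a\in\operatorname{Aut}(F_p)\mid a \text{ an } A\text{-loop at } p\}$. *)

(* Defs.v *)
From HB Require Import structures.
From mathcomp Require Import all_boot all_order all_algebra.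
From mathcomp Require Import all_classical all_reals all_analysis.
Set Implicit Arguments.
Unset Strict Implicit.
Unset Printing Implicit Defensive.
Import Order.TTheory GRing.Theory Num.Theory.
Import numFieldNormedType.Exports.
Local Open Scope classical_set_scope.
Local Open Scope ring_scope.

Section Smooth.
Variables (R : realType) (V W : normedModType R).
Implicit Types (f g : V -> W) (x : V).

Definition iter_derive (vs : seq V) f : V -> W :=
  foldr (fun v g x => 'D_v g x) f vs.

(* C^oo on a neighbourhood of x; V is finite-dimensional in all uses *)
Definition smooth_at f x : Prop :=
  \forall y \near x, forall vs, differentiable (iter_derive vs f) y.

Lemma near_eq_differentiable f g x : (\near x, f x = g x) ->
  differentiable f x -> differentiable g x.
Proof.
move=> fg /diff_locallyP [dc df].
have E : g \o shift x = cst (g x) + 'd f x +o_ 0 id.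
  apply/eqaddoP => e e0.
  move/eqaddoP: df => /(_ e e0) df.
  have fg0 : \forall h \near 0, f (h + x) = g (h + x).
    move: fg; rewrite (near_shift 0 x) /=; apply: filterS => h /=.
    by rewrite subr0.
  near=> h.
  have fgh : f (h + x) = g (h + x) by near: h.
  have : `|(f \o shift x - (cst (f x) + 'd f x)) h| <= e * `|id h| by near: h.
  by rewrite !fctE /= fgh (nbhs_singleton fg).
have dgf := diff_unique dc E.
by apply/diff_locallyP; rewrite dgf.
Unshelve. all: by end_near. Qed.

Lemma near_eq_iter_derive f g x vs : (\near x, f x = g x) ->
  \forall y \near x, iter_derive vs f y = iter_derive vs g y.
Proof.
move=> fg; elim: vs => [//|v vs IH] /=.
by near=> y; apply: near_eq_derive; near: y; exact/near_join.
Unshelve. all: by end_near. Qed.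

Lemma near_eq_smooth_at f g x : (\near x, f x = g x) ->
  smooth_at f x -> smooth_at g x.
Proof.
move=> /near_join fg sf; near=> y => vs.
apply: (@near_eq_differentiable (iter_derive vs f)).
  by apply: near_eq_iter_derive; near: y.
by move: vs; near: y.
Unshelve. all: by end_near. Qed.

Lemma smooth_at_differentiable f x : smooth_at f x -> differentiable f x.
Proof. by move=> /nbhs_singleton /(_ [::]). Qed.

Lemma smooth_at_derive f x v : smooth_at f x -> smooth_at ('D_v f) x.
Proof.
apply: filterS => y + vs => /(_ (rcons vs v)).
by rewrite /iter_derive -cats1 foldr_cat.
Qed.

End Smooth.

Lemma diff_comp_near (R : realType) (U V W : normedModType R) (f : U -> V)
    (g : V -> W) (h : U -> W) x y v : f x = y ->
  differentiable f x -> differentiable g y -> (\near x, g (f x) = h x) ->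
  'd g y ('d f x v) = 'd h x v.
Proof.
move=> <- df dg gfh; have dgf := differentiable_comp df dg.
have dh : differentiable h x by exact: near_eq_differentiable gfh dgf.
rewrite -(deriveE v dh) -(near_eq_derive v gfh) (deriveE v dgf).
by rewrite (diff_comp df dg).
Qed.

(* Smooth manifolds without boundary: [chart_inv i] is only meaningful on the
   open set [chart i @` chart_dom i]. *)
Record manifold (R : realType) := Manifold {
  mfd_sort :> topologicalType;
  mfd_hausdorff : hausdorff_space mfd_sort;
  mfd_second_countable : @second_countable mfd_sort;
  mdim : nat;
  chart_idx : Type;
  chart_dom : chart_idx -> set mfd_sort;
  chart : chart_idx -> mfd_sort -> 'rV[R]_mdim;
  chart_inv : chart_idx -> 'rV[R]_mdim -> mfd_sort;
  chart_cover : forall p, exists i, chart_dom i p;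
  open_chart_dom : forall i, open (chart_dom i);
  open_chart_image : forall i, open (chart i @` chart_dom i);
  chartK : forall i p, chart_dom i p -> chart_inv i (chart i p) = p;
  chart_continuous : forall i p, chart_dom i p -> {for p, continuous (chart i)};
  chart_inv_continuous : forall i p, chart_dom i p ->
    {for chart i p, continuous (chart_inv i)};
  chart_smooth : forall i j p, chart_dom i p -> chart_dom j p ->
    smooth_at (chart j \o chart_inv i) (chart i p)
}.

Definition chart_at (R : realType) (M : manifold R) (p : M) : chart_idx M :=
  projT1 (cid (chart_cover p)).

Lemma chart_atP (R : realType) (M : manifold R) (p : M) :
  chart_dom (chart_at p) p.
Proof. exact: projT2 (cid (chart_cover p)). Qed.

Definition msmooth_at (R : realType) (M : manifold R) (W : normedModType R)
    (f : M -> W) (p : M) : Prop :=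
  exists2 i, chart_dom i p & smooth_at (f \o chart_inv i) (chart i p).

(* A vector bundle is given by its fibres and an atlas of local trivialisations
   with inverse maps [vb_coord i p] and [vb_frame i p] (for p in [vb_dom i]);
   the manifold structure of the total space is the one they determine. *)
Record vbundle (R : realType) (M : manifold R) := VBundle {
  fib :> M -> lmodType R;
  vrank : nat;
  vb_idx : Type;
  vb_dom : vb_idx -> set M;
  vb_coord : vb_idx -> forall p, {linear fib p -> 'rV[R]_vrank};
  vb_frame : vb_idx -> forall p, {linear 'rV[R]_vrank -> fib p};
  vb_cover : forall p, exists i, vb_dom i p;
  open_vb_dom : forall i, open (vb_dom i);
  vb_coordK : forall i p, vb_dom i p -> cancel (vb_coord i p) (vb_frame i p);
  vb_frameK : forall i p, vb_dom i p -> cancel (vb_frame i p) (vb_coord i p);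
  vb_smooth : forall i j p, vb_dom i p -> vb_dom j p -> forall v,
    msmooth_at (fun q => vb_coord j q (vb_frame i q v)) p
}.

Arguments vb_coord {R M} _ _ _.
Arguments vb_frame {R M} _ _ _.

Section Tangent.
Variables (R : realType) (M : manifold R).
Implicit Types (i j : chart_idx M) (p q : M).

(* A tangent vector at p is represented by its components in the chart
   [chart_at p]; [tangent_coord i p] gives its components in the chart i. *)
Definition tangent_fib p : lmodType R := 'rV[R]_(mdim M).

Definition tangent_coord i p : {linear tangent_fib p -> 'rV[R]_(mdim M)} :=
  'd (chart i \o chart_inv (chart_at p)) (chart (chart_at p) p).

Definition tangent_frame i p : {linear 'rV[R]_(mdim M) -> tangent_fib p} :=
  'd (chart (chart_at p) \o chart_inv i) (chart i p).

Lemma near_chart_dom i p : chart_dom i p ->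
  \forall x \near chart i p, chart_dom i (chart_inv i x) /\
    chart i (chart_inv i x) = x.
Proof.
move=> ip; have : nbhs (chart i p) (chart i @` chart_dom i).
  by apply: open_nbhs_nbhs; split; [exact: open_chart_image|exists p].
by apply: filterS => _ [q iq <-]; rewrite chartK.
Qed.

Lemma diff_chartM i j k p v : chart_dom i p -> chart_dom j p ->
  chart_dom k p ->
  'd (chart k \o chart_inv j) (chart j p)
    ('d (chart j \o chart_inv i) (chart i p) v) =
  'd (chart k \o chart_inv i) (chart i p) v.
Proof.
move=> ip jp kp.
apply: diff_comp_near.
- by rewrite /= chartK.
- exact: smooth_at_differentiable (chart_smooth ip jp).
- exact: smooth_at_differentiable (chart_smooth jp kp).
have jn : \forall x \near chart i p, chart_dom j (chart_inv i x).
  apply: (chart_inv_continuous ip); rewrite chartK //.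
  by apply: open_nbhs_nbhs; split => //; exact: open_chart_dom.
by apply: filterS jn => x jx /=; rewrite chartK.
Qed.

Lemma diff_chart1 i p v : chart_dom i p ->
  'd (chart i \o chart_inv i) (chart i p) v = v.
Proof.
move=> ip; rewrite -deriveE; last first.
  exact: smooth_at_differentiable (chart_smooth ip ip).
rewrite -[RHS](derive_id (chart i p) v); apply: near_eq_derive.
by apply: filterS (near_chart_dom ip) => x [].
Qed.

Lemma tangent_coordK i p : chart_dom i p ->
  cancel (tangent_coord i p) (tangent_frame i p).
Proof.
move=> ip v; have cp := chart_atP p.
by rewrite /tangent_frame /tangent_coord diff_chartM // diff_chart1.
Qed.

Lemma tangent_frameK i p : chart_dom i p ->
  cancel (tangent_frame i p) (tangent_coord i p).
Proof.
move=> ip v; have cp := chart_atP p.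
by rewrite /tangent_frame /tangent_coord diff_chartM // diff_chart1.
Qed.

Lemma tangent_smooth i j p : chart_dom i p -> chart_dom j p -> forall v,
  msmooth_at (fun q => tangent_coord j q (tangent_frame i q v)) p.
Proof.
move=> ip jp v; exists i => //.
apply: near_eq_smooth_at (smooth_at_derive v (chart_smooth ip jp)).
have jn : \forall x \near chart i p, chart_dom j (chart_inv i x).
  apply: (chart_inv_continuous ip); rewrite chartK //.
  by apply: open_nbhs_nbhs; split => //; exact: open_chart_dom.
have sn := chart_smooth ip jp.
near=> x; have sx := near sn x.
have jx : chart_dom j (chart_inv i x) by near: x.
have [ix xE] : chart_dom i (chart_inv i x) /\ chart i (chart_inv i x) = x.
  by near: x; exact: near_chart_dom.
have cx := chart_atP (chart_inv i x).
rewrite /= /tangent_frame /tangent_coord diff_chartM // xE deriveE //.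
exact: sx [::].
Unshelve. all: by end_near. Qed.

Definition tangent : vbundle M :=
  VBundle (@chart_cover R M) (@open_chart_dom R M)
    tangent_coordK tangent_frameK tangent_smooth.

Definition tangent_derive p (v : tangent p) (f : M -> R) : R :=
  'D_v (f \o chart_inv (chart_at p)) (chart (chart_at p) p).

End Tangent.

Section Sections.
Variables (R : realType) (M : manifold R) (E : vbundle M).

(* arbitrary set-theoretic sections, with pointwise operations *)
Definition sect : Type := forall p, E p.

HB.instance Definition _ := gen_eqMixin sect.
HB.instance Definition _ := gen_choiceMixin sect.

Let zero : sect := fun p => 0.
Let opp (s : sect) : sect := fun p => - s p.
Let add (s t : sect) : sect := fun p => s p + t p.
Let scale (c : R) (s : sect) : sect := fun p => c *: s p.

Let addA : associative add.
Proof. by move=> s t u; apply: functional_extensionality_dep => p; exact: addrA. Qed.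
Let addC : commutative add.
Proof. by move=> s t; apply: functional_extensionality_dep => p; exact: addrC. Qed.
Let add0 : left_id zero add.
Proof. by move=> s; apply: functional_extensionality_dep => p; exact: add0r. Qed.
Let addN : left_inverse zero opp add.
Proof. by move=> s; apply: functional_extensionality_dep => p; exact: addNr. Qed.
HB.instance Definition _ := GRing.isZmodule.Build sect addA addC add0 addN.

Let scaleA c d (s : sect) : scale c (scale d s) = scale (c * d) s.
Proof. by apply: functional_extensionality_dep => p; exact: scalerA. Qed.
Let scale1 : left_id 1 scale.
Proof. by move=> s; apply: functional_extensionality_dep => p; exact: scale1r. Qed.
Let scaleDr : right_distributive scale +%R.
Proof. by move=> c s t; apply: functional_extensionality_dep => p; exact: scalerDr. Qed.
Let scaleDl (s : sect) : {morph scale^~ s : c d / c + d}.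
Proof. by move=> c d; apply: functional_extensionality_dep => p; exact: scalerDl. Qed.
HB.instance Definition _ := GRing.Zmodule_isLmodule.Build R sect
  scaleA scale1 scaleDr scaleDl.

Definition fscale (f : M -> R) (s : sect) : sect := fun p => f p *: s p.

Definition Gamma : set sect :=
  [set s | forall p, exists2 i, vb_dom i p &
    msmooth_at (fun q => vb_coord E i q (s q)) p].

(* the sections making up the i-th local frame; meaningful on [vb_dom i] *)
Definition local_frame (i : vb_idx E) (k : 'I_(vrank E)) : sect :=
  fun q => vb_frame E i q (delta_mx 0 k).

End Sections.
Arguments Gamma {R M} E.

Section Anchored.
Variables (R : realType) (M : manifold R).

Record bundle_hom (E E' : vbundle M) := BundleHom {
  hom_fun :> forall p, {linear E p -> E' p};
  hom_smooth : forall i j p, vb_dom i p -> vb_dom j p -> forall v,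
    msmooth_at (fun q => vb_coord E' j q (hom_fun q (vb_frame E i q v))) p
}.

Definition transitive_anchor (A : vbundle M) (rho : bundle_hom A (tangent M)) :=
  forall p (w : tangent M p), exists v : A p, rho p v = w.

(* Only the values of [nabla] on smooth sections are meaningful. *)
Record connection (A : vbundle M) (rho : bundle_hom A (tangent M))
    (F : vbundle M) := Connection {
  nabla :> sect A -> sect F -> sect F;
  nabla_Gamma : forall X s, Gamma A X -> Gamma F s -> Gamma F (nabla X s);
  nabla_linearl : forall (c : R) X Y s, Gamma A X -> Gamma A Y -> Gamma F s ->
    nabla (c *: X + Y) s = c *: nabla X s + nabla Y s;
  nabla_linearr : forall (c : R) X s t, Gamma A X -> Gamma F s -> Gamma F t ->
    nabla X (c *: s + t) = c *: nabla X s + nabla X t;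
  nabla_fscalel : forall (f : M -> R) X s, (forall p, msmooth_at f p) ->
    Gamma A X -> Gamma F s -> nabla (fscale f X) s = fscale f (nabla X s);
  nabla_leibniz : forall (f : M -> R) X s, (forall p, msmooth_at f p) ->
    Gamma A X -> Gamma F s ->
    nabla X (fscale f s) =
      fscale (fun p => tangent_derive (rho p (X p)) f) s + fscale f (nabla X s)
}.

End Anchored.

Section Curves.
Variable R : realType.

Definition I01 : set R := [set t | 0 <= t <= 1].

(* Curves on [0,1] are represented by functions on R, whose values outside
   [0,1] are irrelevant; smoothness on [0,1] means the local existence of
   smooth extensions. *)
Definition smooth01_at (W : normedModType R) (g : R -> W) (t : R) : Prop :=
  exists2 h : R -> W, smooth_at h t & \forall s \near t, I01 s -> g s = h s.

Definition derive01 (W : normedModType R) (g : R -> W) (t : R) : W :=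
  lim ((s - t)^-1 *: (g s - g t) @[s --> within I01 t^']).

Variable M : manifold R.

Definition smooth_curve (c : R -> M) : Prop :=
  {within I01, continuous c} /\
  forall t, I01 t ->
    exists2 i, chart_dom i (c t) & smooth01_at (chart i \o c) t.

Definition velocity (c : R -> M) (t : R) : tangent M (c t) :=
  derive01 (chart (chart_at (c t)) \o c) t.

Definition smooth_along (E : vbundle M) (c : R -> M) (u : forall t, E (c t)) :=
  forall t, I01 t -> exists2 i, vb_dom i (c t) &
    smooth01_at (fun s => vb_coord E i (c s) (u s)) t.

Definition Apath (A : vbundle M) (rho : bundle_hom A (tangent M))
    (c : R -> M) (a : forall t, A (c t)) : Prop :=
  [/\ smooth_curve c, smooth_along a &
      forall t, I01 t -> rho (c t) (a t) = velocity c t].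

End Curves.

Section Holonomy.
Variables (R : realType) (M : manifold R) (A : vbundle M).
Variables (rho : bundle_hom A (tangent M)) (F : vbundle M).
Variable D : connection rho F.

(* The operator induced by D on local sections X of A and s of F defined
   near p: extend their germs at p to global smooth sections. *)
Definition local_nabla (X : sect A) (s : sect F) (p : M) : F p :=
  xget 0 [set w | exists X' s', [/\ Gamma A X', Gamma F s',
    \forall q \near p, X' q = X q, \forall q \near p, s' q = s q &
    w = D X' s' p]].

Definition christoffel (i : vb_idx A) (j : vb_idx F)
    (al : 'I_(vrank A)) (k l : 'I_(vrank F)) (p : M) : R :=
  vb_coord F j p (local_nabla (local_frame i al) (local_frame j k) p) 0 l.

(* D^a_t u, computed in the local frames i of A and j of F *)
Definition cov_derive (i : vb_idx A) (j : vb_idx F) (c : R -> M)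
    (a : forall t, A (c t)) (u : forall t, F (c t)) (t : R) : F (c t) :=
  let ac al := vb_coord A i (c t) (a t) 0 al in
  let uc k s := vb_coord F j (c s) (u s) 0 k in
  vb_frame F j (c t) (\row_l (derive01 (uc l) t +
    \sum_al \sum_k ac al * uc k t * christoffel i j al k l (c t))).

Definition parallel_along (c : R -> M) (a : forall t, A (c t))
    (u : forall t, F (c t)) : Prop :=
  smooth_along u /\
  forall t, I01 t -> forall i j, vb_dom i (c t) -> vb_dom j (c t) ->
    cov_derive i j a u t = 0.

Definition transport (c : R -> M) (a : forall t, A (c t)) (v : F (c 0)) :
    F (c 1) :=
  xget 0 [set w | exists u, [/\ parallel_along a u, u 0 = v & u 1 = w]].

Definition Hol (p : M) : set (F p -> F p) :=
  [set h | exists (c : R -> M) (a : forall t, A (c t))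
    (c0 : c 0 = p) (c1 : c 1 = p), Apath rho a /\
    h = fun v => ecast x (F x) c1 (transport a (ecast x (F x) (esym c0) v))].

Definition Hol_fixed (p : M) : set (F p) :=
  [set v | forall h, Hol h -> h v = v].

Definition parallel_sections : set (sect F) :=
  [set s | Gamma F s /\ forall X, Gamma A X -> D X s = 0].

End Holonomy.
Arguments Hol {R M A rho F} D p.
Arguments Hol_fixed {R M A rho F} D p.

(* f restricts to an isomorphism from the linear subspace S onto the linear
   subspace T *)
Definition linear_subspace (R : realType) (V : lmodType R) (S : set V) : Prop :=
  S 0 /\ forall (c : R) x y, S x -> S y -> S (c *: x + y).

Definition linear_iso_on (R : realType) (V W : lmodType R) (S : set V)
    (T : set W) (f : V -> W) : Prop :=
  [/\ linear_subspace S, linear_subspace T,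
      forall (c : R) x y, S x -> S y -> f (c *: x + y) = c *: f x + f y &
      set_bij S T f].

(* Main.v *)
Require Import Defs.
From HB Require Import structures.
From mathcomp Require Import all_boot all_order all_algebra.
From mathcomp Require Import all_classical all_reals all_analysis.
From mathcomp Require Import ring lra.
Set Implicit Arguments.
Unset Strict Implicit.
Unset Printing Implicit Defensive.
Import Order.TTheory GRing.Theory Num.Theory.
Import numFieldNormedType.Exports.
Local Open Scope classical_set_scope.
Local Open Scope ring_scope.

(* No differential equation has to be solved.  A vector v fixed by the holonomy
   group and different from 0 has a parallel extension along every loop at p, as
   its transport around the loop is v, while transport is 0 by convention when
   there is no parallel section.  Any path a from p to q is the
   first half of the loop that runs through a and back, so v is transported along
   a; two paths from p to q together form a loop, and uniqueness of parallel
   sections shows that the result does not depend on the path.  The section s so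
   obtained is parallel along all paths.

   Near any point the anchor has a smooth right inverse, which lifts straight
   lines of a chart; hence all directional derivatives of the components of s are
   given by a linear system with smooth coefficients.  Gronwall's inequality and
   a bootstrap show that s is smooth, and lines lifted with a prescribed initial
   value show that its covariant derivatives vanish.  Injectivity is uniqueness of
   parallel sections along a path joining p to q. *)

(** * Calculus of smooth maps *)

(** The obstacle is gluing: a concatenation of smooth curves need not be smooth at the junction,
    while only smooth loops define holonomy. Hence the auxiliary paths are reparametrised to rest
    near both ends, at the zero vector of A, and are defined on the whole line.

    Existence of parallel sections is always drawn from a nonzero fixed vector; the zero vector is
    served by the zero section.

    Transport along single paths says nothing about dependence on the end point, so that not even
    continuity of s is known at first. The only information is a linear equation along each lifted
    line, which is why the regularity argument starts from mere directional derivatives.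

    A connection acts here on global sections only. Bump functions give it a local expression
    through Christoffel symbols, which can then be compared with the equation along curves. *)

Section CkDef.
Variables (R : realType) (V W : normedModType R).

(** All directional derivatives of order at most n are differentiable on U. The recursion peels off
    the derivative taken first, so that the product, quotient and chain rules become inductions on
    n. *)
Fixpoint ck (n : nat) (U : set V) (f : V -> W) : Prop :=
  (forall x, U x -> differentiable f x) /\
  if n is m.+1 then forall v, ck m U ('D_v f) else True.

Implicit Types (U : set V) (f g : V -> W).

Lemma ck_differentiable n U f x : ck n U f -> U x -> differentiable f x.
Proof. by case: n => [|n] [df _] /df. Qed.

Lemma ck_derivable n U f x v : ck n U f -> U x -> derivable f x v.
Proof. by move=> cf Ux; apply: diff_derivable; exact: ck_differentiable cf Ux. Qed.

Lemma ckW n U f : ck n.+1 U f -> ck n U f.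
Proof.
elim: n f => [|n IH] f [df cf]; split=> // v.
exact: IH.
Qed.

Lemma sub_ck n U U' f : U' `<=` U -> ck n U f -> ck n U' f.
Proof.
move=> UU'; elim: n f => [|n IH] f [df cf]; split=> //; do ?by move=> x /UU' /df.
by move=> v; apply: (IH _ (cf v)).
Qed.

Lemma eq_ck n U f g : open U -> (forall x, U x -> f x = g x) ->
  ck n U f -> ck n U g.
Proof.
move=> oU; elim: n f g => [|n IH] f g fg [df cf];
  have nfg x : U x -> \near x, f x = g x by
    move=> Ux; apply: filterS fg _; exact: open_nbhs_nbhs.
  by split=> // x Ux; apply: near_eq_differentiable (nfg _ Ux) (df _ Ux).
split=> [x Ux|v]; first exact: near_eq_differentiable (nfg _ Ux) (df _ Ux).
by apply: IH (cf v) => x /nfg; exact: near_eq_derive.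
Qed.

Lemma open_ck n U f :
  (forall y, U y -> forall vs, differentiable (iter_derive vs f) y) -> ck n U f.
Proof.
elim: n f => [|n IH] f Uf; split=> //; do ?by move=> y /Uf /(_ [::]).
move=> v; apply: IH => y /Uf + vs => /(_ (rcons vs v)).
by rewrite /iter_derive -cats1 foldr_cat.
Qed.

(** The neighbourhood is chosen before the order n: [smooth_at] demands all derivatives on one and
    the same neighbourhood. *)
Lemma smooth_at_ck f x :
  smooth_at f x <-> exists2 U, open_nbhs x U & forall n, ck n U f.
Proof.
split=> [|[U xU cf]].
  rewrite /smooth_at /prop_near1 nbhsE => -[U xU Uf]; exists U => // n.
  exact: open_ck.
apply: filterS (open_nbhs_nbhs xU) => y Uy vs.
elim/last_ind: vs f cf => [|vs v IH] f cf; first exact: ck_differentiable (cf 0%N) Uy.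
rewrite /iter_derive -cats1 foldr_cat; apply: IH => n.
by have [_ /(_ v)] := cf n.+1.
Qed.

End CkDef.

Section CkCst.
Variables (R : realType) (V W : normedModType R).
Implicit Types (U : set V).

Lemma ck_cst n U (w : W) : ck n U (cst w).
Proof.
elim: n w => [|n IH] w; split => //; do ?by move=> x _; exact: ex_diff.
move=> v; suff -> : 'D_v (cst w) = cst 0 :> (V -> W) by exact: IH.
by apply/funext => x; rewrite derive_cst.
Qed.

Lemma ckD n U (f g : V -> W) : open U -> ck n U f -> ck n U g ->
  ck n U (fun x => f x + g x).
Proof.
move=> oU; elim: n f g => [|n IH] f g [df cf] [dg cg]; split=> //;
  do ?by move=> x Ux; apply: differentiableD; [exact: df|exact: dg].
move=> v; apply: (@eq_ck _ _ _ n U (fun x => 'D_v f x + 'D_v g x)) => [//|x Ux|].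
  by rewrite -deriveD//; apply: diff_derivable; [exact: df|exact: dg].
by apply: IH; [exact: cf|exact: cg].
Qed.

Lemma ck_sum n U I (r : seq I) (P : pred I) (f : I -> V -> W) : open U ->
  (forall i, P i -> ck n U (f i)) ->
  ck n U (fun x => \sum_(i <- r | P i) f i x).
Proof.
move=> oU cf; elim: r => [|i r IH].
  by under eq_fun do rewrite big_nil; exact: ck_cst.
under eq_fun do rewrite big_cons.
case: (boolP (P i)) => // Pi; apply: ckD => //.
exact: cf.
Qed.

End CkCst.

Lemma ck_id (R : realType) (V : normedModType R) n (U : set V) : ck n U (@id V).
Proof.
case: n => [|n]; split => //; do ?by move=> x _; exact: ex_diff.
move=> v; suff -> : 'D_v (@id V) = cst v by exact: ck_cst.
by apply/funext => x; rewrite derive_id.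
Qed.

Section CkScalar.
Variables (R : realType) (V : normedModType R).
Implicit Types (U : set V) (f g : V -> R).

Lemma ckM n U f g : open U -> ck n U f -> ck n U g ->
  ck n U (fun x => f x * g x).
Proof.
move=> oU; elim: n f g => [|n IH] f g cf cg; split=> //;
  do ?by move=> x Ux; apply: differentiableM; apply: ck_differentiable; eassumption.
move=> v.
apply: (@eq_ck _ _ _ n U (fun x => f x * 'D_v g x + g x * 'D_v f x)) => [//|x Ux|].
  by rewrite -[RHS]/('D_v (f * g) x) deriveM//; apply: ck_derivable; eassumption.
apply: ckD => //; apply: IH; do ?exact: ckW.
- by case: cg => _ /(_ v).
- by case: cf => _ /(_ v).
Qed.

Lemma ckV n U f : open U -> (forall x, U x -> f x != 0) -> ck n U f ->
  ck n U (fun x => (f x)^-1).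
Proof.
move=> oU f0; elim: n => [|n IH] cf; split=> //;
  do ?by move=> x Ux; apply: differentiableV (f0 _ Ux);
    apply: ck_differentiable; eassumption.
move=> v; apply: (@eq_ck _ _ _ n U
    (fun x => (-1) * ((f x)^-1 * (f x)^-1) * 'D_v f x)) => [//|x Ux|].
  rewrite deriveV ?f0//; last by apply: ck_derivable; eassumption.
  by rewrite mulN1r -invfM -expr2.
apply: ckM => //; last by case: cf => _ /(_ v).
by apply: ckM => //; [exact: ck_cst|apply: ckM => //; exact/IH/ckW].
Qed.

Lemma differentiable_mx m k (f : V -> 'M[R]_(m, k)) x :
  (forall i j, differentiable (fun y => f y i j) x) -> differentiable f x.
Proof.
move=> df; rewrite (_ : f = \sum_i \sum_j (fun y => f y i j *: delta_mx i j)).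
  apply: differentiable_sum => i; apply: differentiable_sum => j.
  exact: differentiableZl.
apply/funext => y; rewrite fct_sumE {1}(matrix_sum_delta (f y)).
by apply: eq_bigr => i _; rewrite fct_sumE.
Qed.

Lemma differentiable_entry m k (f : V -> 'M[R]_(m, k)) i j x :
  differentiable f x -> differentiable (fun y => f y i j) x.
Proof.
move=> df; apply: (@differentiable_comp _ _ _ _ f (fun M => M i j)) => //.
exact: differentiable_coord.
Qed.

Lemma ck_mxP m k n U (f : V -> 'M[R]_(m, k)) : open U ->
  ck n U f <-> forall i j, ck n U (fun x => f x i j).
Proof.
move=> oU; split.
  move=> + i j; elim: n f => [|n IH] f cf; split=> //;
    do ?by move=> x Ux; apply: differentiable_entry; exact: ck_differentiable cf Ux.
  move=> v; apply: (@eq_ck _ _ _ n U (fun x => 'D_v f x i j)) => [//|x Ux|].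
    by rewrite derive_mx ?mxE//; exact: ck_derivable cf Ux.
  by apply: IH; case: cf => _ /(_ v).
elim: n f => [|n IH] f cf; have df x : U x -> differentiable f x
  by move=> Ux; apply: differentiable_mx => i j; exact: ck_differentiable (cf i j) Ux.
  by split.
split=> // v; apply: IH => i j.
apply: (@eq_ck _ _ _ n U ('D_v (fun x => f x i j))) => [//|x Ux|].
  by rewrite derive_mx ?mxE//; exact/diff_derivable/df.
by case: (cf i j) => _ /(_ v).
Qed.

End CkScalar.

Section CkComp.
Variables (R : realType) (V V' : normedModType R) (m : nat).
Variables (e : 'I_m -> V') (l : 'I_m -> V' -> R).
Hypothesis basis : forall v, v = \sum_k l k v *: e k.
Hypothesis ck_basis : forall n (U : set V) (f : V -> V') k, open U ->
  ck n U f -> ck n U (fun x => l k (f x)).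

(** Expanding ['D_v f x] in the basis turns the chain rule into a finite sum of products, the shape
    that closes the induction of [ck_comp_basis]. The abstract basis covers both row vectors and R
    itself, with a basis of one element. *)
Lemma derive_comp_basis (g : V' -> R) (f : V -> V') x v :
  differentiable f x -> differentiable g (f x) ->
  'D_v (fun y => g (f y)) x = \sum_k l k ('D_v f x) * 'D_(e k) g (f x).
Proof.
move=> df dg; rewrite (deriveE _ (differentiable_comp df dg)) diff_comp//=.
rewrite -(deriveE _ df) {1}(basis ('D_v f x)) linear_sum; apply: eq_bigr => k _.
by rewrite linearZ/= -deriveE.
Qed.

Lemma ck_comp_basis n (U : set V) (Y : set V') (g : V' -> R) (f : V -> V') :
  open U -> (forall x, U x -> Y (f x)) -> ck n Y g -> ck n U f ->
  ck n U (fun x => g (f x)).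
Proof.
move=> oU fY; elim: n g => [|n IH] g cg cf.
  split=> // x Ux; apply: differentiable_comp.
    exact: ck_differentiable cf Ux.
  exact/(ck_differentiable cg)/fY.
split=> [x Ux|v].
  apply: differentiable_comp; first exact: ck_differentiable cf Ux.
  exact/(ck_differentiable cg)/fY.
apply: (@eq_ck _ _ _ n U
    (fun x => \sum_k l k ('D_v f x) * 'D_(e k) g (f x))) => [//|x Ux|].
  rewrite derive_comp_basis//; first exact: ck_differentiable cf Ux.
  exact/(ck_differentiable cg)/fY.
apply: ck_sum => // k _; apply: ckM => //.
  by case: cf => _ /(_ v); exact: ck_basis.
by apply: (IH ('D_(e k) g)); [case: cg => _ /(_ (e k))|exact: ckW].
Qed.

Lemma smooth_at_comp_basis (g : V' -> R) (f : V -> V') x :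
  smooth_at f x -> smooth_at g (f x) -> smooth_at (fun y => g (f y)) x.
Proof.
move=> /smooth_at_ck[U [oU Ux] cf] /smooth_at_ck[Y [oY Yfx] cg].
have oUY : open (U `&` f @^-1` Y).
  rewrite openE => y [Uy Yfy]; apply: filterI; first exact: open_nbhs_nbhs.
  apply: (differentiable_continuous (ck_differentiable (cf 0%N) Uy)).
  exact: open_nbhs_nbhs.
apply/smooth_at_ck; exists (U `&` f @^-1` Y) => // n.
apply: (@ck_comp_basis n _ Y) => //; first by move=> y [].
by apply: sub_ck (cf n) => y [].
Qed.

End CkComp.

Section SmoothAt.
Variables (R : realType) (V : normedModType R).
Implicit Types (x : V).

Lemma smooth_at_open (W : normedModType R) (f : V -> W) x :
  smooth_at f x -> \forall y \near x, smooth_at f y.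
Proof. exact: near_join. Qed.

Lemma smooth_at_continuous (W : normedModType R) (f : V -> W) x :
  smooth_at f x -> {for x, continuous f}.
Proof. by move=> /smooth_at_differentiable; exact: differentiable_continuous. Qed.

Lemma smooth_at_derivable (W : normedModType R) (f : V -> W) x v :
  smooth_at f x -> derivable f x v.
Proof. by move=> /smooth_at_differentiable; exact: diff_derivable. Qed.

Lemma smooth_at_common (W W' : normedModType R) (f : V -> W) (g : V -> W') x :
  smooth_at f x -> smooth_at g x ->
  exists2 U, open_nbhs x U & forall n, ck n U f /\ ck n U g.
Proof.
move=> /smooth_at_ck[U xU cf] /smooth_at_ck[Y xY cg].
exists (U `&` Y); first exact: open_nbhsI.
by move=> n; split; [apply: sub_ck (cf n) => y []|apply: sub_ck (cg n) => y []].
Qed.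

Lemma smooth_at_cst (W : normedModType R) (w : W) x : smooth_at (cst w) x.
Proof.
apply/smooth_at_ck; exists setT => [|n]; last exact: ck_cst.
by split => //; exact: openT.
Qed.

Lemma smooth_at_id x : smooth_at (@id V) x.
Proof.
apply/smooth_at_ck; exists setT => [|n]; last exact: ck_id.
by split => //; exact: openT.
Qed.

Lemma smooth_atD (W : normedModType R) (f g : V -> W) x :
  smooth_at f x -> smooth_at g x -> smooth_at (fun y => f y + g y) x.
Proof.
move=> sf /(smooth_at_common sf)[U xU c]; apply/smooth_at_ck.
by exists U => // n; have [? ?] := c n; apply: ckD => //; case: xU.
Qed.

Lemma smooth_at_sum (W : normedModType R) I (r : seq I) (P : pred I)
    (f : I -> V -> W) x : (forall i, P i -> smooth_at (f i) x) ->
  smooth_at (fun y => \sum_(i <- r | P i) f i y) x.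
Proof.
move=> sf; elim: r => [|i r IH].
  by under eq_fun do rewrite big_nil; exact: smooth_at_cst.
under eq_fun do rewrite big_cons.
case: (boolP (P i)) => // Pi; apply: smooth_atD => //.
exact: sf.
Qed.

Lemma smooth_atM (f g : V -> R) x :
  smooth_at f x -> smooth_at g x -> smooth_at (fun y => f y * g y) x.
Proof.
move=> sf /(smooth_at_common sf)[U xU c]; apply/smooth_at_ck.
by exists U => // n; have [? ?] := c n; apply: ckM => //; case: xU.
Qed.

Lemma smooth_atZ (c : R) (f : V -> R) x :
  smooth_at f x -> smooth_at (fun y => c * f y) x.
Proof. by move=> sf; apply: smooth_atM => //; exact: smooth_at_cst. Qed.

Lemma smooth_atN (f : V -> R) x :
  smooth_at f x -> smooth_at (fun y => - f y) x.
Proof.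
by move=> /(smooth_atZ (-1)); under eq_fun do rewrite mulN1r.
Qed.

Lemma smooth_at_prod I (r : seq I) (P : pred I)
    (f : I -> V -> R) x : (forall i, P i -> smooth_at (f i) x) ->
  smooth_at (fun y => \prod_(i <- r | P i) f i y) x.
Proof.
move=> sf; elim: r => [|i r IH].
  by under eq_fun do rewrite big_nil; exact: smooth_at_cst.
under eq_fun do rewrite big_cons.
case: (boolP (P i)) => // Pi; apply: smooth_atM => //.
exact: sf.
Qed.

Lemma smooth_atV (f : V -> R) x : f x != 0 ->
  smooth_at f x -> smooth_at (fun y => (f y)^-1) x.
Proof.
move=> fx0 sf; have [U [oU Ux] cf] := (smooth_at_ck f x).1 sf.
have oU' : open (U `&` [set y | f y != 0]).
  rewrite openE => y [Uy fy0]; apply: filterI; first exact: open_nbhs_nbhs.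
  have := differentiable_continuous (ck_differentiable (cf 0%N) Uy).
  move=> /cvgrPdist_lt /(_ `|f y|); rewrite normr_gt0 => /(_ fy0).
  apply: filterS => z; rewrite /=; apply: contraTneq => ->.
  by rewrite subr0 ltxx.
apply/smooth_at_ck; exists (U `&` [set y | f y != 0]) => // n.
by apply: ckV => // [y []//|]; apply: sub_ck (cf n) => y [].
Qed.

Lemma smooth_at_mxP m k (f : V -> 'M[R]_(m, k)) x :
  smooth_at f x <-> forall i j, smooth_at (fun y => f y i j) x.
Proof.
split=> [/smooth_at_ck[U xU cf] i j|sf].
  apply/smooth_at_ck; exists U => // n.
  by apply: (ck_mxP n f xU.1).1.
have : \forall y \near x, forall ij : 'I_m * 'I_k, forall vs,
    differentiable (iter_derive vs (fun z => f z ij.1 ij.2)) y.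
  by apply: filter_forall => -[i j]; exact: sf.
rewrite /prop_near1 nbhsE => -[U xU Uf]; apply/smooth_at_ck; exists U => // n.
apply/(ck_mxP n f xU.1) => i j; apply: open_ck => y /Uf /(_ (i, j)) //.
Qed.

End SmoothAt.

Section Compose.
Variables (R : realType) (V : normedModType R).

Lemma smooth_at_comp_row m (g : 'rV[R]_m -> R) (f : V -> 'rV[R]_m) x :
  smooth_at f x -> smooth_at g (f x) -> smooth_at (g \o f) x.
Proof.
apply: (@smooth_at_comp_basis R V _ m (fun k => delta_mx 0 k) (fun k v => v 0 k)).
  by move=> v; exact: row_sum_delta.
by move=> n U h k oU ch; exact: (ck_mxP n h oU).1.
Qed.

Lemma smooth_at_comp_row_mx m a b (g : 'rV[R]_m -> 'M[R]_(a, b))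
    (f : V -> 'rV[R]_m) x :
  smooth_at f x -> smooth_at g (f x) -> smooth_at (g \o f) x.
Proof.
move=> sf /smooth_at_mxP sg; apply/smooth_at_mxP => i j.
exact: (smooth_at_comp_row sf (sg i j)).
Qed.

Lemma smooth_at_comp_real (g : R -> R) (f : V -> R) x :
  smooth_at f x -> smooth_at g (f x) -> smooth_at (g \o f) x.
Proof.
apply: (@smooth_at_comp_basis R V R 1%N (fun=> 1) (fun _ v => v) _ _ g f x) => //.
by move=> v; rewrite big_ord1 /GRing.scale/= mulr1.
Qed.

Lemma smooth_at_comp_real_mx a b (g : R -> 'M[R]_(a, b)) (f : V -> R) x :
  smooth_at f x -> smooth_at g (f x) -> smooth_at (g \o f) x.
Proof.
move=> sf /smooth_at_mxP sg; apply/smooth_at_mxP => i j.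
exact: (smooth_at_comp_real sf (sg i j)).
Qed.

Lemma smooth_at_det n (A : V -> 'M[R]_n) x :
  smooth_at A x -> smooth_at (fun y => \det (A y)) x.
Proof.
move=> /smooth_at_mxP sA; apply: smooth_at_sum => s _.
by apply: smooth_atM; [exact: smooth_at_cst|exact: smooth_at_prod].
Qed.

Lemma smooth_at_adj n (A : V -> 'M[R]_n) x :
  smooth_at A x -> smooth_at (fun y => \adj (A y)) x.
Proof.
move=> /smooth_at_mxP sA; apply/smooth_at_mxP => i j.
under eq_fun do rewrite mxE /cofactor.
apply: smooth_atZ; apply: smooth_at_det; apply/smooth_at_mxP => k l.
by under eq_fun do rewrite !mxE; exact: sA.
Qed.

Lemma smooth_at_mulmx a b c (A : V -> 'M[R]_(a, b)) (B : V -> 'M[R]_(b, c)) x :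
  smooth_at A x -> smooth_at B x -> smooth_at (fun y => A y *m B y) x.
Proof.
move=> /smooth_at_mxP sA /smooth_at_mxP sB; apply/smooth_at_mxP => i j.
under eq_fun do rewrite mxE.
by apply: smooth_at_sum => k _; exact: smooth_atM.
Qed.

Lemma smooth_at_scalemx a b (f : V -> R) (B : V -> 'M[R]_(a, b)) x :
  smooth_at f x -> smooth_at B x -> smooth_at (fun y => f y *: B y) x.
Proof.
move=> sf /smooth_at_mxP sB; apply/smooth_at_mxP => i j.
by under eq_fun do rewrite mxE; exact: smooth_atM.
Qed.

End Compose.

(** * Bump functions *)

Section Bump1D.
Variable R : realType.
Implicit Types (s t : R).

(** The parameter k makes the family closed under differentiation up to linear combinations, so that
    smoothness of all members is one induction. *)
Definition flat_exp (k : nat) t : R :=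
  if 0 < t then t^-1 ^+ k * expR (- t^-1) else 0.

Lemma flat_exp_ge0 k t : 0 <= flat_exp k t.
Proof.
rewrite /flat_exp; case: ifP => // t0.
by rewrite mulr_ge0 ?expR_ge0// exprn_ge0// invr_ge0 ltW.
Qed.

Lemma flat_exp_gt0 k t : 0 < t -> 0 < flat_exp k t.
Proof. by move=> t0; rewrite /flat_exp t0 mulr_gt0 ?expR_gt0// exprn_gt0// invr_gt0. Qed.

Lemma flat_exp_le0 k t : t <= 0 -> flat_exp k t = 0.
Proof. by rewrite /flat_exp ltNge => ->. Qed.

(** The term of order k+2 of the exponential series at 1/t bounds exp(1/t) from below. A quadratic
    bound is what the difference quotient at 0 needs in order to tend to 0. *)
Lemma flat_exp_bound k t : flat_exp k t <= k.+2`!%:R * t ^+ 2.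
Proof.
rewrite /flat_exp; case: ifPn => t0; last by rewrite mulr_ge0// sqr_ge0.
have y0 : 0 < t^-1 by rewrite invr_gt0.
rewrite expRN ler_pdivrMr ?expR_gt0//.
have := expR_ge1Dxn k.+1 (ltW y0); set e := expR _ => le_e.
have {le_e} : t^-1 ^+ k.+2 / k.+2`!%:R <= e.
  by apply: le_trans le_e; rewrite lerDr.
rewrite ler_pdivrMr ?ltr0n ?fact_gt0// => le_e.
have -> : t^-1 ^+ k = t ^+ 2 * t^-1 ^+ k.+2.
  by rewrite (exprD _ 2 k) mulrA -exprMn divff ?gt_eqF// expr1n mul1r.
by rewrite [leRHS]mulrAC [leRHS]mulrC ler_pM2l ?exprn_gt0// mulrC.
Qed.

Lemma is_derive_flat_exp k t :
  is_derive t 1 (flat_exp k) (flat_exp k.+2 t - k%:R * flat_exp k.+1 t).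
Proof.
have [t0|t0|->] := ltrgt0P t.
- have nE : \near t, (fun s => s^-1 ^+ k * expR (- s^-1)) t = flat_exp k t.
    by apply: filterS (lt_nbhsr t0) => s s0; rewrite /flat_exp s0.
  apply: near_eq_is_derive nE _ => //.
  have tn0 : t != 0 by rewrite gt_eqF.
  have dV : is_derive t 1 (fun s => s^-1) (- t ^- 2).
    apply: (@is_derive_eq _ _ _ _ _ _ _ _ (is_deriveV tn0 (is_derive_id t 1))).
    by rewrite /GRing.scale/= mulr1.
  have dE : is_derive t 1 (fun s => expR (- s^-1)) (expR (- t^-1) * t ^- 2).
    rewrite -[t ^- 2]opprK.
    by apply: (@is_derive1_comp _ expR (fun s => - s^-1)); exact: is_deriveN.
  have dX : is_derive t 1 (fun s => s^-1 ^+ k) (- (k%:R * t^-1 ^+ k.+1)).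
    case: (k) => [|m].
      by under eq_fun do rewrite expr0; rewrite mul0r oppr0; exact: is_derive_cst.
    have := is_deriveX m.+1 dV; rewrite exprfctE => h; apply: (is_derive_eq h).
    rewrite /GRing.scale/= -exprVn mulrN; congr (- _).
    by rewrite -mulrA -exprD addn2.
  apply: (@is_derive_eq _ _ _ _ _ _ _ _ (is_deriveM dX dE)).
  rewrite /flat_exp t0 /GRing.scale/=.
  rewrite -exprVn mulrN mulrCA -exprD addn2 mulrC; congr (_ - _).
  by rewrite mulrC mulrA.
- have nE : \near t, (fun=> 0) t = flat_exp k t.
    by apply: filterS (lt_nbhsl t0) => s /ltW /flat_exp_le0 ->.
  apply: near_eq_is_derive nE _ => //.
  by rewrite !flat_exp_le0 ?(ltW t0)// mulr0 subr0; exact: is_derive_cst.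
rewrite !flat_exp_le0// mulr0 subr0.
have cvg0 : (h^-1 *: ((flat_exp k \o shift 0) (h *: 1) - flat_exp k 0)) @[h --> 0^']
    --> (0 : R).
  apply/cvgr0Pnorm_lt => e e0.
  set C : R := k.+2`!%:R.
  have C0 : 0 < C by rewrite ltr0n fact_gt0.
  near=> h.
  have h0 : h != 0 by near: h; exact: nbhs_dnbhs_neq.
  rewrite /= addr0 (@flat_exp_le0 _ 0)// subr0 /GRing.scale/= mulr1.
  rewrite normrM normfV ltr_pdivrMl ?normr_gt0//.
  rewrite ger0_norm ?flat_exp_ge0//.
  apply: le_lt_trans (flat_exp_bound _ _) _.
  rewrite -normr_id -real_normK ?num_real// normr_id expr2 mulrCA ltr_pM2l ?normr_gt0//.
  rewrite -ltr_pdivlMl//; near: h; apply: dnbhs0_lt.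
  by rewrite mulr_gt0 ?invr_gt0.
by apply: DeriveDef; [exact/cvgP/cvg0|exact: cvg_lim cvg0].
Unshelve. all: by end_near. Qed.

Lemma derive_flat_exp k v :
  'D_v (flat_exp k) = fun t => v * (flat_exp k.+2 t - k%:R * flat_exp k.+1 t).
Proof.
apply/funext => t; have [df dE] := is_derive_flat_exp k t.
rewrite deriveE; last exact/derivable1_diffP.
rewrite -[v in LHS]mulr1 -[v * 1]/(v *: 1) linearZ/=.
by rewrite -deriveE ?dE//; exact/derivable1_diffP.
Qed.

Lemma smooth_flat_exp k t : smooth_at (flat_exp k) t.
Proof.
apply/smooth_at_ck; exists setT => [|n]; first by split => //; exact: openT.
elim: n k => [|n IH] k; have df s : [set: R] s -> differentiable (flat_exp k) s
  by move=> _; have [df _] := is_derive_flat_exp k s; exact/derivable1_diffP.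
  by split.
split=> // v; rewrite derive_flat_exp.
apply: ckM => //; [exact: openT|exact: ck_cst|].
apply: ckD => //; [exact: openT|].
under eq_fun do rewrite -mulNr.
by apply: ckM => //; [exact: openT|exact: ck_cst].
Qed.

Definition smooth_step t : R :=
  flat_exp 0 t / (flat_exp 0 t + flat_exp 0 (1 - t)).

Lemma smooth_step_denom_gt0 t : 0 < flat_exp 0 t + flat_exp 0 (1 - t).
Proof.
have [t0|t0] := ltP 0 t.
  by rewrite ltr_pwDl ?flat_exp_gt0 ?flat_exp_ge0.
rewrite ltr_pwDr ?flat_exp_ge0 ?flat_exp_gt0//.
by rewrite subr_gt0 (le_lt_trans t0).
Qed.

Lemma smooth_step_le0 t : t <= 0 -> smooth_step t = 0.
Proof. by move=> t0; rewrite /smooth_step flat_exp_le0// mul0r. Qed.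

Lemma smooth_step_ge1 t : 1 <= t -> smooth_step t = 1.
Proof.
move=> t1; rewrite /smooth_step (@flat_exp_le0 _ (1 - t)) ?subr_le0// addr0.
by rewrite divff// gt_eqF// flat_exp_gt0// (lt_le_trans _ t1).
Qed.

Lemma smooth_step_itv t : 0 <= smooth_step t <= 1.
Proof.
have d0 := smooth_step_denom_gt0 t.
rewrite /smooth_step divr_ge0 ?flat_exp_ge0//=; last exact: ltW.
by rewrite ler_pdivrMr// mul1r lerDl flat_exp_ge0.
Qed.

Lemma smooth_smooth_step t : smooth_at smooth_step t.
Proof.
have s1 : smooth_at (fun s => 1 - s) t.
  by apply: smooth_atD; [exact: smooth_at_cst|exact/smooth_atN/smooth_at_id].
have s2 := smooth_at_comp_real s1 (smooth_flat_exp 0 (1 - t)).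
apply: smooth_atM; first exact: smooth_flat_exp.
apply: smooth_atV; first by rewrite gt_eqF// smooth_step_denom_gt0.
by apply: smooth_atD => //; exact: smooth_flat_exp.
Qed.

Definition bump1 (e : R) t : R :=
  smooth_step (2 * (1 + t / e)) * smooth_step (2 * (1 - t / e)).

Lemma bump1_itv e t : 0 <= bump1 e t <= 1.
Proof.
have /andP[a0 a1] := smooth_step_itv (2 * (1 + t / e)).
have /andP[b0 b1] := smooth_step_itv (2 * (1 - t / e)).
by rewrite /bump1 mulr_ge0//= mulr_ile1.
Qed.

Lemma bump1_eq1 e t : 0 < e -> `|t| <= e / 2 -> bump1 e t = 1.
Proof.
move=> e0; rewrite ler_norml => /andP[t1 t2].
have h : - (2^-1) <= t / e <= 2^-1.
  by rewrite ler_pdivlMr// ler_pdivrMr// mulNr (mulrC 2^-1) t1 t2.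
by rewrite /bump1 !smooth_step_ge1 ?mulr1//; lra.
Qed.

Lemma bump1_eq0 e t : 0 < e -> e <= `|t| -> bump1 e t = 0.
Proof.
move=> e0; rewrite ler_normr => /orP[t1|t1]; rewrite /bump1.
  rewrite [X in _ * X]smooth_step_le0 ?mulr0//.
  by rewrite pmulr_rle0// subr_le0 ler_pdivlMr// mul1r.
rewrite smooth_step_le0 ?mul0r// pmulr_rle0//.
by rewrite -lerBrDl sub0r ler_pdivrMr// mulN1r lerNr.
Qed.

Lemma smooth_bump1 e t : smooth_at (bump1 e) t.
Proof.
have sd : smooth_at (fun s => s / e) t.
  by apply: smooth_atM; [exact: smooth_at_id|exact: smooth_at_cst].
apply: smooth_atM.
  apply: (@smooth_at_comp_real _ _ smooth_step); last exact: smooth_smooth_step.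
  by apply: smooth_atZ; apply: smooth_atD => //; exact: smooth_at_cst.
apply: (@smooth_at_comp_real _ _ smooth_step); last exact: smooth_smooth_step.
apply: smooth_atZ; apply: smooth_atD; first exact: smooth_at_cst.
exact: smooth_atN.
Qed.

End Bump1D.

Lemma mx_entry_norm_le (R : realType) m n (A : 'M[R]_(m, n)) i j :
  `|A i j| <= `|A|.
Proof.
rewrite {2}/Num.norm/= mx_normrE.
exact: (le_bigmax _ (fun ij => `|A ij.1 ij.2|) (i, j)).
Qed.

Section BumpRow.
Variables (R : realType) (n : nat).
Implicit Types (x : 'rV[R]_n).

Definition bump_row (x0 : 'rV[R]_n) (e : R) x : R :=
  \prod_k bump1 e (x 0 k - x0 0 k).

Lemma bump_row_eq1 x0 e x : 0 < e -> `|x - x0| <= e / 2 -> bump_row x0 e x = 1.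
Proof.
move=> e0 h; apply: big1 => k _; apply: bump1_eq1 => //.
by have := le_trans (mx_entry_norm_le (x - x0) 0 k) h; rewrite !mxE.
Qed.

(** The norm of a row is the largest absolute value of its entries; the factor at a coordinate
    attaining it vanishes. *)
Lemma bump_row_eq0 x0 e x : 0 < e -> e <= `|x - x0| -> bump_row x0 e x = 0.
Proof.
move=> e0 h; have : mx_norm (x - x0) != 0 by rewrite gt_eqF// (lt_le_trans e0).
move=> /mx_norm_neq0[[i k] /= E]; move: E; rewrite (ord1 i) => E.
apply/eqP; rewrite prodf_seq_eq0; apply/hasP; exists k; first exact: mem_index_enum.
rewrite /= bump1_eq0//; apply: le_trans h _.
by rewrite {1}/Num.norm/= E !mxE.
Qed.

Lemma smooth_bump_row x0 e x : smooth_at (bump_row x0 e) x.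
Proof.
apply: smooth_at_prod => k _.
apply: (@smooth_at_comp_real _ _ (bump1 e)); last exact: smooth_bump1.
apply: smooth_atD; last exact: smooth_at_cst.
exact: (smooth_at_mxP id x).1 (smooth_at_id x) 0 k.
Qed.

End BumpRow.

(** * Linear differential equations *)

(** The local equivalence makes E both relatively open and relatively closed in A. This serves
    uniqueness along intervals as well as reachability by paths. *)
Lemma connected_local (T : topologicalType) (A E : set T) (x0 : T) :
  connected A -> A x0 -> E x0 ->
  (forall x, A x -> \forall y \near x, A y -> (E x <-> E y)) -> A `<=` E.
Proof.
move=> cA Ax0 Ex0 loc; suff <- : A `&` E = A by move=> x [].
apply: cA; first by exists x0.
  exists [set y | A y -> E y]°; first exact: open_interior.
  apply/seteqP; split=> x [Ax Ex]; split=> //; last exact: interior_subset Ex Ax.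
  by apply: filterS (loc x Ax) => y /= + Ay => /(_ Ay) <-.
exists (~` [set y | A y -> ~ E y]°).
  by apply: open_closedC; exact: open_interior.
apply/seteqP; split=> x [Ax Ex]; split=> //.
  by move=> /interior_subset /(_ Ax).
apply: contrapT => nEx; apply: Ex.
by apply: filterS (loc x Ax) => y /= + Ay => /(_ Ay) <-.
Qed.

Section Gronwall.
Variable R : realType.

(** The function f(x) exp(-Kx) has nonpositive derivative. *)
Lemma gronwall (f df : R -> R) (K a b : R) : a <= b ->
  (forall x, a <= x <= b -> is_derive x 1 f (df x)) ->
  (forall x, a <= x <= b -> df x <= K * f x) ->
  f b <= f a * expR (K * (b - a)).
Proof.
move=> ab dfP dfK.
pose g x := f x * expR (- (K * x)).
have dg x : a <= x <= b ->
    is_derive x 1 g (expR (- (K * x)) * (df x - K * f x)).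
  move=> /dfP dx.
  have dl : is_derive x 1 (fun y => - (K * y)) (- K).
    have := is_deriveN (is_deriveZ K (is_derive_id x 1)).
    by rewrite /GRing.scale/= mulr1.
  have de := @is_derive1_comp _ expR (fun y => - (K * y)) x _ _
    (is_derive_expR _) dl.
  apply: (is_derive_eq (is_deriveM dx de)).
  rewrite /GRing.scale/=; ring.
suff : g b <= g a.
  rewrite /g -ler_pdivlMr ?expR_gt0// -expRN opprK -mulrA -expRD.
  by rewrite (_ : _ + _ = K * (b - a))//; ring.
have oc x : x \in `]a, b[ -> a <= x <= b.
  by rewrite in_itv/= => /andP[/ltW -> /ltW ->].
apply: (@ler0_derive1_le_cc _ g a b) => //.
- by move=> x /oc /dg [].
- move=> x /oc axb; have [_] := dg x axb; rewrite derive1E => ->.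
  by rewrite pmulr_rle0 ?expR_gt0// subr_le0 dfK.
- apply: continuous_in_subspaceT => x; rewrite inE/= in_itv/= => /dg [+ _].
  by move=> /derivable1_diffP /differentiable_continuous.
- by rewrite in_itv/= lexx ab.
- by rewrite in_itv/= lexx ab.
Qed.

Lemma gronwall_left (f df : R -> R) (K a b : R) : a <= b ->
  (forall x, a <= x <= b -> is_derive x 1 f (df x)) ->
  (forall x, a <= x <= b -> - (K * f x) <= df x) ->
  f a <= f b * expR (K * (b - a)).
Proof.
move=> ab dfP dfK.
have swap x : - b <= x <= - a -> a <= - x <= b.
  by move=> /andP[h1 h2]; rewrite lerNr h2 lerNl.
have := @gronwall (fun x => f (- x)) (fun x => - df (- x)) K (- b) (- a).
rewrite !opprK [- a + b]addrC; apply=> [|x /swap xab|x /swap xab].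
- by rewrite lerN2.
- have dN : is_derive x 1 -%R (-1) by exact: is_deriveN (is_derive_id x 1).
  by apply: (is_derive_eq (is_derive1_comp (dfP _ xab) dN)); rewrite mulrN1.
- by rewrite lerNl dfK.
Qed.

Section Sumsq.
Variables (n : nat) (h : 'I_n -> R -> R) (m : 'I_n -> 'I_n -> R -> R) (K : R).

Let phi s := \sum_l h l s ^+ 2.
Let dphi s := \sum_l 2 * h l s * \sum_k m l k s * h k s.

Lemma is_derive_sumsq (s : R) :
  (forall l, is_derive s 1 (h l) (\sum_k m l k s * h k s)) ->
  is_derive s 1 phi (dphi s).
Proof.
move=> dh; have : is_derive s 1 (\sum_l (h l ^+ 2)) (dphi s).
  by apply: is_derive_sum => l; apply: (is_derive_eq (is_deriveX 2 (dh l))).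
by rewrite fct_sumE.
Qed.

(** Each product satisfies 2|h_l h_k| <= h_l^2 + h_k^2; in the sum over all pairs every square
    occurs 2n times. *)
Lemma sumsq_derive_bound (s : R) : (forall l k, `|m l k s| <= K) ->
  `|dphi s| <= (2 * n%:R * K) * phi s.
Proof.
move=> mK.
have aux : \sum_(l < n) \sum_(k < n) K * (h l s ^+ 2 + h k s ^+ 2)
    = (2 * n%:R * K) * phi s.
  transitivity (\sum_(l < n) K * (n%:R * h l s ^+ 2 + phi s)).
    apply: eq_bigr => l _; rewrite -mulr_sumr big_split/= sumr_const card_ord.
    by rewrite mulr_natl.
  rewrite -mulr_sumr big_split/= sumr_const card_ord -mulr_sumr -/(phi s).
  by rewrite -[phi s *+ n]mulr_natl -mulrDr -[_ + phi s]mulr2n -mulr_natl; ring.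
rewrite -aux; apply: le_trans (ler_norm_sum _ _ _) _.
apply: ler_sum => l _; rewrite mulr_sumr.
apply: le_trans (ler_norm_sum _ _ _) _; apply: ler_sum => k _.
rewrite (_ : _ * _ = m l k s * (2 * h l s * h k s)); last by ring.
rewrite normrM ler_pM//.
rewrite -(real_normK (num_real (h l s))) -(real_normK (num_real (h k s))).
rewrite !normrM ger0_norm//.
have := sqr_ge0 (`|h l s| - `|h k s|).
by rewrite sqrrB; lra.
Qed.

Lemma sumsq_eq0 (s : R) : (phi s <= 0) <-> (forall l, h l s = 0).
Proof.
split=> [phi0 l|h0]; last by rewrite /phi big1// => l _; rewrite h0 expr0n.
have : phi s == 0 by rewrite eq_le phi0/= sumr_ge0// => k _; exact: sqr_ge0.
rewrite psumr_eq0; last by move=> k _; exact: sqr_ge0.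
by move=> /allP /(_ l (mem_index_enum _)); rewrite sqrf_eq0 => /eqP.
Qed.

(** The sum of squares vanishes at s1 and grows at most exponentially in both directions of time, so
    it stays 0. *)
Lemma lin_ode_eq0 (a b s1 s2 : R) :
  (forall s, a <= s <= b -> forall l, is_derive s 1 (h l) (\sum_k m l k s * h k s)) ->
  (forall s, a <= s <= b -> forall l k, `|m l k s| <= K) ->
  a <= s1 <= b -> a <= s2 <= b -> (forall l, h l s1 = 0) -> forall l, h l s2 = 0.
Proof.
move=> dh mK /andP[as1 s1b] /andP[as2 s2b] h1.
have phi1 : phi s1 = 0 by apply: big1 => l _; rewrite h1 expr0n.
apply/sumsq_eq0.
have [s12|/ltW s21] := leP s1 s2.
  have sub x : s1 <= x <= s2 -> a <= x <= b.
    by move=> /andP[x1 x2]; rewrite (le_trans as1 x1) (le_trans x2 s2b).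
  have := @gronwall phi dphi (2 * n%:R * K) s1 s2 s12; rewrite phi1 mul0r; apply.
    by move=> x /sub /dh /is_derive_sumsq.
  by move=> x /sub /mK /sumsq_derive_bound; exact/le_trans/ler_norm.
have sub x : s2 <= x <= s1 -> a <= x <= b.
  by move=> /andP[x1 x2]; rewrite (le_trans as2 x1) (le_trans x2 s1b).
have := @gronwall_left phi dphi (2 * n%:R * K) s2 s1 s21; rewrite phi1 mul0r; apply.
  by move=> x /sub /dh /is_derive_sumsq.
by move=> x /sub /mK /sumsq_derive_bound; rewrite ler_norml => /andP[].
Qed.

End Sumsq.

(* [E] is the zero set of a section that solves, in local coordinates around
   every point, a homogeneous linear equation. *)
Lemma lin_ode_unique (J E : set R) : is_interval J ->
  (forall t, J t -> exists n (h : 'I_n -> R -> R) m K,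
     \forall s \near t, J s -> [/\ E s <-> (forall l, h l s = 0),
       forall l, is_derive s 1 (h l) (\sum_k m l k s * h k s) &
       forall l k, `|m l k s| <= K]) ->
  forall t1, J t1 -> E t1 -> J `<=` E.
Proof.
move=> iJ loc t1 Jt1 Et1.
apply: connected_local Jt1 Et1 _; first exact/connected_intervalP.
move=> t Jt; have [n [h [m [K]]]] := loc t Jt.
move=> /nbhs_ballP[d /= d0 dP]; apply/nbhs_ballP; exists d => //= s sd Js.
have bt := ballxx t d0.
have H x : Num.min t s <= x <= Num.max t s -> ball t d x /\ J x.
  move=> xts; split.
    move: sd xts; rewrite /ball/= !ltr_distl.
    by case: (leP t s) => ts /andP[s1 s2] /andP[x1 x2]; apply/andP; split; lra.
  have [ts|st] := leP t s; apply: iJ.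
  - exact: Jt.
  - exact: Js.
  - by move: xts; rewrite min_l ?max_r.
  - exact: Js.
  - exact: Jt.
  - by move: xts; rewrite min_r ?max_l ?(ltW st).
have [E1 _ _] := dP t bt Jt; have [E2 _ _] := dP s sd Js.
have dh x : Num.min t s <= x <= Num.max t s ->
    forall l, is_derive x 1 (h l) (\sum_k m l k x * h k x).
  by move=> /H[bx Jx]; have [] := dP x bx Jx.
have mK x : Num.min t s <= x <= Num.max t s -> forall l k, `|m l k x| <= K.
  by move=> /H[bx Jx]; have [] := dP x bx Jx.
have tts : Num.min t s <= t <= Num.max t s by rewrite ge_min le_max !lexx.
have sts : Num.min t s <= s <= Num.max t s by rewrite ge_min le_max !lexx !orbT.
by rewrite E1 E2; split; exact: lin_ode_eq0 dh mK _ _.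
Qed.

End Gronwall.

Lemma differentiable_littleo (R : realType) (V W : normedModType R) (f : V -> W)
    (L : {linear V -> W}) x : continuous L ->
  (forall e : R, 0 < e ->
    \forall h \near 0, `|f (h + x) - f x - L h| <= e * `|h|) ->
  differentiable f x.
Proof.
move=> cL fL.
have E : f \o shift x = cst (f x) + L +o_ 0 id.
  apply/eqaddoP => e e0; apply: filterS (fL e e0) => h.
  by rewrite !fctE/= opprD addrA.
by apply/diff_locallyP; rewrite (diff_unique cL E).
Qed.

Lemma cvg_sumr (R : numFieldType) (T I : Type) (F : set_system T) (r : seq I)
    (f : I -> T -> R) (a : I -> R) : Filter F ->
  (forall i, f i t @[t --> F] --> a i) ->
  (\sum_(i <- r) f i t) @[t --> F] --> \sum_(i <- r) a i.
Proof.
move=> FF fa; elim: r => [|i r IH].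
  by rewrite big_nil; under eq_fun do rewrite big_nil; exact: cvg_cst.
by rewrite big_cons; under eq_fun do rewrite big_cons; exact: cvgD.
Qed.

Lemma continuous_at_dist (R : realType) (V W : normedModType R) (f : V -> W) x :
  (forall e : R, 0 < e -> \forall y \near x, `|f x - f y| < e) ->
  {for x, continuous f}.
Proof. by move=> h; apply/cvgrPdist_lt. Qed.

Section RowDot.
Variables (R : realType) (n : nat).
Variable g : 'I_n -> R.

(** The linear form with gradient g, made a linear map so that it can serve as a candidate
    differential. *)
Definition row_dot (w : 'rV[R]_n) : R := \sum_i w 0 i * g i.

Let row_dot_linear : linear row_dot.
Proof.
move=> c u v; rewrite /row_dot scaler_sumr -big_split/=; apply: eq_bigr => i _.
by rewrite !mxE mulrDl -mulrA.
Qed.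

HB.instance Definition _ :=
  GRing.isLinear.Build R 'rV[R]_n R *:%R row_dot row_dot_linear.

Lemma row_dot_norm_le (C : R) (w : 'rV[R]_n) : (forall i, `|g i| <= C) ->
  `|row_dot w| <= n%:R * C * `|w|.
Proof.
move=> gC; apply: le_trans (ler_norm_sum _ _ _) _.
apply: (@le_trans _ _ (\sum_(i < n) `|w| * C)).
  by apply: ler_sum => i _; rewrite normrM ler_pM// mx_entry_norm_le.
by rewrite sumr_const card_ord -[leLHS]mulr_natl [`|w| * C]mulrC mulrA.
Qed.

Lemma row_dot_continuous : continuous row_dot.
Proof.
move=> w; rewrite /row_dot; apply: (@cvg_sumr _ _ _ (nbhs w)) => i.
apply: cvgM; last exact: cvg_cst.
exact: coord_continuous.
Qed.

End RowDot.

(** * Linear first-order systems that prescribe all partial derivatives *)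

Section Pde.
Variables (R : realType) (n : nat).
Implicit Types (x w : 'rV[R]_n).

Lemma is_derive_line (f : 'rV[R]_n -> R) x w (t d : R) :
  is_derive (x + t *: w) w f d -> is_derive t 1 (fun s : R => f (x + s *: w)) d.
Proof.
have E : (fun h : R => h^-1 *: (((fun s : R => f (x + s *: w)) \o shift t) (h *: 1)
      - f (x + t *: w)))
    = fun h => h^-1 *: ((f \o shift (x + t *: w)) (h *: w) - f (x + t *: w)).
  apply/funext => h /=; congr (_ *: (f _ - _)).
  by rewrite /GRing.scale/= mulr1 -/(_ *: _) scalerDl addrCA.
by move=> [df <-]; apply: DeriveDef; rewrite /derivable /derive E.
Qed.

Lemma ball_segment x0 (r : R) x y (t : R) : 0 <= t <= 1 ->
  `|x - x0| < r -> `|y - x0| < r -> `|x + t *: (y - x) - x0| < r.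
Proof.
move=> /andP[t0 t1] xr yr.
rewrite (_ : _ - _ = (1 - t) *: (x - x0) + t *: (y - x0)); last first.
  by apply/rowP => i; rewrite !mxE; ring.
apply: le_lt_trans (ler_normD _ _) _; rewrite !normrZ !ger0_norm ?subr_ge0//.
have [->|tn0] := eqVneq t 0; first by rewrite subr0 mul1r mul0r addr0.
have tp : 0 < t by rewrite lt_neqAle eq_sym tn0.
have h1 : (1 - t) * `|x - x0| <= (1 - t) * r by rewrite ler_wpM2l ?subr_ge0// ltW.
have h2 : t * `|y - x0| < t * r by rewrite ltr_pM2l.
by apply: lt_le_trans (ler_ltD h1 h2) _; rewrite mulrBl mul1r subrK.
Qed.

Lemma MVT_line (f : 'rV[R]_n -> R) (df : 'rV[R]_n -> R) x y :
  (forall t : R, 0 <= t <= 1 ->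
    is_derive (x + t *: (y - x)) (y - x) f (df (x + t *: (y - x)))) ->
  exists2 t : R, 0 <= t <= 1 & f y - f x = df (x + t *: (y - x)).
Proof.
move=> fD; have gD t (t01 : 0 <= t <= 1) := is_derive_line (fD t t01).
have oc (t : R) : t \in `]0, 1[ -> 0 <= t <= 1.
  by rewrite in_itv/= => /andP[/ltW -> /ltW ->].
have [|c c01 E] := @MVT_segment R (fun s => f (x + s *: (y - x)))
    (fun s => df (x + s *: (y - x))) 0 1 ler01 (fun t h => gD t (oc t h)).
  apply: continuous_in_subspaceT => t; rewrite inE/= in_itv/= => /gD [+ _].
  by move=> /derivable1_diffP /differentiable_continuous.
exists c; first by move: c01; rewrite in_itv.
by move: E; rewrite scale1r scale0r addr0 [x + (y - x)]addrC subrK subr0 mulr1.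
Qed.

(** By the mean value theorem the increment of f over h is the gradient at an intermediate point
    applied to h, and near x0 that gradient is close to the one at x0. *)
Lemma C1_differentiable (f : 'rV[R]_n -> R) (G : 'I_n -> 'rV[R]_n -> R) x0 :
  (\forall x \near x0, forall w, is_derive x w f (row_dot (G^~ x) w)) ->
  (forall i, {for x0, continuous (G i)}) -> differentiable f x0.
Proof.
move=> fD cG.
apply: (@differentiable_littleo _ _ _ f (row_dot (G^~ x0))) => [|e e0].
  exact: row_dot_continuous.
(* Absorbs the factor n of [row_dot_norm_le]; n+1 instead of n because n may be 0. *)
pose e' := e / n.+1%:R.
have e'0 : 0 < e' by rewrite divr_gt0.
have : \forall x \near x0, (forall w, is_derive x w f (row_dot (G^~ x) w)) /\
    forall i, `|G i x - G i x0| <= e'.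
  suff nG : \forall x \near x0, forall i, `|G i x - G i x0| <= e'.
    by apply: filterS2 fD nG => x; split.
  apply: (@filter_forall _ _ _ (nbhs x0)) => i.
  by have /cvgrPdist_le/(_ e' e'0) := cG i; apply: filterS => x; rewrite distrC.
move=> /nbhs_ballP[r /= r0 rP]; apply/nbhs_ballP; exists r => //= h.
rewrite -ball_normE /= sub0r normrN => hr.
have [|t t01] := @MVT_line f (fun y => row_dot (G^~ y) h) x0 (h + x0).
  move=> t t01; rewrite addrK; apply: (rP _ _).1.
  rewrite -ball_normE/= opprD addrA subrr sub0r normrN normrZ.
  apply: le_lt_trans hr; case/andP: t01 => t0 t1.
  by rewrite ger0_norm// ler_piMl.
rewrite addrK => fE; rewrite fE.
rewrite (_ : _ - _ = row_dot (fun i => G i (x0 + t *: h) - G i x0) h); last first.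
  by rewrite /row_dot -sumrB; apply: eq_bigr => i _; rewrite mulrBr.
apply: (le_trans (@row_dot_norm_le R n _ e' h _)).
  apply: (rP _ _).2; rewrite -ball_normE/= opprD addrA subrr sub0r normrN normrZ.
  apply: le_lt_trans hr; case/andP: t01 => t0 t1.
  by rewrite ger0_norm// ler_piMl.
rewrite ler_wpM2r// /e' mulrCA ler_piMr ?(ltW e0)//.
by rewrite ler_pdivrMr ?ltr0n// mul1r ler_nat.
Qed.

(* Gronwall's inequality along rays bounds [s], the mean value theorem then makes
   it Lipschitz, hence C^1, and the equation propagates regularity. *)
Lemma pde_smooth m (s : 'I_m -> 'rV[R]_n -> R)
    (A : 'I_n -> 'I_m -> 'I_m -> 'rV[R]_n -> R) x0 :
  (\forall x \near x0, forall w l,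
    is_derive x w (s l) (row_dot (fun i => \sum_k A i l k x * s k x) w)) ->
  (forall i l k, smooth_at (A i l k) x0) ->
  forall l, smooth_at (s l) x0.
Proof.
move=> sD sA.
(* A common bound for all coefficients near x0: the sum dominates each value at x0, and continuity
   costs at most 1. *)
pose K := 1 + \sum_i \sum_l \sum_k `|A i l k x0|.
have leK i l k : `|A i l k x0| <= \sum_i \sum_l \sum_k `|A i l k x0|.
  rewrite (bigD1 i)//= (bigD1 l)//= (bigD1 k)//= -!addrA lerDl.
  by rewrite !addr_ge0// !sumr_ge0// => *; rewrite ?sumr_ge0// => *; rewrite ?sumr_ge0.
have : \forall x \near x0, (forall w l,
      is_derive x w (s l) (row_dot (fun i => \sum_k A i l k x * s k x) w)) /\
    (forall i l k, `|A i l k x| <= K /\ smooth_at (A i l k) x).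
  suff nA : \forall x \near x0, forall i l k, `|A i l k x| <= K /\ smooth_at (A i l k) x.
    by apply: filterS2 sD nA => x; split.
  apply: (@filter_forall _ _ _ (nbhs x0)) => i.
  apply: (@filter_forall _ _ _ (nbhs x0)) => l.
  apply: (@filter_forall _ _ _ (nbhs x0)) => k.
  apply: filterI; last exact: (smooth_at_open (sA i l k)).
  have /cvgrPdist_le/(_ 1 ltr01) := smooth_at_continuous (sA i l k).
  apply: filterS => x h; rewrite -(subrK (A i l k x0) (A i l k x)).
  by apply: le_trans (ler_normD _ _) _; rewrite lerD// distrC.
move=> /nbhs_ballP[r /= r0 rP].
have {}rP x : `|x - x0| < r -> (forall w l,
      is_derive x w (s l) (row_dot (fun i => \sum_k A i l k x * s k x) w)) /\
    (forall i l k, `|A i l k x| <= K /\ smooth_at (A i l k) x).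
  by move=> xr; apply: rP; rewrite -ball_normE/= distrC.
have K0 : 0 <= K.
  by rewrite /K addr_ge0// sumr_ge0// => *; rewrite ?sumr_ge0// => *; rewrite ?sumr_ge0.
have [S S0 bS] : exists2 S : R, 0 <= S &
    forall x l, `|x - x0| < r -> `|s l x| <= S.
  pose phi x := \sum_l s l x ^+ 2.
  (* The exponential is the Gronwall factor along a ray. The summand 1 gives S >= 1, so that a bound
     S on the square of [s l x] is also a bound on its absolute value. *)
  pose S := 1 + phi x0 * expR (2 * m%:R * (n%:R * K * r) * (1 - 0)).
  have phi0 x : 0 <= phi x by apply: sumr_ge0 => l _; exact: sqr_ge0.
  have S1 : 1 <= S by rewrite lerDl mulr_ge0// expR_ge0.
  exists S => [|x l xr]; first exact: le_trans S1.
  pose h l (t : R) := s l (x0 + t *: (x - x0)).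
  (* Restricted to the ray from x0 to x, s solves an ordinary linear equation whose matrix is A
     contracted with the direction; its entries are at most n K r. *)
  pose mm l k (t : R) := row_dot (fun i => A i l k (x0 + t *: (x - x0))) (x - x0).
  have seg (t : R) : 0 <= t <= 1 -> `|x0 + t *: (x - x0) - x0| < r.
    by move=> t01; apply: ball_segment => //; rewrite subrr normr0.
  have dh (t : R) : 0 <= t <= 1 ->
      forall l, is_derive t 1 (h l) (\sum_k mm l k t * h k t).
    move=> /seg /rP[dS _] l'; have := is_derive_line (dS (x - x0) l').
    move=> dd; apply: (is_derive_eq dd); rewrite /row_dot.
    under eq_bigr do rewrite mulr_sumr.
    rewrite exchange_big; apply: eq_bigr => k _; rewrite mulr_suml.
    by apply: eq_bigr => i _; rewrite mulrA.
  have mK (t : R) : 0 <= t <= 1 -> forall l k, `|mm l k t| <= n%:R * K * r.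
    move=> /seg /rP[_ bA] l' k; apply: le_trans (row_dot_norm_le (C := K) _ _) _.
      by move=> i; have [] := bA i l' k.
    by apply: ler_wpM2l; [exact: mulr_ge0|exact: ltW].
  have := gronwall ler01 (fun t t01 => is_derive_sumsq (dh t t01))
    (fun t t01 => le_trans (ler_norm _) (sumsq_derive_bound h (mK t t01))).
  rewrite /h scale1r scale0r addr0 [x0 + (x - x0)]addrC subrK -/(phi x) -/(phi x0) => le1.
  have : `|s l x| ^+ 2 <= S.
    rewrite real_normK ?num_real//; apply: (@le_trans _ _ (phi x)).
      by rewrite /phi (bigD1 l)//= lerDl sumr_ge0// => k _; exact: sqr_ge0.
    by apply: (le_trans le1); rewrite lerDr.
  have [//|lt1] := leP `|s l x| S; rewrite expr2 => le2.
  have : S < `|s l x| * `|s l x|.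
    apply: (lt_le_trans lt1); rewrite ler_peMl//.
    exact/(le_trans S1)/ltW.
  by rewrite ltNge le2.
have bG i l x : `|x - x0| < r -> `|\sum_k A i l k x * s k x| <= m%:R * (K * S).
  move=> xr; apply: le_trans (ler_norm_sum _ _ _) _.
  rewrite mulr_natl -[m in leRHS]card_ord -sumr_const.
  apply: ler_sum => k _; rewrite normrM ler_pM//; last exact: bS.
  by have [_ /(_ i l k)[]] := rP x xr.
pose C := n%:R * (m%:R * (K * S)).
have C0 : 0 <= C by rewrite !mulr_ge0.
(* With s bounded, its gradient is bounded, and s is Lipschitz with constant C; dividing by C + 1
   allows for C = 0. *)
have cs l x : `|x - x0| < r -> {for x, continuous (s l)}.
  move=> xr; apply: continuous_at_dist => e e0.
  have e'0 : 0 < e / (C + 1) by rewrite divr_gt0// ltr_wpDl.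
  apply: filterS (_ : nbhs x (ball x0 r `&` ball x (e / (C + 1)))); last first.
    apply: filterI; last exact: nbhsx_ballx.
    by apply: open_nbhs_nbhs; split; [exact: ball_open|rewrite -ball_normE/= distrC].
  move=> y []; rewrite -!ball_normE/= distrC => yr xy.
  have [|t t01 ->] := @MVT_line (s l)
      (fun z => row_dot (fun i => \sum_k A i l k z * s k z) (x - y)) y x.
    by move=> t t01; apply: (rP _ _).1; exact: ball_segment.
  apply: (le_lt_trans (row_dot_norm_le (C := m%:R * (K * S)) _ _)).
    by move=> i; apply: bG; exact: ball_segment.
  apply: (@le_lt_trans _ _ ((C + 1) * `|x - y|)).
    by rewrite ler_wpM2r// lerDl.
  by rewrite mulrC -ltr_pdivlMr ?ltr_wpDl.
have oB : open (ball x0 r) by exact: ball_open.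
have Br x : ball x0 r x -> `|x - x0| < r by rewrite -ball_normE/= distrC.
have cG i l x : `|x - x0| < r ->
    {for x, continuous (fun y => \sum_k A i l k y * s k y)}.
  move=> xr; apply: (@cvg_sumr _ _ _ (nbhs x)) => k; apply: cvgM; last exact: cs.
  by have [_ /(_ i l k)[_ /smooth_at_continuous]] := rP x xr.
have ds l x : ball x0 r x -> differentiable (s l) x.
  move=> Bx; apply: (@C1_differentiable (s l) (fun i y => \sum_k A i l k y * s k y)).
    apply: filterS (_ : nbhs x (ball x0 r)); last exact: open_nbhs_nbhs.
    by move=> y /Br yr w; exact: (rP y yr).1.
  by move=> i; exact/cG/Br.
have cA i l k nn : ck nn (ball x0 r) (A i l k).
  apply: open_ck => y /Br /rP[_ /(_ i l k)[_]].
  exact: nbhs_singleton.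
move=> l; apply/smooth_at_ck; exists (ball x0 r).
  by split => //; exact: ballxx.
(* The bootstrap: regularity of order [nn] of s passes to the right-hand side, which is the
   derivative of s. *)
move=> nn; elim: nn l => [|nn IH] l; split => //; do ?by move=> x; exact: ds.
move=> w; apply: (@eq_ck _ _ _ nn _
    (fun x => \sum_i w 0 i * \sum_k A i l k x * s k x)) => //.
  by move=> x /Br /rP[/(_ w l)[_ ->] _].
apply: ck_sum => // i _; apply: ckM => //; first exact: ck_cst.
by apply: ck_sum => // k _; exact: ckM.
Qed.

End Pde.

(** * Smooth functions and sections on a manifold *)

Lemma nbhs_ex_norm (R : realType) (V : normedModType R) (x : V) (P : set V) :
  nbhs x P -> exists2 r : R, 0 < r & forall y, `|y - x| < r -> P y.
Proof.
move=> /nbhs_ballP[r r0 rP]; exists r => // y; rewrite distrC => yr.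
by apply: rP; rewrite -ball_normE.
Qed.

Lemma nbhs_norm_lt (R : realType) (V : normedModType R) (x : V) (r : R) :
  0 < r -> \forall y \near x, `|y - x| < r.
Proof.
move=> r0; apply: filterS (nbhsx_ballx x r r0) => y.
by rewrite -ball_normE/= distrC.
Qed.

Section ManifoldSmooth.
Variables (R : realType) (M : manifold R).
Implicit Types (p q : M) (i j : chart_idx M).

Lemma near_in_chart_dom i p : chart_dom i p -> \forall q \near p, chart_dom i q.
Proof. by move=> ip; apply: open_nbhs_nbhs; split => //; exact: open_chart_dom. Qed.

Lemma near_chart_inv i p (P : set M) : chart_dom i p ->
  (\forall q \near p, P q) -> \forall x \near chart i p, P (chart_inv i x).
Proof.
by move=> ip nP; apply: (chart_inv_continuous ip); rewrite chartK.
Qed.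

Lemma near_chart i p (P : set 'rV[R]_(mdim M)) : chart_dom i p ->
  (\forall x \near chart i p, P x) -> \forall q \near p, P (chart i q).
Proof. by move=> ip nP; exact: (chart_continuous ip). Qed.

Lemma msmooth_near (W : normedModType R) (f g : M -> W) p :
  (\forall q \near p, f q = g q) -> msmooth_at f p -> msmooth_at g p.
Proof.
move=> fg [i ip sf]; exists i => //; apply: near_eq_smooth_at sf.
exact: (near_chart_inv ip fg).
Qed.

Lemma msmooth_chart (f : M -> R) i p : chart_dom i p -> msmooth_at f p ->
  smooth_at (f \o chart_inv i) (chart i p).
Proof.
move=> ip [j jp sf].
have sf' : smooth_at (f \o chart_inv j) ((chart j \o chart_inv i) (chart i p)).
  by rewrite /= chartK.
apply: near_eq_smooth_at (smooth_at_comp_row (chart_smooth ip jp) sf').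
by apply: filterS (near_chart_inv ip (near_in_chart_dom jp)) => x jx /=; rewrite chartK.
Qed.

Lemma msmooth_mxP a b (f : M -> 'M[R]_(a, b)) p :
  msmooth_at f p <-> forall k l, msmooth_at (fun q => f q k l) p.
Proof.
split=> [[i ip sf] k l|sf]; first by exists i => //; exact: (smooth_at_mxP _ _).1 sf k l.
exists (chart_at p); first exact: chart_atP.
by apply/smooth_at_mxP => k l; apply: msmooth_chart (sf k l); exact: chart_atP.
Qed.

Lemma msmooth_cst (W : normedModType R) (w : W) p : msmooth_at (fun=> w) p.
Proof. by exists (chart_at p); [exact: chart_atP|exact: smooth_at_cst]. Qed.

Lemma msmoothD (f g : M -> R) p : msmooth_at f p -> msmooth_at g p ->
  msmooth_at (fun q => f q + g q) p.
Proof.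
move=> sf sg; have cp := chart_atP p; exists (chart_at p) => //.
exact: smooth_atD (msmooth_chart cp sf) (msmooth_chart cp sg).
Qed.

Lemma msmoothM (f g : M -> R) p : msmooth_at f p -> msmooth_at g p ->
  msmooth_at (fun q => f q * g q) p.
Proof.
move=> sf sg; have cp := chart_atP p; exists (chart_at p) => //.
exact: smooth_atM (msmooth_chart cp sf) (msmooth_chart cp sg).
Qed.

Lemma msmooth_sum I (r : seq I) (f : I -> M -> R) p :
  (forall k, msmooth_at (f k) p) -> msmooth_at (fun q => \sum_(k <- r) f k q) p.
Proof.
move=> sf; elim: r => [|k r IH].
  by under eq_fun do rewrite big_nil; exact: msmooth_cst.
by under eq_fun do rewrite big_cons; exact: msmoothD.
Qed.

(** A bump in a chart is extended by 0. The extension is smooth because the closed coordinate ball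
    has compact image, which is closed in M by the Hausdorff property. The last clause asks for
    vanishing near each point outside N, so that products with functions smooth only on N are smooth
    everywhere. *)
Lemma manifold_bump p (N : set M) : nbhs p N ->
  exists f : M -> R, [/\ forall q, msmooth_at f q, \forall q \near p, f q = 1 &
    forall q, ~ N q -> \forall q' \near q, f q' = 0].
Proof.
move=> pN; pose i := chart_at p; have ip : chart_dom i p := chart_atP p.
pose x0 := chart i p.
have [r r0 rP] :=
  nbhs_ex_norm (filterI (near_chart_dom ip) (near_chart_inv ip pN)).
pose e := r / 2; have e0 : 0 < e by rewrite divr_gt0.
have er : e < r by rewrite ltr_pdivrMr// ltr_pMr// ltr1n.
pose B := [set x | `|x - x0| <= e].
have {}rP x : B x -> [/\ chart_dom i (chart_inv i x), chart i (chart_inv i x) = x &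
    N (chart_inv i x)].
  move=> Bx; have [] : (chart_dom i (chart_inv i x) /\ chart i (chart_inv i x) = x)
    /\ N (chart_inv i x); last by case.
  by apply: rP; rewrite (le_lt_trans Bx).
pose K := chart_inv i @` B.
have cK : closed K.
  apply: compact_closed; first exact: mfd_hausdorff.
  apply: continuous_compact.
    apply: continuous_in_subspaceT => x; rewrite inE => /rP[ix xE _].
    by have := chart_inv_continuous ix; rewrite xE.
  apply: bounded_closed_compact.
    exists (`|x0| + e); split; first exact: num_real.
    move=> C /ltW h x Bx; apply: le_trans h; rewrite -(subrK x0 x) addrC.
    by apply: le_trans (ler_normD _ _) _; rewrite lerD2l.
  rewrite (_ : B = closed_ball x0 e); first exact: closed_ball_closed.
  rewrite closed_ballE//; apply/seteqP; split=> x /=; rewrite /closed_ball_/= distrC//.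
have KD q : K q -> chart_dom i q /\ N q by move=> [x /rP[? _ ?] <-].
pose f q := if `[< chart_dom i q >] then bump_row x0 e (chart i q) else 0.
have f0 q : ~ K q -> \forall q' \near q, f q' = 0.
  move=> nKq; have : nbhs q (~` K).
    by apply: open_nbhs_nbhs; split => //; exact: closed_openC.
  apply: filterS => q' nKq'; rewrite /f; case: asboolP => // iq'.
  apply: bump_row_eq0 => //; rewrite leNgt; apply/negP => /ltW Bq'.
  by apply: nKq'; exists (chart i q') => //; rewrite chartK.
exists f; split=> [q||q nNq].
- have [iq|niq] := pselect (chart_dom i q).
    exists i => //; apply: near_eq_smooth_at (smooth_bump_row x0 e (chart i q)).
    apply: filterS (near_chart_dom iq) => x [ix xE].
    by rewrite /= /f; case: asboolP => // _; rewrite xE.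
  apply: (@msmooth_near _ (fun=> 0)); last exact: msmooth_cst.
  by apply: filterS (f0 q _) => [q' ->//|/KD[]].
- have nB : \forall x \near x0, bump_row x0 e x = 1.
    have e20 : 0 < e / 2 by rewrite divr_gt0.
    apply: filterS (nbhsx_ballx x0 _ e20) => x; rewrite -ball_normE/= distrC => /ltW.
    exact: bump_row_eq1.
  apply: filterS2 (near_in_chart_dom ip) (near_chart ip nB) => q iq.
  by rewrite /f; case: asboolP.
- by apply: f0 => /KD[].
Qed.

End ManifoldSmooth.

Section SectionsOfBundles.
Variables (R : realType) (M : manifold R) (E : vbundle M).
Implicit Types (p q : M) (i j : vb_idx E) (s t : sect E).

Lemma near_in_vb_dom i p : vb_dom i p -> \forall q \near p, vb_dom i q.
Proof. by move=> ip; apply: open_nbhs_nbhs; split => //; exact: open_vb_dom. Qed.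

Lemma vb_frame_sum i p (v : E p) : vb_dom i p ->
  v = \sum_k vb_coord E i p v 0 k *: vb_frame E i p (delta_mx 0 k).
Proof.
move=> ip; rewrite -{1}(vb_coordK ip v) {1}(row_sum_delta (vb_coord E i p v)).
by rewrite linear_sum; apply: eq_bigr => k _; rewrite linearZ.
Qed.

Lemma vb_coord_change i j p (v : E p) l : vb_dom i p ->
  vb_coord E j p v 0 l =
  \sum_k vb_coord E i p v 0 k * vb_coord E j p (vb_frame E i p (delta_mx 0 k)) 0 l.
Proof.
move=> ip; rewrite {1}(vb_frame_sum v ip) linear_sum summxE; apply: eq_bigr => k _.
by rewrite linearZ/= mxE.
Qed.

Lemma vb_coord_inj i p (v w : E p) : vb_dom i p ->
  vb_coord E i p v = vb_coord E i p w -> v = w.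
Proof. by move=> ip vw; rewrite -(vb_coordK ip v) vw vb_coordK. Qed.

(** [Gamma E s] unfolds to this condition at every point; the pointwise form also applies to
    sections smooth only on an open set, such as local frames. *)
Definition ssmooth_at s p : Prop :=
  exists2 i, vb_dom i p & msmooth_at (fun q => vb_coord E i q (s q)) p.

Lemma ssmooth_coord s i p l : vb_dom i p -> ssmooth_at s p ->
  msmooth_at (fun q => vb_coord E i q (s q) 0 l) p.
Proof.
move=> ip [j jp /msmooth_mxP sm].
have nE : \forall q \near p, \sum_k vb_coord E j q (s q) 0 k *
    vb_coord E i q (vb_frame E j q (delta_mx 0 k)) 0 l = vb_coord E i q (s q) 0 l.
  by apply: filterS (near_in_vb_dom jp) => q jq; rewrite -vb_coord_change.
apply: msmooth_near nE _; apply: msmooth_sum => k.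
apply: msmoothM; first exact: sm.
exact: (msmooth_mxP _ _).1 (vb_smooth jp ip _) _ _.
Qed.

Lemma ssmoothP s i p : vb_dom i p ->
  (forall l, msmooth_at (fun q => vb_coord E i q (s q) 0 l) p) -> ssmooth_at s p.
Proof. by move=> ip sm; exists i => //; apply/msmooth_mxP => k l; rewrite ord1. Qed.

Lemma ssmooth_near s t p : (\forall q \near p, s q = t q) ->
  ssmooth_at s p -> ssmooth_at t p.
Proof.
move=> st [i ip sm]; exists i => //; apply: msmooth_near sm.
by apply: filterS st => q ->.
Qed.

Lemma ssmooth_lin (c : R) s t p : ssmooth_at s p -> ssmooth_at t p ->
  ssmooth_at (c *: s + t) p.
Proof.
move=> ss st; have [i ip] := vb_cover E p; apply: (ssmoothP ip) => l.
have -> : (fun q => vb_coord E i q ((c *: s + t) q) 0 l) = (fun q =>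
    c * vb_coord E i q (s q) 0 l + vb_coord E i q (t q) 0 l).
  apply/funext => q; rewrite -[(c *: s + t) q]/(c *: s q + t q).
  by rewrite linearD linearZ !mxE.
apply: msmoothD; last exact: ssmooth_coord ip st.
apply: msmoothM; [exact: msmooth_cst|exact: ssmooth_coord ip ss].
Qed.

Lemma ssmooth_fscale (f : M -> R) s p : msmooth_at f p -> ssmooth_at s p ->
  ssmooth_at (fscale f s) p.
Proof.
move=> sf ss; have [i ip] := vb_cover E p; apply: (ssmoothP ip) => l.
have -> : (fun q => vb_coord E i q (fscale f s q) 0 l) =
    (fun q => f q * vb_coord E i q (s q) 0 l).
  by apply/funext => q; rewrite /fscale linearZ mxE.
by apply: msmoothM => //; exact: ssmooth_coord ip ss.
Qed.

Lemma ssmooth0 p : ssmooth_at 0 p.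
Proof.
have [i ip] := vb_cover E p; apply: (ssmoothP ip) => l.
under eq_fun do rewrite linear0 mxE; exact: msmooth_cst.
Qed.

Lemma ssmooth_local_frame i k p : vb_dom i p -> ssmooth_at (local_frame i k) p.
Proof.
move=> ip; apply: (ssmoothP ip) => l.
exact: (msmooth_mxP _ _).1 (vb_smooth ip ip _) _ _.
Qed.

Lemma Gamma_linear (c : R) s t : Gamma E s -> Gamma E t -> Gamma E (c *: s + t).
Proof. by move=> Gs Gt p; apply: ssmooth_lin; [exact: Gs|exact: Gt]. Qed.

Lemma Gamma0 : Gamma E 0.
Proof. exact: ssmooth0. Qed.

Lemma Gamma_sum I (r : seq I) (s : I -> sect E) :
  (forall k, Gamma E (s k)) -> Gamma E (\sum_(k <- r) s k).
Proof.
move=> Gs; elim: r => [|k r IH]; first by rewrite big_nil; exact: Gamma0.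
by rewrite big_cons -[s k]scale1r; exact: Gamma_linear.
Qed.

Lemma sect_sumE I (r : seq I) (s : I -> sect E) p :
  (\sum_(k <- r) s k) p = \sum_(k <- r) s k p.
Proof. by rewrite (big_morph (fun s : sect E => s p) (id1 := 0) (op1 := +%R)). Qed.

Lemma Gamma_cutoff (N : set M) (f : M -> R) s : (forall q, msmooth_at f q) ->
  (forall q, ~ N q -> \forall q' \near q, f q' = 0) ->
  (forall q, N q -> ssmooth_at s q) -> Gamma E (fscale f s).
Proof.
move=> sf f0 ss q; have [Nq|nNq] := pselect (N q).
  by apply: ssmooth_fscale => //; exact: ss.
apply: (@ssmooth_near 0); last exact: ssmooth0.
by apply: filterS (f0 q nNq) => q' fq'; rewrite /fscale fq' scale0r.
Qed.

Lemma msmooth_cutoff (N : set M) (f g : M -> R) : (forall q, msmooth_at f q) ->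
  (forall q, ~ N q -> \forall q' \near q, f q' = 0) ->
  (forall q, N q -> msmooth_at g q) -> forall q, msmooth_at (fun q => f q * g q) q.
Proof.
move=> sf f0 ss q; have [Nq|nNq] := pselect (N q).
  by apply: msmoothM => //; exact: ss.
apply: (@msmooth_near _ _ _ (fun=> 0)); last exact: msmooth_cst.
by apply: filterS (f0 q nNq) => q' fq'; rewrite fq' mul0r.
Qed.

(** This supplies the global sections from which [local_nabla] takes its value. *)
Lemma Gamma_extension s p : (\forall q \near p, ssmooth_at s q) ->
  exists2 s', Gamma E s' & \forall q \near p, s' q = s q.
Proof.
move=> /manifold_bump[f [sf f1 f0]]; exists (fscale f s).
  exact: Gamma_cutoff sf f0 _.
by apply: filterS f1 => q fq; rewrite /fscale fq scale1r.
Qed.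

End SectionsOfBundles.

(** * Locality of a connection and its expression in local frames *)

Section Nabla.
Variables (R : realType) (M : manifold R) (A : vbundle M).
Variables (rho : bundle_hom A (tangent M)) (F : vbundle M).
Variable D : connection rho F.
Implicit Types (p q : M) (X : sect A) (s : sect F).

Lemma nabla0l s : Gamma F s -> D 0 s = 0.
Proof.
move=> Gs; have := nabla_linearl D 1 (Gamma0 A) (Gamma0 A) Gs.
by rewrite !scale1r addr0 => /(congr1 (fun x => x - D 0 s)); rewrite addrK subrr => ->.
Qed.

Lemma nabla0r X : Gamma A X -> D X 0 = 0.
Proof.
move=> GX; have := nabla_linearr D 1 GX (Gamma0 F) (Gamma0 F).
by rewrite !scale1r addr0 => /(congr1 (fun x => x - D X 0)); rewrite addrK subrr => <-.
Qed.

Lemma nabla_suml I (r : seq I) (X : I -> sect A) s :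
  (forall i, Gamma A (X i)) -> Gamma F s ->
  D (\sum_(i <- r) X i) s = \sum_(i <- r) D (X i) s.
Proof.
move=> GX Gs; elim: r => [|i r IH]; first by rewrite !big_nil nabla0l.
rewrite !big_cons -[X i in LHS]scale1r nabla_linearl ?scale1r ?IH//.
exact: Gamma_sum.
Qed.

Lemma nabla_sumr I (r : seq I) X (s : I -> sect F) :
  Gamma A X -> (forall i, Gamma F (s i)) ->
  D X (\sum_(i <- r) s i) = \sum_(i <- r) D X (s i).
Proof.
move=> GX Gs; elim: r => [|i r IH]; first by rewrite !big_nil nabla0r.
rewrite !big_cons -[s i in LHS]scale1r nabla_linearr ?scale1r ?IH//.
exact: Gamma_sum.
Qed.

Lemma tangent_derive_near p (v : tangent M p) (f g : M -> R) :
  (\forall q \near p, f q = g q) -> tangent_derive v f = tangent_derive v g.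
Proof.
move=> fg; apply: near_eq_derive.
exact: near_chart_inv (chart_atP p) fg.
Qed.

Lemma tangent_derive_cst p (v : tangent M p) (c : R) :
  tangent_derive v (fun=> c) = 0.
Proof. exact: derive_cst. Qed.

Lemma tangent_derive_sum I (r : seq I) p (c : I -> R) (v : I -> tangent M p)
    (f : M -> R) : msmooth_at f p ->
  \sum_(i <- r) c i * tangent_derive (v i) f =
  tangent_derive (\sum_(i <- r) c i *: v i) f.
Proof.
move=> sf; have df := smooth_at_differentiable (msmooth_chart (chart_atP p) sf).
rewrite /tangent_derive deriveE// linear_sum; apply: eq_bigr => i _.
by rewrite deriveE// linearZ.
Qed.

(** Since f is constant near p, the derivative term of the Leibniz rule vanishes at p. *)
Lemma nabla_cutoff (f : M -> R) X s p : (forall q, msmooth_at f q) ->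
  (\forall q \near p, f q = 1) -> Gamma A X -> Gamma F s ->
  D (fscale f X) (fscale f s) p = D X s p.
Proof.
move=> sf f1 GX Gs; have fp : f p = 1 := nbhs_singleton f1.
have Gfs : Gamma F (fscale f s) by move=> q; apply: ssmooth_fscale (Gs q).
rewrite nabla_fscalel// /fscale fp scale1r nabla_leibniz//.
rewrite -[LHS]/(fscale _ s p + fscale f (D X s) p) /fscale fp scale1r.
by rewrite (tangent_derive_near _ f1) tangent_derive_cst scale0r add0r.
Qed.

(** One bump function supported where both pairs agree turns them into equal global sections,
    without changing the derivative at p. *)
Lemma nabla_local X X' s s' p : Gamma A X -> Gamma A X' -> Gamma F s -> Gamma F s' ->
  (\forall q \near p, X q = X' q) -> (\forall q \near p, s q = s' q) ->
  D X s p = D X' s' p.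
Proof.
move=> GX GX' Gs Gs' XX ss.
have [f [sf f1 f0]] := manifold_bump (filterI XX ss).
rewrite -(nabla_cutoff sf f1 GX Gs) -(nabla_cutoff sf f1 GX' Gs').
have fE q : f q = 0 \/ (X q = X' q /\ s q = s' q).
  have [?|nN] := pselect (X q = X' q /\ s q = s' q); first by right.
  by left; exact: nbhs_singleton (f0 q nN).
have -> : fscale f X = fscale f X'.
  apply: functional_extensionality_dep => q; rewrite /fscale.
  by case: (fE q) => [->|[-> _]//]; rewrite !scale0r.
congr (D _ _ p).
apply: functional_extensionality_dep => q; rewrite /fscale.
by case: (fE q) => [->|[_ ->]//]; rewrite !scale0r.
Qed.

(** By locality all extensions give the same value, so the choice made by [xget] is immaterial. *)
Lemma local_nablaE X s X' s' p : Gamma A X' -> Gamma F s' ->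
  (\forall q \near p, X' q = X q) -> (\forall q \near p, s' q = s q) ->
  local_nabla D X s p = D X' s' p.
Proof.
move=> GX Gs XX ss; apply: xget_subset1; first by exists X', s'.
move=> _ _ [X1 [s1 [GX1 Gs1 XX1 ss1 ->]]] [X2 [s2 [GX2 Gs2 XX2 ss2 ->]]].
apply: nabla_local => //.
  by apply: filterS2 XX1 XX2 => q -> ->.
by apply: filterS2 ss1 ss2 => q -> ->.
Qed.

(** Global sections extending the two frame sections near p serve for all q near p at once. Near p
    the symbol is therefore a coordinate of one smooth section. *)
Lemma christoffel_smooth i j al k l p : vb_dom i p -> vb_dom j p ->
  msmooth_at (christoffel D i j al k l) p.
Proof.
move=> ip jp.
have [X GX XE] : exists2 X', Gamma A X' & \forall q \near p, X' q = local_frame i al q.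
  apply: Gamma_extension; apply: filterS (near_in_vb_dom ip) => q.
  exact: ssmooth_local_frame.
have [s Gs sE] : exists2 s', Gamma F s' & \forall q \near p, s' q = local_frame j k q.
  apply: Gamma_extension; apply: filterS (near_in_vb_dom jp) => q.
  exact: ssmooth_local_frame.
apply: (msmooth_near _ (ssmooth_coord l jp (nabla_Gamma D GX Gs p))).
apply: filterS2 (near_join XE) (near_join sE) => q XEq sEq.
by rewrite /christoffel (local_nablaE GX Gs).
Qed.

(** The bridge from the axioms, which concern global sections, to the coordinate formula that
    defines [cov_derive]. *)
Lemma nabla_coord i j p X s l : vb_dom i p -> vb_dom j p ->
  Gamma A X -> Gamma F s ->
  vb_coord F j p (D X s p) 0 l =
    tangent_derive (rho p (X p)) (fun q => vb_coord F j q (s q) 0 l) +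
    \sum_al \sum_k vb_coord A i p (X p) 0 al * vb_coord F j p (s p) 0 k *
      christoffel D i j al k l p.
Proof.
move=> ip jp GX Gs.
have [f [sf f1 f0]] :=
  manifold_bump (filterI (near_in_vb_dom ip) (near_in_vb_dom jp)).
have fp : f p = 1 := nbhs_singleton f1.
(* After multiplication by f^2, X and s are combinations of global sections with
   global coefficients, to which the axioms of a connection apply. *)
pose eA al := fscale f (local_frame i al).
pose eF k := fscale f (local_frame j k).
pose cX al q := f q * vb_coord A i q (X q) 0 al.
pose cs k q := f q * vb_coord F j q (s q) 0 k.
have GeA al : Gamma A (eA al).
  by apply: Gamma_cutoff sf f0 _ => q [iq _]; exact: ssmooth_local_frame.
have GeF k : Gamma F (eF k).
  by apply: Gamma_cutoff sf f0 _ => q [_ jq]; exact: ssmooth_local_frame.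
have scX al q : msmooth_at (cX al) q.
  by apply: msmooth_cutoff sf f0 _ q => q [iq _]; exact: ssmooth_coord iq (GX q).
have scs k q : msmooth_at (cs k) q.
  by apply: msmooth_cutoff sf f0 _ q => q [_ jq]; exact: ssmooth_coord jq (Gs q).
have sff q : msmooth_at (fun q => f q * f q) q by exact: msmoothM.
have ff1 : \forall q \near p, f q * f q = 1.
  by apply: filterS f1 => q ->; rewrite mulr1.
have XE : fscale (fun q => f q * f q) X = \sum_al fscale (cX al) (eA al).
  apply: functional_extensionality_dep => q; rewrite sect_sumE /fscale.
  have [Nq|/f0/nbhs_singleton fq] := pselect ((vb_dom i `&` vb_dom j) q).
    rewrite {1}(vb_frame_sum (X q) Nq.1) scaler_sumr; apply: eq_bigr => al _.
    by rewrite /eA /fscale /cX !scalerA mulrAC.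
  by rewrite fq mul0r scale0r big1// => al _; rewrite /cX fq mul0r scale0r.
have sE : fscale (fun q => f q * f q) s = \sum_k fscale (cs k) (eF k).
  apply: functional_extensionality_dep => q; rewrite sect_sumE /fscale.
  have [Nq|/f0/nbhs_singleton fq] := pselect ((vb_dom i `&` vb_dom j) q).
    rewrite {1}(vb_frame_sum (s q) Nq.2) scaler_sumr; apply: eq_bigr => al _.
    by rewrite /eF /fscale /cs !scalerA mulrAC.
  by rewrite fq mul0r scale0r big1// => al _; rewrite /cs fq mul0r scale0r.
have GcX al : Gamma A (fscale (cX al) (eA al)).
  by move=> q; apply: ssmooth_fscale => //; exact: GeA.
have Gcs k : Gamma F (fscale (cs k) (eF k)).
  by move=> q; apply: ssmooth_fscale => //; exact: GeF.
have eAp al : eA al p = local_frame i al p by rewrite /eA /fscale fp scale1r.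
have eFp k : eF k p = local_frame j k p by rewrite /eF /fscale fp scale1r.
have chE al k : christoffel D i j al k l p = vb_coord F j p (D (eA al) (eF k) p) 0 l.
  rewrite /christoffel (local_nablaE (GeA al) (GeF k))//.
    by apply: filterS f1 => q fq; rewrite /eA /fscale fq scale1r.
  by apply: filterS f1 => q fq; rewrite /eF /fscale fq scale1r.
rewrite -(nabla_cutoff sff ff1 GX Gs) XE sE nabla_suml//; last exact: Gamma_sum.
rewrite sect_sumE linear_sum summxE.
transitivity (\sum_al vb_coord A i p (X p) 0 al * (tangent_derive (rho p (eA al p)) (cs l)
    + \sum_k vb_coord F j p (s p) 0 k * christoffel D i j al k l p)).
  apply: eq_bigr => al _.
  rewrite nabla_fscalel//; last exact: Gamma_sum.
  rewrite /fscale linearZ mxE /cX fp mul1r; congr (_ * _).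
  rewrite nabla_sumr// sect_sumE linear_sum summxE.
  (* The k-th frame vector has coordinates [delta_mx 0 k]: of the derivative terms in the Leibniz
     rule only k = l reaches the l-th coordinate. *)
  transitivity (\sum_k (tangent_derive (rho p (eA al p)) (cs k) * (k == l)%:R +
      vb_coord F j p (s p) 0 k * christoffel D i j al k l p)).
    apply: eq_bigr => k _; rewrite nabla_leibniz//.
    transitivity (vb_coord F j p (tangent_derive (rho p (eA al p)) (cs k) *: eF k p
      + cs k p *: D (eA al) (eF k) p) 0 l); first by [].
    rewrite linearD mxE !linearZ !mxE -chE; congr (_ * _ + _).
      by rewrite /local_frame fp mul1r vb_frameK// mxE eqxx/= eq_sym.
    by rewrite /cs fp mul1r.
  rewrite big_split/=; congr (_ + _).
  rewrite (bigD1 l)//= eqxx mulr1 big1 ?addr0// => k /negbTE ->.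
  by rewrite mulr0.
under eq_bigr do rewrite mulrDr.
rewrite big_split/=; congr (_ + _).
  rewrite tangent_derive_sum//.
  rewrite (_ : \sum_(_ <- _) _ = rho p (X p)).
    by apply: tangent_derive_near; apply: filterS f1 => q fq; rewrite /cs fq mul1r.
  rewrite [in RHS](vb_frame_sum (X p) ip) linear_sum; apply: eq_bigr => al _.
  by rewrite eAp linearZ.
apply: eq_bigr => al _; rewrite mulr_sumr; apply: eq_bigr => k _.
by rewrite mulrA.
Qed.

End Nabla.

(** * Curves in the total spaces *)

Section RelativeSmooth.
Variables (R : realType).
Implicit Types (J : set R) (t : R).

(** [smooth01_at] and [derive01] with [0,1] replaced by J. The case [I01] is that of the paths
    defining holonomy; with J the whole line, curves can be reparametrised and glued freely. *)
Definition rsmooth J (W : normedModType R) (g : R -> W) t : Prop :=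
  exists2 h : R -> W, smooth_at h t & \forall s \near t, J s -> g s = h s.

Definition rderive J (W : normedModType R) (g : R -> W) t : W :=
  lim ((s - t)^-1 *: (g s - g t) @[s --> within J t^']).

(* Limits at t within J are unique, so that [rderive] is meaningful. *)
Definition regular J t : Prop := J t /\ ProperFilter (within J t^').

(** Within J the difference quotients of g at t are those of the smooth extension h, and properness
    of the filter makes the limit unique. *)
Lemma rderiveE J (W : normedModType R) (g h : R -> W) t : regular J t ->
  smooth_at h t -> (\forall s \near t, J s -> g s = h s) ->
  rderive J g t = 'D_1 h t.
Proof.
move=> [Jt PF] sh gh; apply: cvg_lim; first exact: norm_hausdorff.
have gt : g t = h t := nbhs_singleton gh Jt.
have dh : derivable h t 1 by exact: smooth_at_derivable.
move=> N /dh; rewrite /nbhs/= /dnbhs /within/= => /nbhs_ex_norm[e e0 eN].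
apply: filterS2 gh (nbhs_norm_lt t e0) => s gs st snt Js.
have := eN (s - t); rewrite subr0 subr_eq0 => /(_ st snt).
by rewrite /= [_ *: 1]mulr1 subrK gs// gt.
Qed.

Lemma regular_interior J t : nbhs t J -> regular J t.
Proof.
move=> nJ; split; first exact: nbhs_singleton.
have -> : within J t^' = t^'; last exact: Proper_dnbhs_numFieldType.
apply/seteqP; split=> P; rewrite /dnbhs /within/= => nP.
  by apply: filterS2 nJ nP => s Js + st; exact.
by apply: filterS nP => s + st Js; exact.
Qed.

Lemma regular_I01 t : I01 t -> regular (@I01 R) t.
Proof.
move=> It; split=> //; split; last exact: within_filter.
rewrite /within/= /dnbhs/= => /nbhs_ex_norm[e e0 eN].
case/andP: (It) => t0 t1.
(* A step of length d taken inwards, to the right when t <= 1/2 and to the left otherwise, stays in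
   [0,1] and within e of t. *)
pose d := Num.min (e / 2) (1 / 2).
have d0 : 0 < d by rewrite lt_min !divr_gt0.
have de : d < e by rewrite gt_min ltr_pdivrMr// ltr_pMr// ltr1n.
have d1 : d <= 1 / 2 by rewrite ge_min lexx orbT.
have [tle|tgt] := leP t (1 / 2).
  have E : t + d - t = d by rewrite addrC addKr.
  apply: (eN (t + d)).
  - by rewrite E gtr0_norm.
  - by rewrite -subr_eq0 E gt_eqF.
  - by rewrite /I01/=; apply/andP; split; lra.
have E : t - d - t = - d by rewrite addrC addKr.
apply: (eN (t - d)).
- by rewrite E normrN gtr0_norm.
- by rewrite -subr_eq0 E oppr_eq0 gt_eqF.
- by rewrite /I01/=; apply/andP; split; lra.
Qed.

Lemma derive01E (W : normedModType R) (g : R -> W) t :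
  derive01 g t = rderive (@I01 R) g t.
Proof. by []. Qed.

Lemma rsmooth_smooth J (W : normedModType R) (g : R -> W) t :
  nbhs t J -> rsmooth J g t -> smooth_at g t.
Proof.
move=> nJ [h sh gh]; apply: near_eq_smooth_at sh.
by apply: filterS2 nJ gh => s Js ->.
Qed.

Lemma smooth_rsmooth J (W : normedModType R) (g : R -> W) t :
  smooth_at g t -> rsmooth J g t.
Proof. by move=> sg; exists g => //; near=> s. Unshelve. all: by end_near. Qed.

Lemma rderive_smooth J (W : normedModType R) (g : R -> W) t :
  nbhs t J -> smooth_at g t -> rderive J g t = 'D_1 g t.
Proof.
move=> nJ sg; apply: rderiveE => //; first exact: regular_interior.
by near=> s.
Unshelve. all: by end_near. Qed.

Lemma near_rsmooth J (W : normedModType R) (f g : R -> W) t :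
  (\forall s \near t, J s -> f s = g s) -> rsmooth J f t -> rsmooth J g t.
Proof.
move=> fg [h sh fh]; exists h => //.
by apply: filterS2 fg fh => s fgs fhs Js; rewrite -fgs// fhs.
Qed.

Lemma rderive_near J (W : normedModType R) (f g : R -> W) t : regular J t ->
  (\forall s \near t, J s -> f s = g s) -> rsmooth J f t ->
  rderive J f t = rderive J g t.
Proof.
move=> rt fg [h sh fh]; rewrite (rderiveE rt sh fh) (rderiveE rt sh)//.
by apply: filterS2 fg fh => s fgs fhs Js; rewrite -fgs// fhs.
Qed.

Lemma rsmooth_cst J (W : normedModType R) (w : W) t : rsmooth J (fun=> w) t.
Proof. exact/smooth_rsmooth/smooth_at_cst. Qed.

Lemma rderive_cst J (W : normedModType R) (w : W) t : regular J t ->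
  rderive J (fun=> w) t = 0.
Proof.
move=> rt; rewrite (rderiveE rt (h := fun=> w)) ?derive_cst//.
  exact: smooth_at_cst.
by near=> s.
Unshelve. all: by end_near. Qed.

Lemma rsmoothM J (f g : R -> R) t : rsmooth J f t -> rsmooth J g t ->
  rsmooth J (fun s => f s * g s) t.
Proof.
move=> [f' sf ff] [g' sg gg]; exists (fun s => f' s * g' s); first exact: smooth_atM.
by apply: filterS2 ff gg => s ffs ggs Js; rewrite ffs// ggs.
Qed.

Lemma rsmoothD J (f g : R -> R) t : rsmooth J f t -> rsmooth J g t ->
  rsmooth J (fun s => f s + g s) t.
Proof.
move=> [f' sf ff] [g' sg gg]; exists (fun s => f' s + g' s); first exact: smooth_atD.
by apply: filterS2 ff gg => s ffs ggs Js; rewrite ffs// ggs.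
Qed.

Lemma rsmooth_sum J I (r : seq I) (f : I -> R -> R) t :
  (forall k, rsmooth J (f k) t) -> rsmooth J (fun s => \sum_(k <- r) f k s) t.
Proof.
move=> sf; elim: r => [|k r IH].
  by under eq_fun do rewrite big_nil; exact: rsmooth_cst.
by under eq_fun do rewrite big_cons; exact: rsmoothD.
Qed.

Lemma rsmooth_coord J a b (f : R -> 'M[R]_(a, b)) t i j : rsmooth J f t ->
  rsmooth J (fun s => f s i j) t.
Proof.
move=> [h sh fh]; exists (fun s => h s i j); first exact: (smooth_at_mxP _ _).1.
by apply: filterS fh => s + Js => ->.
Qed.

Lemma rsmooth_mx J a b (f : R -> 'M[R]_(a, b)) t :
  (forall i j, rsmooth J (fun s => f s i j) t) -> rsmooth J f t.
Proof.
move=> sf; have H (ij : 'I_a * 'I_b) : exists h : R -> R, smooth_at h t /\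
    \forall s \near t, J s -> f s ij.1 ij.2 = h s.
  by have [h sh fh] := sf ij.1 ij.2; exists h.
have [h hP] := choice H.
exists (fun s => \matrix_(i, j) h (i, j) s).
  apply/smooth_at_mxP => i j; under eq_fun do rewrite mxE.
  by have [] := hP (i, j).
have : \forall s \near t, forall ij, J s -> f s ij.1 ij.2 = h ij s.
  apply: (@filter_forall _ _ (fun ij s => J s -> f s ij.1 ij.2 = h ij s) (nbhs t)) => ij.
  by have [] := hP ij.
apply: filterS => s sP Js; apply/matrixP => i j; rewrite mxE.
exact: (sP (i, j)).
Qed.

Lemma rsmooth_comp J m (g : 'rV[R]_m -> R) (f : R -> 'rV[R]_m) t : J t ->
  smooth_at g (f t) -> rsmooth J f t -> rsmooth J (g \o f) t.
Proof.
move=> Jt sg [h sh fh]; exists (g \o h).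
  by apply: smooth_at_comp_row => //; rewrite -(nbhs_singleton fh Jt).
by apply: filterS fh => s + Js => /(_ Js) /= ->.
Qed.

Lemma rsmooth_comp_mx J m a b (g : 'rV[R]_m -> 'M[R]_(a, b)) (f : R -> 'rV[R]_m) t :
  J t -> smooth_at g (f t) -> rsmooth J f t -> rsmooth J (g \o f) t.
Proof.
move=> Jt /smooth_at_mxP sg sf; apply: rsmooth_mx => i j.
exact: (rsmooth_comp Jt (sg i j) sf).
Qed.

(** Smoothness of compositions is a hypothesis so that real-valued and matrix-valued g share the
    proof. *)
Lemma rderive_comp_gen J m (W : normedModType R) (g : 'rV[R]_m -> W)
    (f : R -> 'rV[R]_m) t : regular J t ->
  smooth_at g (f t) -> rsmooth J f t ->
  (forall h : R -> 'rV[R]_m, smooth_at h t -> smooth_at g (h t) ->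
    smooth_at (g \o h) t) ->
  rderive J (g \o f) t = 'D_(rderive J f t) g (f t).
Proof.
move=> rt sg [h sh fh] sgh; have [Jt _] := rt.
have ft : f t = h t := nbhs_singleton fh Jt.
rewrite (rderiveE rt sh fh) ft.
rewrite ft in sg; have dg := smooth_at_differentiable sg.
have dh := smooth_at_differentiable sh.
rewrite (rderiveE rt (sgh h sh sg)); last by apply: filterS fh => s + Js /= => ->.
rewrite (deriveE (1 : R) (differentiable_comp dh dg)) (diff_comp dh dg).
by rewrite (deriveE (1 : R) dh) (deriveE _ dg).
Qed.

Lemma rderive_comp J m (g : 'rV[R]_m -> R)
    (f : R -> 'rV[R]_m) t : regular J t ->
  smooth_at g (f t) -> rsmooth J f t ->
  rderive J (g \o f) t = 'D_(rderive J f t) g (f t).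
Proof.
by move=> rt sg sf; apply: rderive_comp_gen => // h; exact: smooth_at_comp_row.
Qed.

Lemma rderive_comp_mx J m a b (g : 'rV[R]_m -> 'M[R]_(a, b))
    (f : R -> 'rV[R]_m) t : regular J t ->
  smooth_at g (f t) -> rsmooth J f t ->
  rderive J (g \o f) t = 'D_(rderive J f t) g (f t).
Proof.
by move=> rt sg sf; apply: rderive_comp_gen => // h; exact: smooth_at_comp_row_mx.
Qed.

End RelativeSmooth.

(** * Paths and parallel sections at a point of time; uniqueness *)

Section Paths.
Variables (R : realType) (M : manifold R) (A : vbundle M).
Variables (rho : bundle_hom A (tangent M)) (F : vbundle M).
Variable D : connection rho F.
Implicit Types (J : set R) (t : R).

(* Curves in the total spaces of A and of the sum of A and F; the base curve
   being part of the data, they can be compared and glued without casts. *)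
Definition totA : Type := {x : M & A x}.
Definition totAF : Type := {x : M & (A x * F x)%type}.
Definition forget (z : totAF) : totA :=
  existT (fun x => A x : Type) (projT1 z) (projT2 z).1.
Implicit Types (g : R -> totA) (z : R -> totAF).

Definition acoord i (g : totA) := vb_coord A i (projT1 g) (projT2 g).
Definition fcoord j (z : totAF) := vb_coord F j (projT1 z) (projT2 z).2.

(** The conditions on an A-path, localised at one time t and relative to J. The first field is
    continuity of the base curve at t. One chart and one trivialisation are asked for; [path_chart]
    and [path_acoord] pass to all others. *)
Record path_at J g t : Prop := PathAt {
  path_near : forall N, nbhs (projT1 (g t)) N ->
    \forall s \near t, J s -> N (projT1 (g s));
  path_has_chart : exists2 i, chart_dom i (projT1 (g t)) &
    rsmooth J (fun s => chart i (projT1 (g s))) t;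
  path_has_coord : exists2 i, vb_dom i (projT1 (g t)) &
    rsmooth J (fun s => acoord i (g s)) t;
  path_anchor : rho _ (projT2 (g t)) =
    rderive J (fun s => chart (chart_at (projT1 (g t))) (projT1 (g s))) t }.

(** The matrix of the parallel equation solved for the derivative of u, whence the sign. *)
Definition conn_mx i j l k (g : totA) : R :=
  - \sum_al acoord i g 0 al * christoffel D i j al k l (projT1 g).

Record par_at J z t : Prop := ParAt {
  par_path : path_at J (forget \o z) t;
  par_has_coord : exists2 j, vb_dom j (projT1 (z t)) &
    rsmooth J (fun s => fcoord j (z s)) t;
  par_eq : forall i j, vb_dom i (projT1 (z t)) -> vb_dom j (projT1 (z t)) ->
    forall l, rderive J (fun s => fcoord j (z s) 0 l) t =
      \sum_k conn_mx i j l k (forget (z t)) * fcoord j (z t) 0 k }.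

Lemma path_chart J g t i : J t -> path_at J g t -> chart_dom i (projT1 (g t)) ->
  rsmooth J (fun s => chart i (projT1 (g s))) t.
Proof.
move=> Jt pg ip; have [k kp sk] := path_has_chart pg.
have := rsmooth_comp_mx Jt (chart_smooth kp ip) sk; apply: near_rsmooth.
apply: filterS (path_near pg (near_in_chart_dom kp)) => s ks Js.
by rewrite /= chartK//; exact: ks.
Qed.

Lemma path_msmooth J g t (f : M -> R) : J t -> path_at J g t ->
  msmooth_at f (projT1 (g t)) -> rsmooth J (fun s => f (projT1 (g s))) t.
Proof.
move=> Jt pg sf; have kp := chart_atP (projT1 (g t)).
have := rsmooth_comp Jt (msmooth_chart kp sf) (path_chart Jt pg kp).
apply: near_rsmooth; apply: filterS (path_near pg (near_in_chart_dom kp)) => s ks Js.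
by rewrite /= chartK//; exact: ks.
Qed.

(** The transition functions of E are smooth on M, hence smooth along the base curve. *)
Lemma rsmooth_coord_change (E : vbundle M) J g t (v : forall s, E (projT1 (g s))) i j l :
  J t -> path_at J g t -> vb_dom i (projT1 (g t)) -> vb_dom j (projT1 (g t)) ->
  rsmooth J (fun s => vb_coord E i _ (v s)) t ->
  rsmooth J (fun s => vb_coord E j _ (v s) 0 l) t.
Proof.
move=> Jt pg ip jp sv.
have : rsmooth J (fun s => \sum_k vb_coord E i _ (v s) 0 k *
    vb_coord E j (projT1 (g s)) (vb_frame E i (projT1 (g s)) (delta_mx 0 k)) 0 l) t.
  apply: rsmooth_sum => k; apply: rsmoothM; first exact: rsmooth_coord.
  pose f q := vb_coord E j q (vb_frame E i q (delta_mx 0 k)) 0 l.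
  apply: (path_msmooth (f := f) Jt pg).
  exact: (msmooth_mxP _ _).1 (vb_smooth ip jp _) _ _.
apply: near_rsmooth; apply: filterS (path_near pg (near_in_vb_dom ip)) => s is_ Js.
by rewrite -vb_coord_change//; exact: is_.
Qed.

Lemma path_acoord J g t i l : J t -> path_at J g t -> vb_dom i (projT1 (g t)) ->
  rsmooth J (fun s => acoord i (g s) 0 l) t.
Proof.
move=> Jt pg ip; have [k kp sk] := path_has_coord pg.
exact: (@rsmooth_coord_change A J g t (fun s => projT2 (g s)) k i l Jt pg kp ip).
Qed.

Lemma par_fcoord J z t j l : J t -> par_at J z t -> vb_dom j (projT1 (z t)) ->
  rsmooth J (fun s => fcoord j (z s) 0 l) t.
Proof.
move=> Jt pz jp; have [k kp sk] := par_has_coord pz.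
exact: (@rsmooth_coord_change F J (forget \o z) t (fun s => (projT2 (z s)).2)
  k j l Jt (par_path pz) kp jp).
Qed.

Lemma path_conn_mx J g t i j l k : J t -> path_at J g t ->
  vb_dom i (projT1 (g t)) -> vb_dom j (projT1 (g t)) ->
  rsmooth J (fun s => conn_mx i j l k (g s)) t.
Proof.
move=> Jt pg ip jp; rewrite /conn_mx; under eq_fun do rewrite -mulN1r.
apply: rsmoothM; first exact: rsmooth_cst.
apply: rsmooth_sum => al; apply: rsmoothM; first exact: path_acoord.
exact: (path_msmooth Jt pg (christoffel_smooth D al k l ip jp)).
Qed.

Lemma path_at_near J g g' t : regular J t -> (\forall s \near t, J s -> g s = g' s) ->
  path_at J g t -> path_at J g' t.
Proof.
move=> rt gg pg; have [Jt _] := rt.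
have gt : g t = g' t := nbhs_singleton gg Jt.
split.
- move=> N; rewrite -gt => /(path_near pg) nN.
  by apply: filterS2 gg nN => s gs Ns Js; rewrite -gs//; exact: Ns.
- have [i ip si] := path_has_chart pg; exists i; first by rewrite -gt.
  apply: near_rsmooth si.
  by apply: filterS gg => s gs Js; rewrite gs.
- have [i ip si] := path_has_coord pg; exists i; first by rewrite -gt.
  apply: near_rsmooth si.
  by apply: filterS gg => s gs Js; rewrite gs.
- rewrite -gt (path_anchor pg); apply: rderive_near => //.
    by apply: filterS gg => s gs Js; rewrite gs.
  by apply: path_chart => //; exact: chart_atP.
Qed.

Lemma par_at_near J z z' t : regular J t -> (\forall s \near t, J s -> z s = z' s) ->
  par_at J z t -> par_at J z' t.
Proof.
move=> rt zz pz; have [Jt _] := rt.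
have zt : z t = z' t := nbhs_singleton zz Jt.
split.
- apply: path_at_near (par_path pz) => //.
  by apply: filterS zz => s zs Js /=; rewrite zs.
- have [j jp sj] := par_has_coord pz; exists j; first by rewrite -zt.
  apply: near_rsmooth sj.
  by apply: filterS zz => s zs Js; rewrite zs.
- move=> i j; rewrite -zt => ip jp l; rewrite -(par_eq pz ip jp).
  apply/esym/rderive_near => //.
    by apply: filterS zz => s zs Js; rewrite zs.
  exact: par_fcoord.
Qed.

Lemma totAF_eq j (z z' : totAF) : vb_dom j (projT1 z) -> forget z = forget z' ->
  fcoord j z = fcoord j z' -> z = z'.
Proof.
case: z z' => [x [a u]] [y [b w]] /= jx E.
have xy : x = y := congr1 (@projT1 _ _) E.
case: y / xy b w E => b w E.
have -> : a = b := eq_from_Tagged E.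
by rewrite /fcoord/= => /(vb_coord_inj jx) ->.
Qed.

(** J0 is the set relative to which derivatives are taken, J an interval in it over which both
    curves lie above the same A-path. In a trivialisation the difference of the fibre coordinates
    solves the homogeneous equation with matrix [conn_mx], and its zeros are the times at which the
    curves agree. *)
Lemma par_unique J0 J z z' t1 : is_interval J ->
  (forall t, J t -> regular J0 t) ->
  (forall t, J t -> [/\ par_at J0 z t, par_at J0 z' t & forget (z t) = forget (z' t)]) ->
  J t1 -> z t1 = z' t1 -> forall t, J t -> z t = z' t.
Proof.
move=> iJ rJ zz Jt1 z1.
apply: (lin_ode_unique (J := J) (E := fun t => z t = z' t) iJ _ Jt1 z1).
move=> t Jt; have [J0t _] := rJ t Jt; have [pz pz' fz] := zz t Jt.
have [i ip] := vb_cover A (projT1 (z t)).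
have [j jp] := vb_cover F (projT1 (z t)).
have jp' : vb_dom j (projT1 (z' t)) by rewrite -[projT1 _]/(projT1 (forget (z' t))) -fz.
have hP l : exists h : R -> R, smooth_at h t /\
    \forall s \near t, J0 s -> fcoord j (z s) 0 l = h s.
  by have [h sh hE] := par_fcoord l J0t pz jp; exists h.
have hP' l : exists h : R -> R, smooth_at h t /\
    \forall s \near t, J0 s -> fcoord j (z' s) 0 l = h s.
  by have [h sh hE] := par_fcoord l J0t pz' jp'; exists h.
have mP (lk : 'I_(vrank F) * 'I_(vrank F)) : exists m : R -> R, smooth_at m t /\
    \forall s \near t, J0 s -> conn_mx i j lk.1 lk.2 (forget (z s)) = m s.
  by have [m sm mE] := path_conn_mx lk.1 lk.2 J0t (par_path pz) ip jp; exists m.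
have [h hh] := choice hP; have [h' hh'] := choice hP'; have [m hm] := choice mP.
(* Near t each entry of the matrix is bounded by its own summand, by continuity with tolerance 1. *)
pose K : R := \sum_(lk : 'I_(vrank F) * 'I_(vrank F)) (`|m lk t| + 1).
exists (vrank F), (fun l s => h l s - h' l s), (fun l k => m (l, k)), K.
have n1 : \forall s \near t, forall l, smooth_at (h l) s /\
    \forall s' \near s, J0 s' -> fcoord j (z s') 0 l = h l s'.
  apply: (@filter_forall _ _ _ (nbhs t)) => l; have [sh hE] := hh l.
  by apply: filterI; [exact: smooth_at_open sh|exact: near_join hE].
have n2 : \forall s \near t, forall l, smooth_at (h' l) s /\
    \forall s' \near s, J0 s' -> fcoord j (z' s') 0 l = h' l s'.
  apply: (@filter_forall _ _ _ (nbhs t)) => l; have [sh hE] := hh' l.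
  by apply: filterI; [exact: smooth_at_open sh|exact: near_join hE].
have n3 : \forall s \near t, forall lk, `|m lk s| <= K /\
    (J0 s -> conn_mx i j lk.1 lk.2 (forget (z s)) = m lk s).
  apply: (@filter_forall _ _ _ (nbhs t)) => lk; have [sm mE] := hm lk.
  apply: filterI mE; have /cvgrPdist_le/(_ 1 ltr01) := smooth_at_continuous sm.
  apply: filterS => s hs; apply: (@le_trans _ _ (`|m lk t| + 1)).
    rewrite -(subrK (m lk t) (m lk s)) addrC.
    by apply: le_trans (ler_normD _ _) _; rewrite lerD2l distrC.
  rewrite /K (bigD1 lk)//= lerDl sumr_ge0// => ? _; exact: addr_ge0.
have n4 := path_near (par_path pz) (near_in_vb_dom ip).
have n5 := path_near (par_path pz) (near_in_vb_dom jp).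
near=> s => Js; have rs := rJ s Js; have [J0s _] := rs.
have [qz qz' fzs] := zz s Js.
have is_ : vb_dom i (projT1 (z s)) by move: J0s; near: s.
have js : vb_dom j (projT1 (z s)) by move: J0s; near: s.
have js' : vb_dom j (projT1 (z' s)) by rewrite -[projT1 _]/(projT1 (forget (z' s))) -fzs.
have is' : vb_dom i (projT1 (z' s)) by rewrite -[projT1 _]/(projT1 (forget (z' s))) -fzs.
have s1 : forall l, smooth_at (h l) s /\
    \forall s' \near s, J0 s' -> fcoord j (z s') 0 l = h l s' by near: s.
have s2 : forall l, smooth_at (h' l) s /\
    \forall s' \near s, J0 s' -> fcoord j (z' s') 0 l = h' l s' by near: s.
have s3 : forall lk, `|m lk s| <= K /\
    (J0 s -> conn_mx i j lk.1 lk.2 (forget (z s)) = m lk s) by near: s.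
have hs l : fcoord j (z s) 0 l = h l s by have [_ /nbhs_singleton] := s1 l; exact.
have hs' l : fcoord j (z' s) 0 l = h' l s by have [_ /nbhs_singleton] := s2 l; exact.
split.
- split=> [zE l|hz]; first by rewrite -hs -hs' zE subrr.
  apply: totAF_eq js fzs _; apply/rowP => l; rewrite hs hs'.
  by apply/eqP; rewrite -subr_eq0; apply/eqP.
- move=> l; have [sl hl] := s1 l; have [sl' hl'] := s2 l.
  apply: DeriveDef; first by apply: derivableB; exact: smooth_at_derivable.
  transitivity ('D_1 (h l) s - 'D_1 (h' l) s).
    by apply: (@deriveB _ _ _ (h l)); exact: smooth_at_derivable.
  rewrite -(rderiveE rs sl hl) -(rderiveE rs sl' hl').
  rewrite (par_eq qz is_ js) (par_eq qz' is' js') -fzs -sumrB.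
  by apply: eq_bigr => k _; rewrite -mulrBr hs hs' (s3 (l, k)).2.
- by move=> l k; exact: (s3 (l, k)).1.
Unshelve. all: by end_near. Qed.

End Paths.

Arguments forget {R M A F} z.

(** * Reparametrisation, reversal and concatenation of paths *)

Section FlatPaths.
Variables (R : realType) (M : manifold R) (A : vbundle M).
Variables (rho : bundle_hom A (tangent M)) (F : vbundle M).
Variable D : connection rho F.
Implicit Types (t : R) (x y : M).
Local Notation TA := (totA A).
Local Notation TAF := (totAF A F).
Implicit Types (g : R -> TA) (z : R -> TAF).
Local Notation path_at := (path_at rho).
Local Notation par_at := (par_at D).
Local Notation U := [set: R].

Definition mkA x (a : A x) : TA := existT (fun x => A x : Type) x a.
Definition mkAF x (a : A x) (u : F x) : TAF :=
  existT (fun x => (A x * F x)%type) x (a, u).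

(** The chain rule puts the factor ['D_1 phi t] on the velocity, hence on the component in A. A
    parallel section above the path is merely composed with phi, because the parallel equation is
    linear in a. *)
Definition rep (phi : R -> R) g t : TA :=
  mkA ('D_1 phi t *: projT2 (g (phi t))).
Definition repz (phi : R -> R) z t : TAF :=
  mkAF ('D_1 phi t *: (projT2 (z (phi t))).1) (projT2 (z (phi t))).2.

Lemma regularT t : regular U t.
Proof. by apply: regular_interior; exact: filterT. Qed.
#[local] Hint Resolve regularT : core.

Lemma derive_comp_real (W : normedModType R) (f : R -> W) (phi : R -> R) t :
  differentiable phi t -> differentiable f (phi t) ->
  'D_1 (f \o phi) t = 'D_1 phi t *: 'D_1 f (phi t).
Proof.
move=> dp df; rewrite (deriveE _ (differentiable_comp dp df)) (diff_comp dp df)/=.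
by rewrite (deriveE _ dp) (deriveE _ df) -linearZ/= [_ *: 1]mulr1.
Qed.

Lemma rep_path phi g t : smooth_at phi t -> path_at U g (phi t) ->
  path_at U (rep phi g) t.
Proof.
move=> sphi pg; split.
- move=> N /(path_near pg) nN.
  have : \forall s \near t, U (phi s) -> N (projT1 (g (phi s))).
    exact: (smooth_at_continuous sphi nN).
  by apply: filterS => s /(_ I).
- have [i ip si] := path_has_chart pg; exists i => //; apply: smooth_rsmooth.
  have sc : smooth_at (fun s => chart i (projT1 (g s))) (phi t).
    by apply: rsmooth_smooth si; exact: filterT.
  exact: (smooth_at_comp_real_mx sphi sc).
- have [i ip si] := path_has_coord pg; exists i => //; apply: smooth_rsmooth.
  have sc : smooth_at (fun s => acoord i (g s)) (phi t).
    by apply: rsmooth_smooth si; exact: filterT.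
  have := smooth_at_scalemx (smooth_at_derive (1 : R) sphi) (smooth_at_comp_real_mx sphi sc).
  by congr smooth_at; apply/funext => s; rewrite /rep /acoord/= linearZ.
- rewrite /rep/= linearZ/= (path_anchor pg).
  set k := chart_at _.
  have sc : smooth_at (fun s => chart k (projT1 (g s))) (phi t).
    by apply: rsmooth_smooth (path_chart _ pg _); [exact: filterT| |exact: chart_atP].
  rewrite (rderive_smooth _ sc); last exact: filterT.
  rewrite (rderive_smooth _ (smooth_at_comp_real_mx sphi sc)); last exact: filterT.
  by rewrite (derive_comp_real (smooth_at_differentiable sphi) (smooth_at_differentiable sc)).
Qed.

Lemma repz_par phi z t : smooth_at phi t -> par_at U z (phi t) ->
  par_at U (repz phi z) t.
Proof.
move=> sphi pz; split.
- exact: (rep_path sphi (par_path pz)).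
- have [j jp sj] := par_has_coord pz; exists j => //; apply: smooth_rsmooth.
  have sc : smooth_at (fun s => fcoord j (z s)) (phi t).
    by apply: rsmooth_smooth sj; exact: filterT.
  exact: (smooth_at_comp_real_mx sphi sc).
- move=> i j ip jp l.
  have sc : smooth_at (fun s => fcoord j (z s) 0 l) (phi t).
    by apply: rsmooth_smooth (par_fcoord _ _ pz _) => //; exact: filterT.
  have := par_eq pz ip jp l; rewrite (rderive_smooth _ sc); last exact: filterT.
  rewrite (rderive_smooth _ (smooth_at_comp_real sphi sc)); last exact: filterT.
  rewrite (derive_comp_real (smooth_at_differentiable sphi) (smooth_at_differentiable sc)).
  move=> ->; rewrite scaler_sumr; apply: eq_bigr => k _.
  rewrite /conn_mx /= /GRing.scale/= mulrA mulrN mulr_sumr; congr (- _ * _).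
  by apply: eq_bigr => al _; rewrite /acoord/= linearZ mxE mulrA.
Qed.

Lemma const_path J x t : regular J t -> path_at J (fun=> mkA (0 : A x)) t.
Proof.
move=> rt; split.
- by move=> N /= nN; near=> s => _; exact: nbhs_singleton nN.
- by exists (chart_at x); [exact: chart_atP|exact: rsmooth_cst].
- by have [i ip] := vb_cover A x; exists i => //; exact: rsmooth_cst.
- by rewrite /= linear0 rderive_cst.
Unshelve. all: by end_near. Qed.

Lemma const_par J x (v : F x) t : regular J t ->
  par_at J (fun=> mkAF (0 : A x) v) t.
Proof.
move=> rt; split; first exact: const_path.
- by have [j jp] := vb_cover F x; exists j => //; exact: rsmooth_cst.
- move=> i j ip jp l; rewrite rderive_cst// big1// => k _.
  rewrite /conn_mx big1 ?oppr0 ?mul0r// => al _.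
  by rewrite /acoord/= linear0 mxE mul0r.
Qed.

(* Paths at rest near both ends have smooth concatenations. *)
Definition path_ends T (g : R -> T) (a b : T) : Prop :=
  exists e : R, [/\ 0 < e, forall t, t < e -> g t = a & forall t, 1 - e < t -> g t = b].

Definition flat_path g x y : Prop :=
  (forall t, path_at U g t) /\ path_ends g (mkA (0 : A x)) (mkA (0 : A y)).

Definition flat_lift z x (v : F x) y (w : F y) : Prop :=
  (forall t, par_at U z t) /\ path_ends z (mkAF (0 : A x) v) (mkAF (0 : A y) w).

Lemma path_ends0 T (g : R -> T) a b : path_ends g a b -> g 0 = a.
Proof. by move=> [e [e0 ga _]]; exact: ga. Qed.

Lemma path_ends1 T (g : R -> T) a b : path_ends g a b -> g 1 = b.
Proof. by move=> [e [e0 _ gb]]; apply: gb; rewrite ltrBlDr ltrDl. Qed.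

Lemma flat_lift_path z x (v : F x) y (w : F y) : flat_lift z v w ->
  flat_path (forget \o z) x y.
Proof.
move=> [pz [e [e0 za zb]]]; split=> [t|]; first exact: par_path (pz t).
by exists e; split=> // t te /=; [rewrite za|rewrite zb].
Qed.

Lemma smooth_affine (a b t : R) : smooth_at (fun s => a * s + b) t.
Proof.
apply: smooth_atD; last exact: smooth_at_cst.
by apply: smooth_atZ; exact: smooth_at_id.
Qed.

Lemma derive_affine (a b t : R) : 'D_1 (fun s => a * s + b) t = a.
Proof.
have : is_derive t 1 (fun s : R => a * s + b) (a *: 1 + 0).
  by apply: is_deriveD.
by case=> _ ->; rewrite addr0 [_ *: _]mulr1.
Qed.

Lemma rep_affineE (a b : R) g t :
  rep (fun s => a * s + b) g t = mkA (a *: projT2 (g (a * t + b))).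
Proof. by rewrite /rep derive_affine. Qed.

Lemma repz_affineE (a b : R) z t :
  repz (fun s => a * s + b) z t =
  mkAF (a *: (projT2 (z (a * t + b))).1) (projT2 (z (a * t + b))).2.
Proof. by rewrite /repz derive_affine. Qed.

Definition path_rev g := rep (fun s => -1 * s + 1) g.

Definition path_cat g g' t :=
  if t < 1 / 2 then rep (fun s => 2 * s + 0) g t
  else rep (fun s => 2 * s + - 1) g' t.

Lemma flat_const x : flat_path (fun=> mkA (0 : A x)) x x.
Proof. by split=> [t|]; [exact: const_path|exists 1; split]. Qed.

Lemma flat_rev g x y : flat_path g x y -> flat_path (path_rev g) y x.
Proof.
move=> [pg [e [e0 ga gb]]]; split=> [t|].
  by apply: rep_path; [exact: smooth_affine|exact: pg].
exists e; split=> // t te; rewrite /path_rev rep_affineE mulN1r.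
  by rewrite gb /= ?scaler0//; lra.
by rewrite ga /= ?scaler0//; lra.
Qed.

(** Around the time 1/2 both halves rest at y, so the concatenation is constant there; at all other
    times it is locally a reparametrisation of one half. *)
Lemma flat_cat g g' x y w : flat_path g x y -> flat_path g' y w ->
  flat_path (path_cat g g') x w.
Proof.
move=> [pg [e [e0 ga gb]]] [pg' [e' [e'0 ga' gb']]].
(* Times within d of 1/2 are sent within 2d, hence within e and e', of the junction. The bound 2d <=
   1/2 keeps the times t < d in the first half and those with t > 1 - d in the second. *)
pose d := Num.min (Num.min e e') (1 / 2) / 2.
have d0 : 0 < d by rewrite divr_gt0// !lt_min e0 e'0 divr_gt0.
have d2 : 2 * d = Num.min (Num.min e e') (1 / 2) by rewrite mulrC divfK.
have de : 2 * d <= e by rewrite d2 !ge_min lexx.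
have de' : 2 * d <= e' by rewrite d2 !ge_min lexx orbT.
have dh : 2 * d <= 1 / 2 by rewrite d2 !ge_min lexx !orbT.
have mid s : `|s - 1 / 2| < d -> path_cat g g' s = mkA (0 : A y).
  rewrite ltr_norml => /andP[s1 s2].
  rewrite /path_cat; case: ltP => sh; rewrite rep_affineE.
    by rewrite gb /= ?scaler0//; lra.
  by rewrite ga' /= ?scaler0//; lra.
split=> [t|].
  have [th|th|th] := ltgtP t (1 / 2).
  - apply: (@path_at_near _ _ _ _ _ (rep (fun s => 2 * s + 0) g)) => //.
      by apply: filterS (lt_nbhsl th) => s sh _; rewrite /path_cat sh.
    by apply: rep_path; [exact: smooth_affine|exact: pg].
  - apply: (@path_at_near _ _ _ _ _ (rep (fun s => 2 * s + - 1) g')) => //.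
      by apply: filterS (lt_nbhsr th) => s sh _; rewrite /path_cat ltNge (ltW sh).
    by apply: rep_path; [exact: smooth_affine|exact: pg'].
  - apply: (@path_at_near _ _ _ _ _ (fun=> mkA (0 : A y))) => //; last exact: const_path.
    by apply: filterS (nbhs_norm_lt t d0) => s; rewrite th => /mid ->.
exists d; split=> // t td; rewrite /path_cat.
  rewrite ifT; last by lra.
  by rewrite rep_affineE ga /= ?scaler0//; lra.
rewrite ifF; last by apply/negbTE; rewrite -leNgt; lra.
by rewrite rep_affineE gb' /= ?scaler0//; lra.
Qed.

Lemma path_cat_half g g' x y w : flat_path g x y -> flat_path g' y w ->
  path_cat g g' (1 / 2) = mkA (0 : A y).
Proof.
move=> _ [_ g'e]; have g'0 := path_ends0 g'e; rewrite /path_cat ltxx rep_affineE.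
by rewrite (_ : 2 * (1 / 2) + - 1 = 0) ?g'0 /= ?scaler0//; lra.
Qed.

(** At 1/2 itself [path_cat] takes its second branch; equality persists because both branches are
    the zero vector over y. Including this time lets uniqueness on the half line reach the
    junction. *)
Lemma path_cat_left g g' x y w t : flat_path g x y -> flat_path g' y w ->
  t <= 1 / 2 -> path_cat g g' t = rep (fun s => 2 * s + 0) g t.
Proof.
move=> fg fg'; rewrite le_eqVlt => /predU1P[->|th]; last by rewrite /path_cat th.
rewrite (path_cat_half fg fg') rep_affineE.
have [_ ge] := fg; have g1 := path_ends1 ge.
by rewrite (_ : 2 * (1 / 2) + 0 = 1) ?g1 /= ?scaler0//; lra.
Qed.

Lemma path_cat_right g g' t : 1 / 2 <= t ->
  path_cat g g' t = rep (fun s => 2 * s + - 1) g' t.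
Proof. by move=> th; rewrite /path_cat ltNge th. Qed.

(** The lift is run through a time change going from 0 to t1. The argument 2t - 1/2 of the step
    makes it constant for t < 1/4 and for t > 3/4, so the new lift is flat again. *)
Lemma flat_lift_stop z x (v : F x) y (w : F y) t1 : flat_lift z v w ->
  exists z', flat_lift z' v (projT2 (z t1)).2.
Proof.
move=> [pz zE]; pose phi t : R := t1 * smooth_step (2 * t + - (1 / 2)).
have sphi t : smooth_at phi t.
  apply: smooth_atZ; apply: (@smooth_at_comp_real _ _ (@smooth_step R)).
    exact: smooth_affine.
  exact: smooth_smooth_step.
exists (repz phi z); split=> [t|]; first exact: repz_par.
exists (1 / 4); split=> [|t th|t th]; first by rewrite divr_gt0.
  have np : \forall s \near t, (fun=> 0) s = phi s.
    apply: filterS (lt_nbhsl th) => s sh; rewrite /phi smooth_step_le0 ?mulr0//; lra.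
  rewrite /repz -(near_eq_derive _ np) derive_cst -(nbhs_singleton np).
  by rewrite scale0r (path_ends0 zE).
have np : \forall s \near t, (fun=> t1) s = phi s.
  apply: filterS (lt_nbhsr th) => s sh; rewrite /phi smooth_step_ge1 ?mulr1//; lra.
by rewrite /repz -(near_eq_derive _ np) derive_cst -(nbhs_singleton np) scale0r.
Qed.

Lemma par_at_interior J z t : nbhs t J -> par_at J z t -> par_at U z t.
Proof.
move=> nJ pz; have rt := regular_interior nJ; have [Jt _] := rt.
have conv (W : normedModType R) (f : R -> W) : rsmooth J f t -> rsmooth U f t.
  by move=> /(rsmooth_smooth nJ); exact: smooth_rsmooth.
have convd (W : normedModType R) (f : R -> W) : rsmooth J f t ->
    rderive U f t = rderive J f t.
  by move=> /(rsmooth_smooth nJ) sf; rewrite !rderive_smooth//; exact: filterT.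
split.
- have pg := par_path pz; split.
  + by move=> N /(path_near pg); apply: filterS2 nJ => s Js /(_ Js).
  + by have [i ip si] := path_has_chart pg; exists i => //; exact: conv.
  + by have [i ip si] := path_has_coord pg; exists i => //; exact: conv.
  + rewrite (path_anchor pg) convd//.
    exact: path_chart Jt pg (chart_atP (projT1 (forget (z t)))).
- by have [i ip si] := par_has_coord pz; exists i => //; exact: conv.
- move=> i j ip jp l; rewrite convd; last exact: par_fcoord Jt pz jp.
  exact: (par_eq pz ip jp l).
Qed.

Lemma path_at_restrict J g t : regular J t -> path_at U g t -> path_at J g t.
Proof.
move=> rt pg; have [Jt _] := rt.
have conv (W : normedModType R) (f : R -> W) : rsmooth U f t -> rsmooth J f t.
  by move=> /rsmooth_smooth sf; apply: smooth_rsmooth; apply: sf; exact: filterT.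
split.
- by move=> N /(path_near pg); apply: filterS => s /(_ I).
- by have [i ip si] := path_has_chart pg; exists i => //; exact: conv.
- by have [i ip si] := path_has_coord pg; exists i => //; exact: conv.
- have sc := path_chart I pg (chart_atP (projT1 (g t))).
  rewrite (path_anchor pg); have [h sh hE] := sc.
  rewrite (rderiveE (regularT t) sh hE) (rderiveE rt sh)//.
  by apply: filterS hE => s /(_ I).
Qed.

End FlatPaths.

(** * Parallel transport and holonomy *)

Section Interface.
Variables (R : realType) (M : manifold R) (A : vbundle M).
Variables (rho : bundle_hom A (tangent M)) (F : vbundle M).
Variable D : connection rho F.
Implicit Types (t : R) (x y p : M).
Local Notation I01 := (@I01 R).

Lemma Apath_path_at (c : R -> M) (a : forall t, A (c t)) : Apath rho a ->
  forall t, I01 t -> path_at rho I01 (fun t => mkA (a t)) t.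
Proof.
move=> [[cc sc] sa ra] t It; split => //=.
- by move=> N nN; have /subspace_continuousP/(_ t It) := cc; apply.
- by have [i ip [h sh hE]] := sc t It; exists i => //; exists h.
- by have [i ip [h sh hE]] := sa t It; exists i => //; exists h.
- exact: ra.
Qed.

Lemma path_at_Apath (g : R -> totA A) :
  (forall t, I01 t -> path_at rho I01 g t) -> Apath rho (fun t => projT2 (g t)).
Proof.
move=> pg; split=> [|t It|t It]; last exact: path_anchor (pg t It).
  split=> [|t It].
    by apply/subspace_continuousP => t It N /(path_near (pg t It)).
  by have [i ip [h sh hE]] := path_has_chart (pg t It); exists i => //; exists h.
by have [i ip [h sh hE]] := path_has_coord (pg t It); exists i => //; exists h.
Qed.

Lemma conn_mx_sum i j l x (a : A x) (u : F x) :
  \sum_k conn_mx D i j l k (mkA a) * vb_coord F j x u 0 k =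
  - \sum_al \sum_k vb_coord A i x a 0 al * vb_coord F j x u 0 k *
      christoffel D i j al k l x.
Proof.
rewrite exchange_big -sumrN; apply: eq_bigr => k _ /=.
rewrite /conn_mx mulNr mulr_suml; congr (- _); apply: eq_bigr => al _.
by rewrite /acoord/= mulrAC.
Qed.

Lemma parallel_par_at (c : R -> M) (a : forall t, A (c t)) (u : forall t, F (c t)) :
  Apath rho a -> parallel_along D a u ->
  forall t, I01 t -> par_at D I01 (fun t => mkAF (a t) (u t)) t.
Proof.
move=> pa [su pu] t It; split; first exact: (Apath_path_at pa It).
  by have [i ip [h sh hE]] := su t It; exists i => //; exists h.
move=> i j ip jp l; rewrite /forget /fcoord/= conn_mx_sum.
have /(congr1 (vb_coord F j (c t))) := pu t It i j ip jp.
rewrite /cov_derive vb_frameK// linear0 => /rowP/(_ l); rewrite !mxE.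
by rewrite derive01E => /eqP; rewrite addr_eq0 => /eqP.
Qed.

Lemma par_at_parallel (z : R -> totAF A F) :
  (forall t, I01 t -> par_at D I01 z t) ->
  parallel_along D (fun t => (projT2 (z t)).1) (fun t => (projT2 (z t)).2).
Proof.
move=> pz; split=> [t It|t It i j ip jp].
  by have [i ip [h sh hE]] := par_has_coord (pz t It); exists i => //; exists h.
rewrite /cov_derive (_ : \row__ _ = 0) ?linear0//; apply/rowP => l; rewrite !mxE.
have := par_eq (pz t It) ip jp l; rewrite /forget /fcoord conn_mx_sum derive01E => ->.
by rewrite addNr.
Qed.

Lemma is_interval_I01 : is_interval I01.
Proof.
move=> a b /andP[a0 _] /andP[_ b1] c /andP[ac cb].
by rewrite /I01/=; apply/andP; split; [exact: le_trans ac|exact: le_trans b1].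
Qed.

Lemma I010 : I01 0. Proof. by rewrite /I01/= lexx ler01. Qed.
Lemma I011 : I01 1. Proof. by rewrite /I01/= lexx ler01. Qed.

Lemma mkAF_inj x (a : A x) (u w : F x) : mkAF a u = mkAF a w -> u = w.
Proof. by move=> /(@eq_from_Tagged _ _ _ _ _)[]. Qed.

Lemma mkAF_eq x y (a : A x) (b : A y) (u : F x) (w : F y) : mkA a = mkA b ->
  existT (fun x => F x : Type) x u = existT (fun x => F x : Type) y w ->
  mkAF a u = mkAF b w.
Proof.
move=> E; have xy : x = y := congr1 (@projT1 _ _) E.
case: y / xy b w E => b w /(@eq_from_Tagged _ _ _ _ _) ->.
by move=> /(@eq_from_Tagged _ _ _ _ _) ->.
Qed.

Lemma parallel_unique (c : R -> M) (a : forall t, A (c t)) (u w : forall t, F (c t)) :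
  Apath rho a -> parallel_along D a u -> parallel_along D a w -> u 0 = w 0 ->
  u 1 = w 1.
Proof.
move=> pa pu pw uw0; apply: (@mkAF_inj _ (a 1)).
apply: (@par_unique _ _ _ _ _ D I01 I01 (fun t => mkAF (a t) (u t))
  (fun t => mkAF (a t) (w t)) 0).
- exact: is_interval_I01.
- exact: regular_I01.
- by move=> t It; split=> //; exact: parallel_par_at It.
- exact: I010.
- by rewrite uw0.
- exact: I011.
Qed.

Lemma transportE (c : R -> M) (a : forall t, A (c t)) (u : forall t, F (c t)) :
  Apath rho a -> parallel_along D a u -> transport D a (u 0) = u 1.
Proof.
move=> pa pu; apply: xget_subset1; first by exists u.
move=> _ _ [u1 [pu1 u10 <-]] [u2 [pu2 u20 <-]].
by apply: parallel_unique pu2 _ => //; rewrite u10.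
Qed.

Lemma transport_neq0 (c : R -> M) (a : forall t, A (c t)) (v : F (c 0)) :
  transport D a v != 0 -> exists u, [/\ parallel_along D a u, u 0 = v &
    u 1 = transport D a v].
Proof.
move=> nz; have [[w Sw]|nS] := pselect (exists w, exists u,
    [/\ parallel_along D a u, u 0 = v & u 1 = w]).
  exact: (@xgetPex _ (0 : F (c 1)) [set w | exists u,
    [/\ parallel_along D a u, u 0 = v & u 1 = w]] (ex_intro _ w Sw)).
by move: nz; rewrite /transport xgetPN ?eqxx// => w Sw; apply: nS; exists w.
Qed.

Lemma ecast_Tagged x y (e : x = y) (v : F x) :
  existT (fun x => F x : Type) y (ecast o (F o) e v) = existT _ x v.
Proof. by case: y / e. Qed.

Lemma ecast_sect x y (e : x = y) (s : sect F) : ecast o (F o) e (s x) = s y.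
Proof. by case: y / e. Qed.

Lemma ecast0 x y (e : x = y) : ecast o (F o) e 0 = 0.
Proof. by case: y / e. Qed.

Lemma ecast_lin x y (e : x = y) (c : R) (v w : F x) :
  ecast o (F o) e (c *: v + w) = c *: ecast o (F o) e v + ecast o (F o) e w.
Proof. by case: y / e. Qed.

Lemma vector_extension (E : vbundle M) p (v : E p) :
  exists2 s : sect E, Gamma E s & s p = v.
Proof.
have [i ip] := vb_cover E p.
pose s : sect E := fun q => vb_frame E i q (vb_coord E i p v).
have [s' Gs' sE] : exists2 s', Gamma E s' & \forall q \near p, s' q = s q.
  apply: Gamma_extension; apply: filterS (near_in_vb_dom ip) => q iq.
  apply: (ssmoothP iq) => l.
  exact: (msmooth_mxP _ _).1 (vb_smooth iq iq _) _ _.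
by exists s' => //; rewrite (nbhs_singleton sE) /s vb_coordK.
Qed.

(** Extend the vector of the path at time t to a section X. In coordinates, vanishing of [D X s]
    equates the derivative of s along the anchor of X with the Christoffel term; that anchor is the
    velocity of the base curve, and the chain rule gives the parallel equation. *)
Lemma parallel_section_par (J : set R) (g : R -> totA A) (s : sect F) t :
  regular J t -> path_at rho J g t -> parallel_sections D s ->
  par_at D J (fun t => mkAF (projT2 (g t)) (s (projT1 (g t)))) t.
Proof.
move=> rt pg [Gs Ds]; have [Jt _] := rt.
have sm j l : vb_dom j (projT1 (g t)) ->
    msmooth_at (fun q => vb_coord F j q (s q) 0 l) (projT1 (g t)).
  by move=> jp; exact: ssmooth_coord jp (Gs _).
split.
- by apply: path_at_near pg => //; near=> r => _; rewrite /forget/= /mkA; case: (g r).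
- have [j jp] := vb_cover F (projT1 (g t)); exists j => //.
  apply: rsmooth_mx => k l; rewrite ord1.
  exact: (path_msmooth Jt pg (sm j l jp)).
- move=> i j ip jp l; rewrite /fcoord /forget/= conn_mx_sum.
  have [X GX Xp] := vector_extension (projT2 (g t)).
  have := nabla_coord D l ip jp GX Gs; rewrite Ds// linear0 mxE Xp => /eqP.
  rewrite eq_sym addr_eq0 => /eqP <-.
  rewrite (path_anchor pg) /tangent_derive.
  have kp := chart_atP (projT1 (g t)).
  have sk := path_chart Jt pg kp.
  rewrite -(rderive_comp rt (msmooth_chart kp (sm j l jp)) sk).
  apply: rderive_near => //; last exact: (path_msmooth Jt pg (sm j l jp)).
  apply: filterS (path_near pg (near_in_chart_dom kp)) => r kr Jr /=.
  by rewrite chartK//; exact: kr.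
Unshelve. all: by end_near. Qed.

(* The transport of a nonzero fixed vector around a loop is nonzero, so that the
   parallel section defining it exists. *)
Lemma hol_lift p (v : F p) (g : R -> totA A) : Hol_fixed D p v -> v != 0 ->
  flat_path rho g p p ->
  exists2 z, flat_lift D z v v & forall t, forget (z t) = g t.
Proof.
move=> fv v0 [pg [e [e0 ga gb]]].
have pI t : I01 t -> path_at rho I01 g t.
  by move=> It; apply: path_at_restrict (pg t); exact: regular_I01.
have pa := path_at_Apath pI.
have geta t : mkA (projT2 (g t)) = g t by case: (g t).
pose c0 : projT1 (g 0) = p := congr1 (@projT1 _ _) (ga 0 e0).
have g1 : g 1 = mkA (0 : A p) by apply: gb; rewrite ltrBlDr ltrDl.
pose c1 : projT1 (g 1) = p := congr1 (@projT1 _ _) g1.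
pose a t := projT2 (g t).
(* The loop g defines an element of the holonomy group; the casts identify its end fibres with the
   fibre at p. *)
have E : ecast o (F o) c1 (transport D a (ecast o (F o) (esym c0) v)) = v.
  by apply: (fv (fun v => ecast o (F o) c1 (transport D a (ecast o (F o) (esym c0) v))));
    exists (fun t => projT1 (g t)), a, c0, c1.
have nz : transport D a (ecast o (F o) (esym c0) v) != 0.
  by apply: contra_neq v0 => T0; rewrite -E T0 ecast0.
have [u [pu u0 u1]] := transport_neq0 nz.
pose Z t := mkAF (a t) (u t).
have pZ t : I01 t -> par_at D I01 Z t by move=> It; exact: parallel_par_at pa pu t It.
have fZ t : forget (Z t) = g t by rewrite -[RHS]geta.
pose k : totAF A F := mkAF (0 : A p) v.
have Z0 : Z 0 = k.
  by apply: mkAF_eq; [rewrite geta ga|rewrite u0 ecast_Tagged].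
have Z1 : Z 1 = k.
  apply: mkAF_eq; first by rewrite geta g1.
  by rewrite u1 -(ecast_Tagged c1) E.
(* While g rests, the constant curve [k] is also parallel above it and agrees with Z at time 0; thus
   Z rests as well. The same holds from time 1 backwards. *)
have Zl t : I01 t -> t < e -> Z t = k.
  move=> It te; apply: (@par_unique _ _ _ _ _ D I01 [set t | I01 t /\ t < e] Z (fun=> k) 0)
    (conj It te) => //.
  - move=> r s [Ir re] [Is se] q /andP[rq qs]; split.
      by apply: is_interval_I01 Ir Is _ _; rewrite rq qs.
    exact: le_lt_trans se.
  - by move=> r [Ir _]; exact: regular_I01.
  - move=> r [Ir re]; split; [exact: pZ|exact/const_par/regular_I01|].
    by rewrite fZ ga.
  - by split => //; exact: I010.
have Zr t : I01 t -> 1 - e < t -> Z t = k.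
  move=> It te; apply: (@par_unique _ _ _ _ _ D I01 [set t | I01 t /\ 1 - e < t] Z (fun=> k) 1)
    (conj It te) => //.
  - move=> r s [Ir re] [Is se] q /andP[rq qs]; split.
      by apply: is_interval_I01 Ir Is _ _; rewrite rq qs.
    exact: lt_le_trans rq.
  - by move=> r [Ir _]; exact: regular_I01.
  - move=> r [Ir re]; split; [exact: pZ|exact/const_par/regular_I01|].
    by rewrite fZ gb.
  - by split; [exact: I011|rewrite ltrBlDr ltrDl].
(* Outside [0,1] the values of Z are arbitrary; they are replaced by the constant with which Z
   begins and ends. *)
pose z t := if 0 <= t <= 1 then Z t else k.
have zl t : t < e -> z t = k by move=> te; rewrite /z; case: ifP => // It; exact: Zl.
have zr t : 1 - e < t -> z t = k by move=> te; rewrite /z; case: ifP => // It; exact: Zr.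
exists z => [|t]; last first.
  rewrite /z; case: ifP => [_|/negbT]; first exact: fZ.
  rewrite negb_and -!ltNge => /orP[t0|t1].
    by rewrite ga ?(lt_trans t0).
  by rewrite gb// (lt_trans _ t1)// ltrBlDr ltrDl.
split=> [t|]; last by exists e.
have [te|et] := ltP t e.
  apply: (@par_at_near _ _ _ _ _ _ _ (fun=> k)); first exact: regularT.
    by apply: filterS (lt_nbhsl te) => s /zl ->.
  exact/const_par/regularT.
have [te'|te'] := ltP (1 - e) t.
  apply: (@par_at_near _ _ _ _ _ _ _ (fun=> k)); first exact: regularT.
    by apply: filterS (lt_nbhsr te') => s /zr ->.
  exact/const_par/regularT.
have t0 : 0 < t by exact: lt_le_trans et.
have t1 : t < 1 by apply: le_lt_trans te' _; rewrite ltrBlDr ltrDl.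
have nI : nbhs t I01.
  apply: filterS2 (lt_nbhsr t0) (lt_nbhsl t1) => s s0 s1.
  by rewrite /I01/=; apply/andP; split; exact: ltW.
apply: (@par_at_near _ _ _ _ _ _ _ Z); first exact: regularT.
  by apply: filterS nI => s Is _; rewrite /z ifT.
apply: (par_at_interior nI); apply: pZ; exact: nbhs_singleton nI.
Qed.

End Interface.

(** * The section spread out from a fixed vector *)

Section HolonomySection.
Variables (R : realType) (M : manifold R) (A : vbundle M).
Variables (rho : bundle_hom A (tangent M)) (F : vbundle M).
Variable D : connection rho F.
Implicit Types (t : R) (x y p : M).
Local Notation U := [set: R].

Lemma mkA_eta (g : totA A) : mkA (projT2 g) = g.
Proof. by case: g. Qed.

Lemma forget_mk y (a : A y) (z : totAF A F) : forget z = mkA a ->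
  exists w : F y, z = mkAF a w.
Proof.
case: z => [x [b w]] E; have xy : x = y := congr1 (@projT1 _ _) E.
case: y / xy a E => a /(@eq_from_Tagged _ _ _ _ _) /= <-.
by exists w.
Qed.

Variables (p : M) (v : F p).
Hypotheses (fv : Hol_fixed D p v) (v0 : v != 0).
Hypothesis reach : forall y, exists g, flat_path rho g p y.

Lemma flat_lift_exists y : exists (w : F y) z, flat_lift D z v w.
Proof.
have [g fg] := reach y.
have [z zP zE] := hol_lift fv v0 (flat_cat fg (flat_rev fg)).
have [w wE] : exists w, z (1 / 2) = mkAF (0 : A y) w.
  by apply: forget_mk; rewrite zE (path_cat_half fg (flat_rev fg)).
have [z'] := flat_lift_stop (1 / 2) zP; rewrite wE /= => z'P.
by exists w, z'.
Qed.

(** The lift Z of the loop out along the path of z and back along that of z' is compared with z from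
    time 0 up to 1/2, and with z' from time 1 down to 1/2, at the parameter 2 - 2s. Its value at 1/2
    is then both w and w'. *)
Lemma flat_lift_unique y (w w' : F y) z z' :
  flat_lift D z v w -> flat_lift D z' v w' -> w = w'.
Proof.
move=> lz lz'; have fg := flat_lift_path lz; have fg' := flat_lift_path lz'.
have fr := flat_rev fg'.
have [Z [pZ ZE] fZ] := hol_lift fv v0 (flat_cat fg fr).
have [pz ez] := lz; have [pz' ez'] := lz'.
have reg t : regular U t by exact: regularT.
have Z1 : Z (1 / 2) = repz (fun s => 2 * s + 0) z (1 / 2).
  apply: (@par_unique _ _ _ _ _ D U [set t | t <= 1 / 2] _ _ 0) => //=.
  - by move=> a b _ b2 c /andP[_ cb]; exact: le_trans b2.
  - move=> t th; split; [exact: pZ|apply: repz_par|].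
    + exact: smooth_affine.
    + exact: pz.
    + by rewrite fZ (path_cat_left fg fr th).
  - rewrite (path_ends0 ZE) repz_affineE mulr0 addr0 (path_ends0 ez)/=.
    by rewrite scaler0.
have Z2 : Z (1 / 2) = repz (fun s => - 2 * s + 2) z' (1 / 2).
  apply: (@par_unique _ _ _ _ _ D U [set t | 1 / 2 <= t] _ _ 1) => //=.
  - by move=> a b a2 _ c /andP[ac _]; exact: le_trans ac.
  - move=> t th; split; [exact: pZ|apply: repz_par|].
    + exact: smooth_affine.
    + exact: pz'.
    + rewrite fZ (path_cat_right _ _ th) rep_affineE /path_rev rep_affineE/=.
      rewrite repz_affineE (_ : -1 * (2 * t + -1) + 1 = - 2 * t + 2); last by ring.
      by rewrite scalerA mulrN1.
  - lra.
  - rewrite (path_ends1 ZE) repz_affineE mulr1 addNr (path_ends0 ez')/=.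
    by rewrite scaler0.
apply: (@mkAF_inj _ _ A _ _ (0 : A y)).
have -> : mkAF (0 : A y) w = Z (1 / 2).
  rewrite Z1 repz_affineE (_ : 2 * (1 / 2) + 0 = 1); last by lra.
  by rewrite (path_ends1 ez)/= scaler0.
rewrite Z2 repz_affineE (_ : - 2 * (1 / 2) + 2 = 1); last by lra.
by rewrite (path_ends1 ez')/= scaler0.
Qed.

(* By uniqueness, stopping a lift at any time shows that it stays on the graph
   of the section obtained by transporting [v]. *)
Lemma holonomy_section : exists s : sect F, s p = v /\
  forall x b, flat_path rho b x x -> forall t, 0 < t < 1 ->
    par_at D U (fun t => mkAF (projT2 (b t)) (s (projT1 (b t)))) t.
Proof.
pose s : sect F := fun y => projT1 (cid (flat_lift_exists y)).
have sP y : exists z, flat_lift D z v (s y) := projT2 (cid (flat_lift_exists y)).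
have s_eq y (w : F y) z : flat_lift D z v w -> w = s y.
  by move=> zP; have [z' z'P] := sP y; exact: flat_lift_unique zP z'P.
exists s; split=> [|x b fb t /andP[t0 t1]].
  apply/esym/(s_eq p v (fun=> mkAF (0 : A p) v)); split=> [t|].
    exact/const_par/regularT.
  by exists 1; split.
have [g fg] := reach x.
have fgb := flat_cat fg fb; have fr := flat_rev fg.
have [Z ZP fZ] := hol_lift fv v0 (flat_cat fgb fr).
(* Stopping Z at time r gives a flat lift from v to the current vector, which is therefore the value
   of s. *)
have Zs r : Z r = mkAF (projT2 (Z r)).1 (s (projT1 (Z r))).
  have [z' z'P] := flat_lift_stop r ZP.
  by rewrite -(s_eq _ _ _ z'P); case: (Z r) => [? []].
(* In the doubly concatenated loop b runs during [1/4, 1/2]. This time change recovers it, its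
   factor 1/4 cancelling the fourfold speed. *)
pose z := repz (fun r => (1 / 4) * r + 1 / 4) Z.
have pz : par_at D U z t.
  by apply: repz_par; [exact: smooth_affine|exact: ZP.1].
apply: par_at_near pz; first exact: regularT.
apply: filterS2 (lt_nbhsr t0) (lt_nbhsl t1) => r r0 r1 _.
rewrite /z repz_affineE Zs /=.
have bE : b r = mkA ((1 / 4) *: (projT2 (Z (1 / 4 * r + 1 / 4))).1).
  have := fZ (1 / 4 * r + 1 / 4).
  rewrite (path_cat_left fgb fr); last by lra.
  rewrite rep_affineE path_cat_right; last by lra.
  rewrite rep_affineE (_ : 2 * (2 * (1 / 4 * r + 1 / 4) + 0) + -1 = r); last by lra.
  move=> E; have -> : mkA (1 / 4 *: (projT2 (Z (1 / 4 * r + 1 / 4))).1) =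
    mkA (1 / 4 *: projT2 (forget (Z (1 / 4 * r + 1 / 4)))) by [].
  rewrite E /= !scalerA (_ : 1 / 4 * (2 * 2) = 1); last by lra.
  by rewrite scale1r mkA_eta.
by rewrite bE.
Qed.

End HolonomySection.

(** * Lines lifted through the anchor *)

Section LinePaths.
Variables (R : realType) (M : manifold R) (A : vbundle M).
Variables (rho : bundle_hom A (tangent M)).
Local Notation U := [set: R].
Local Notation V := 'rV[R]_(mdim M).
Implicit Types (x w : V) (q : M).

Definition anchor_mx (i : chart_idx M) (ia : vb_idx A) x : 'M[R]_(vrank A, mdim M) :=
  \matrix_(al, k) tangent_coord i (chart_inv i x)
    (rho _ (vb_frame A ia (chart_inv i x) (delta_mx 0 al))) 0 k.

Lemma anchor_mxE i ia x (v : 'rV[R]_(vrank A)) :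
  v *m anchor_mx i ia x =
  tangent_coord i (chart_inv i x) (rho _ (vb_frame A ia (chart_inv i x) v)).
Proof.
apply/rowP => k; rewrite !mxE {2}(row_sum_delta v) !linear_sum summxE.
apply: eq_bigr => al _; rewrite mxE.
by rewrite !linearZ mxE.
Qed.

Lemma smooth_anchor_mx i ia q : chart_dom i q -> vb_dom ia q ->
  smooth_at (anchor_mx i ia) (chart i q).
Proof.
move=> iq aq; apply/smooth_at_mxP => al k; under eq_fun do rewrite mxE.
apply: (msmooth_chart (f := fun p => tangent_coord i p
  (rho p (vb_frame A ia p (delta_mx 0 al))) 0 k) iq).
exact: (msmooth_mxP _ _).1 (@hom_smooth _ _ _ _ rho ia i q aq iq _) _ _.
Qed.

(* A smooth right inverse of the anchor near q; with S a right inverse at q,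
   it is (S R)^-1 S where R is the matrix of the anchor. *)
Lemma anchor_section i ia q : transitive_anchor rho -> chart_dom i q -> vb_dom ia q ->
  exists G : V -> 'M[R]_(mdim M, vrank A), smooth_at G (chart i q) /\
    \forall x \near chart i q, G x *m anchor_mx i ia x = 1%:M.
Proof.
move=> tr iq aq.
have [f fP] := choice (fun k : 'I_(mdim M) => tr q (tangent_frame i q (delta_mx 0 k))).
pose S : 'M[R]_(mdim M, vrank A) := \matrix_(k, al) vb_coord A ia q (f k) 0 al.
pose B x := S *m anchor_mx i ia x.
have Bq : B (chart i q) = 1%:M.
  apply/row_matrixP => k; rewrite row_mul row1 anchor_mxE chartK//.
  rewrite (_ : row k S = vb_coord A ia q (f k)); last by apply/rowP => al; rewrite !mxE.
  by rewrite vb_coordK// fP tangent_frameK.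
have sR := smooth_anchor_mx iq aq.
have sB : smooth_at B (chart i q) by apply: smooth_at_mulmx => //; exact: smooth_at_cst.
have sd := smooth_at_det sB.
have dq : \det (B (chart i q)) != 0 by rewrite Bq det1 oner_eq0.
exists (fun x => ((\det (B x))^-1 *: \adj (B x)) *m S); split.
  apply: smooth_at_mulmx; last exact: smooth_at_cst.
  by apply: smooth_at_scalemx; [exact: smooth_atV|exact: smooth_at_adj].
have : \forall x \near chart i q, \det (B x) != 0.
  have /cvgrPdist_lt/(_ `|\det (B (chart i q))|) := smooth_at_continuous sd.
  rewrite normr_gt0 => /(_ dq); apply: filterS => x; apply: contraTneq => ->.
  by rewrite subr0 ltxx.
apply: filterS => x dx.
by rewrite -mulmxA -/(B x) -scalemxAl mul_adj_mx scale_scalar_mx mulVf.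
Qed.

(* On [Om], the section with components y has anchor w in the chart i. *)
Definition lifts_on (Om : set V) i ia (y : V -> 'rV[R]_(vrank A)) w : Prop :=
  forall x, Om x -> [/\ chart_dom i (chart_inv i x), chart i (chart_inv i x) = x,
    vb_dom ia (chart_inv i x), smooth_at y x & y x *m anchor_mx i ia x = w].

Definition lifted_line i ia (y : V -> 'rV[R]_(vrank A)) x0 w (s : R) : totA A :=
  mkA (vb_frame A ia (chart_inv i (x0 + s *: w)) (y (x0 + s *: w))).

Lemma smooth_line x0 w (s : R) : smooth_at (fun s : R => x0 + s *: w) s.
Proof.
apply: smooth_atD; first exact: smooth_at_cst.
by apply: smooth_at_scalemx; [exact: smooth_at_id|exact: smooth_at_cst].
Qed.

Lemma derive_line x0 w (s : R) : 'D_1 (fun s : R => x0 + s *: w) s = w.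
Proof.
rewrite derive_mx; last exact/smooth_at_derivable/smooth_line.
apply/rowP => k; rewrite mxE.
rewrite (_ : (fun r : R => (x0 + r *: w) 0 k) = fun r => w 0 k * r + x0 0 k).
  by rewrite derive_affine.
by apply/funext => r; rewrite !mxE addrC mulrC.
Qed.

Lemma lifted_line_path Om i ia y x0 w s : lifts_on Om i ia y w ->
  (\forall x \near x0 + s *: w, Om x) -> path_at rho U (lifted_line i ia y x0 w) s.
Proof.
move=> lO nO.
have [ix xE ax sy yw] := lO _ (nbhs_singleton nO).
have sl := smooth_line x0 w s.
have nO' : \forall r \near s, Om (x0 + r *: w) := smooth_at_continuous sl nO.
split=> /=.
- move=> N nN; have := chart_inv_continuous ix; rewrite xE => /(_ _ nN) nN'.
  have : \forall r \near s, N (chart_inv i (x0 + r *: w)) := smooth_at_continuous sl nN'.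
  by apply: filterS.
- exists i => //; apply: smooth_rsmooth; apply: near_eq_smooth_at sl.
  by apply: filterS nO' => r /lO[].
- exists ia => //; apply: smooth_rsmooth.
  apply: near_eq_smooth_at (smooth_at_comp_row_mx sl sy).
  by apply: filterS nO' => r /lO[_ _ ar _ _]; rewrite /acoord/= vb_frameK.
(* The anchor condition is stated in the chart attached to the current point; the differential of
   the transition map from chart i carries w to the velocity there. *)
- set c := chart_inv i _; set k := chart_at c; have kc : chart_dom k c := chart_atP c.
  have h : tangent_coord i c (rho c (vb_frame A ia c (y (x0 + s *: w)))) = w.
    by rewrite -anchor_mxE.
  transitivity (tangent_frame i c w).
    have := congr1 (tangent_frame i c) h.
    exact: etrans (esym (tangent_coordK ix _)).
  have sc := chart_smooth ix kc; rewrite xE in sc.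
  have sl' : rsmooth U (fun r : R => x0 + r *: w) s := smooth_rsmooth U sl.
  rewrite -[RHS]/(rderive U ((chart k \o chart_inv i) \o (fun r : R => x0 + r *: w)) s).
  rewrite rderive_comp_mx//; last exact: regularT.
  rewrite (rderive_smooth _ sl); last exact: filterT.
  rewrite derive_line deriveE; last exact: smooth_at_differentiable.
  by rewrite /tangent_frame xE.
Qed.

(** Where tau is constant the factor ['D_1 tau] is 0, so the new path rests. With al = be the result
    is a loop. *)
Lemma flat_rep (g : R -> totA A) (tau : R -> R) (al be : R) :
  (forall t, smooth_at tau t) -> (forall t, path_at rho U g (tau t)) ->
  (forall t, t < 1 / 4 -> tau t = al) -> (forall t, 1 - 1 / 4 < t -> tau t = be) ->
  flat_path rho (rep tau g) (projT1 (g al)) (projT1 (g be)).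
Proof.
move=> st pg tal tbe; split=> [t|]; first exact: rep_path.
exists (1 / 4); split=> [|t th|t th]; first by rewrite divr_gt0.
  have np : \forall s \near t, (fun=> al) s = tau s.
    by apply: filterS (lt_nbhsl th) => s /tal ->.
  by rewrite /rep -(near_eq_derive _ np) derive_cst -(nbhs_singleton np) scale0r.
have np : \forall s \near t, (fun=> be) s = tau s.
  by apply: filterS (lt_nbhsr th) => s /tbe ->.
by rewrite /rep -(near_eq_derive _ np) derive_cst -(nbhs_singleton np) scale0r.
Qed.

(** A coordinate ball is convex, so each of its points is joined to q by a segment; the segment is
    lifted by [w *m G x] and traversed with a smooth step as time. *)
Lemma flat_path_near q : transitive_anchor rho ->
  \forall q' \near q, exists g, flat_path rho g q q'.
Proof.
move=> tr; pose i := chart_at q; have iq : chart_dom i q := chart_atP q.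
have [ia aq] := vb_cover A q; have [G [sG GR]] := anchor_section tr iq aq.
have [r r0 rP] := nbhs_ex_norm (filterI (filterI (near_chart_dom iq)
  (near_chart_inv iq (near_in_vb_dom aq))) (filterI (smooth_at_open sG) GR)).
pose Om := [set x : V | `|x - chart i q| < r].
have lO w : lifts_on Om i ia (fun x => w *m G x) w.
  move=> x /rP[[[ix xE] ax] [sx GRx]]; split=> //.
    by apply: smooth_at_mulmx => //; exact: smooth_at_cst.
  by rewrite -mulmxA GRx mulmx1.
have oO x : Om x -> \forall x' \near x, Om x'.
  move=> Ox; have d0 : 0 < r - `|x - chart i q| by rewrite subr_gt0.
  apply: filterS (nbhs_norm_lt x d0) => x'; rewrite ltrBrDr; apply: le_lt_trans.
  by rewrite -[x' in leLHS](subrK x x') -addrA ler_normD.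
have nq : \forall q' \near q, Om (chart i q').
  by apply: near_chart iq _; apply: oO; rewrite /Om/= subrr normr0.
apply: filterS2 nq (near_in_chart_dom iq) => q' Oq' iq'.
pose w := chart i q' - chart i q.
pose tau (t : R) : R := smooth_step (2 * t + - (1 / 2)).
have := @flat_rep (lifted_line i ia (fun x => w *m G x) (chart i q) w) tau 0 1.
have wE : chart i q + w = chart i q' by rewrite addrC subrK.
rewrite /= scale0r addr0 scale1r wE !chartK// => fp.
eexists; apply: fp => t.
- apply: (@smooth_at_comp_real _ _ (@smooth_step R)); first exact: smooth_affine.
  exact: smooth_smooth_step.
- apply: lifted_line_path (lO w) _; apply: oO; apply: ball_segment => //.
    exact: smooth_step_itv.
  by rewrite subrr normr0.
- by move=> th; rewrite /tau smooth_step_le0//; lra.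
- by move=> th; rewrite /tau smooth_step_ge1//; lra.
Qed.

(** Near x, reaching x and reaching y are equivalent: a short path or its reverse is appended. *)
Lemma flat_path_exists (p q : M) : connected [set: M] -> transitive_anchor rho ->
  exists g, flat_path rho g p q.
Proof.
move=> cM tr.
apply: (@connected_local _ setT [set q | exists g, flat_path rho g p q] p) => //.
  by exists (fun=> mkA (0 : A p)); exact: flat_const.
move=> x _; apply: filterS (flat_path_near x tr) => y [h fh] _; split=> -[g fg].
  by exists (path_cat g h); exact: flat_cat fh.
by exists (path_cat g (path_rev h)); apply: flat_cat (flat_rev fh).
Qed.

End LinePaths.

(** * Smoothness and parallelism of a section parallel along loops *)

Section Invariance.
Variables (R : realType) (M : manifold R) (A : vbundle M).
Variables (rho : bundle_hom A (tangent M)) (F : vbundle M).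
Variable D : connection rho F.
Local Notation U := [set: R].
Local Notation V := 'rV[R]_(mdim M).
Variable s : sect F.
Hypothesis s_par : forall x b, flat_path rho b x x -> forall t, 0 < t < 1 ->
  par_at D U (fun t => mkAF (projT2 (b t)) (s (projT1 (b t)))) t.

Let cs j l p := vb_coord F j p (s p) 0 l.

Lemma is_derive_line_inv (f : V -> R) x w (t d : R) :
  is_derive t 1 (fun r : R => f (x + (r - t) *: w)) d -> is_derive x w f d.
Proof.
have E : (fun h : R => h^-1 *: (((fun r : R => f (x + (r - t) *: w)) \o shift t) (h *: 1)
      - f (x + (t - t) *: w)))
    = fun h => h^-1 *: ((f \o shift x) (h *: w) - f x).
  apply/funext => h /=; congr (_ *: (f _ - f _)).
    by rewrite [_ *: 1]mulr1 addrK addrC.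
  by rewrite subrr scale0r addr0.
by move=> [df <-]; apply: DeriveDef; rewrite /derivable /derive -E.
Qed.

(** The hypothesis on s concerns loops, so the line is made into one: its parameter tau starts at 0,
    returns to 0, and equals t - 1/2 near t = 1/2. There the line is traversed at unit speed through
    x0, and the parallel equation at that time is the stated derivative. *)
Lemma line_derive Om i ia j y w x0 l : lifts_on rho Om i ia y w ->
  (\forall x \near x0, Om x) -> vb_dom j (chart_inv i x0) ->
  is_derive x0 w (cs j l \o chart_inv i)
    (\sum_k (- \sum_al y x0 0 al * christoffel D ia j al k l (chart_inv i x0)) *
       cs j k (chart_inv i x0)).
Proof.
move=> lO nO jx.
have [e e0 eP] : exists2 e : R, 0 < e & forall r : R, `|r| < e ->
    \forall x \near x0 + r *: w, Om x.
  have nO' : \forall x \near x0 + 0 *: w, \forall x' \near x, Om x'.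
    by rewrite scale0r addr0; exact: near_join nO.
  have [e e0 eP] := nbhs_ex_norm (smooth_at_continuous (smooth_line x0 w 0) nO').
  by exists e => // r re; apply: eP; rewrite subr0.
(* The bound e keeps the line in [Om], since |tau| stays below e; the bound 1/4 leaves the loop at
   rest for t < 1/4 and for t > 3/4. *)
pose ep := Num.min e (1 / 4).
have ep0 : 0 < ep by rewrite lt_min e0 divr_gt0.
have ep1 : ep <= 1 / 4 by rewrite ge_min lexx orbT.
pose tau (t : R) := (t - 1 / 2) * bump1 ep (t - 1 / 2).
have stau t : smooth_at tau t.
  have sh : smooth_at (fun t : R => t - 1 / 2) t.
    by apply: smooth_atD; [exact: smooth_at_id|exact: smooth_at_cst].
  apply: smooth_atM => //.
  exact: (smooth_at_comp_real sh (smooth_bump1 ep _)).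
have taue t : `|tau t| < e.
  have [le|lt] := leP ep `|t - 1 / 2|; first by rewrite /tau bump1_eq0// mulr0 normr0.
  apply: lt_le_trans (_ : ep <= e); last by rewrite ge_min lexx.
  apply: le_lt_trans lt; rewrite normrM ler_piMr//.
  by have /andP[b0 b1] := bump1_itv ep (t - 1 / 2); rewrite ger0_norm.
have taul t : t < 1 / 4 -> tau t = 0.
  by move=> th; rewrite /tau bump1_eq0 ?mulr0// ler_normr; apply/orP; right; lra.
have taur t : 1 - 1 / 4 < t -> tau t = 0.
  by move=> th; rewrite /tau bump1_eq0 ?mulr0// ler_normr; apply/orP; left; lra.
have ntau : \forall t \near (1 / 2 : R), (t - 1 / 2) = tau t.
  have ep2 : 0 < ep / 2 by rewrite divr_gt0.
  apply: filterS (nbhs_norm_lt (1 / 2 : R) ep2) => t /ltW th.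
  by rewrite /tau bump1_eq1// mulr1.
have tau0 : tau (1 / 2) = 0 by rewrite -(nbhs_singleton ntau) subrr.
have dtau : 'D_1 tau (1 / 2) = 1.
  rewrite -(near_eq_derive _ ntau) (_ : (fun t : R => t - 1 / 2) =
    fun t => 1 * t + - (1 / 2)) ?derive_affine//.
  by apply/funext => t; rewrite [1 * t]mul1r.
have fp := flat_rep stau (fun t => lifted_line_path lO (eP _ (taue t))) taul taur.
have h01 : 0 < (1 / 2 : R) < 1 by apply/andP; split; lra.
have P := s_par fp h01.
have x0E : x0 + tau (1 / 2) *: w = x0 by rewrite tau0 scale0r addr0.
have [_ _ ax _ _] := lO _ (nbhs_singleton nO).
have iaP : vb_dom ia (chart_inv i (x0 + tau (1 / 2) *: w)) by rewrite x0E.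
have jP : vb_dom j (chart_inv i (x0 + tau (1 / 2) *: w)) by rewrite x0E.
have sm : smooth_at (fun t => cs j l (chart_inv i (x0 + tau t *: w))) (1 / 2).
  by apply: rsmooth_smooth (par_fcoord l I P jP); exact: filterT.
have eqn := par_eq P iaP jP l.
have {eqn} eqn : 'D_1 (fun t => cs j l (chart_inv i (x0 + tau t *: w))) (1 / 2) =
    \sum_k (- \sum_al y x0 0 al * christoffel D ia j al k l (chart_inv i x0)) *
       cs j k (chart_inv i x0).
  rewrite -(@rderive_smooth _ U _ _ _ filterT sm) [LHS]eqn; apply: eq_bigr => k _.
  rewrite /conn_mx /acoord /fcoord /= -/(cs j k _) dtau x0E; congr (- _ * _).
  by apply: eq_bigr => al _; rewrite scale1r vb_frameK.
apply: (@is_derive_line_inv _ _ _ (1 / 2)).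
have nE : \forall t \near (1 / 2 : R), cs j l (chart_inv i (x0 + tau t *: w)) =
    (cs j l \o chart_inv i) (x0 + (t - 1 / 2) *: w).
  by apply: filterS ntau => t ->.
apply: near_eq_is_derive nE _ => //.
by apply: DeriveDef; [exact: smooth_at_derivable|].
Qed.

(** The lift [w *m G x] is linear in the direction w, so the derivatives along all lines form one
    linear system with coefficients -G times the Christoffel symbols, to which [pde_smooth]
    applies. *)
Lemma invariant_smooth q : transitive_anchor rho -> ssmooth_at s q.
Proof.
move=> tr; pose i := chart_at q; have iq : chart_dom i q := chart_atP q.
have [ia aq] := vb_cover A q; have [j jq] := vb_cover F q.
have [G [sG GR]] := anchor_section tr iq aq.
have [r r0 rP] := nbhs_ex_norm (filterI (filterI (near_chart_dom iq)
  (near_chart_inv iq (near_in_vb_dom aq))) (filterI (smooth_at_open sG) GR)).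
pose Om := [set x : V | `|x - chart i q| < r].
have lO w : lifts_on rho Om i ia (fun x => w *m G x) w.
  move=> x /rP[[[ix xE] ax] [sx GRx]]; split=> //.
    by apply: smooth_at_mulmx => //; exact: smooth_at_cst.
  by rewrite -mulmxA GRx mulmx1.
have nO : \forall x \near chart i q, Om x by exact: nbhs_norm_lt.
have nj := near_chart_inv iq (near_in_vb_dom jq).
pose Ga al k l p := christoffel D ia j al k l p.
apply: (ssmoothP jq) => l; exists i => //.
apply: (@pde_smooth R _ _ (fun l => cs j l \o chart_inv i)
  (fun n l k x => - \sum_al G x n al * Ga al k l (chart_inv i x))) => [|n l' k].
- apply: filterS2 (near_join nO) nj => x Ox jx w l'.
  apply: is_derive_eq (line_derive l' (lO w) Ox jx) _.
  rewrite /row_dot; under [RHS]eq_bigr do rewrite mulr_sumr.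
  rewrite exchange_big; apply: eq_bigr => k _ /=.
  under [RHS]eq_bigr do rewrite mulrA.
  rewrite -mulr_suml; congr (_ * _).
  under [RHS]eq_bigr do rewrite mulrN mulr_sumr.
  rewrite sumrN exchange_big; congr (- _); apply: eq_bigr => al _ /=.
  by rewrite mxE mulr_suml; apply: eq_bigr => n _; rewrite mulrA.
- apply: smooth_atN; apply: smooth_at_sum => al _; apply: smooth_atM.
    exact: (smooth_at_mxP _ _).1 sG n al.
  exact: msmooth_chart iq (christoffel_smooth D al k l' aq jq).
Qed.

(** The right inverse of the anchor only reaches some vectors over q, while X(q) is arbitrary and
    may even lie in the kernel of the anchor. The line is therefore lifted so as to pass through
    X(q) itself. *)
Lemma invariant_parallel : transitive_anchor rho -> parallel_sections D s.
Proof.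
move=> tr; have Gs : Gamma F s by move=> q; exact: invariant_smooth.
split=> // X GX; apply: functional_extensionality_dep => q.
have iq := chart_atP q; set i := chart_at q in iq.
have [ia aq] := vb_cover A q; have [j jq] := vb_cover F q.
apply: (vb_coord_inj jq); rewrite linear0; apply/rowP => l; rewrite mxE.
rewrite (nabla_coord D l aq jq GX Gs).
pose w : V := rho q (X q).
have wE : vb_coord A ia q (X q) *m anchor_mx rho i ia (chart i q) = w.
  by rewrite anchor_mxE chartK// vb_coordK//; exact: diff_chart1.
have [G [sG GR]] := anchor_section tr iq aq.
have sR := smooth_anchor_mx rho iq aq.
pose zeta := vb_coord A ia q (X q).
(* Constant coordinates zeta corrected by the right inverse G: the anchor of y is w wherever G
   inverts it, and at q the correction vanishes because zeta already has anchor w. *)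
pose y x := zeta + (w - zeta *m anchor_mx rho i ia x) *m G x.
have sy : smooth_at y (chart i q).
  apply: smooth_atD; first exact: smooth_at_cst.
  apply: smooth_at_mulmx => //; apply: smooth_atD; first exact: smooth_at_cst.
  have : smooth_at (fun x => (- 1 : R) *: (zeta *m anchor_mx rho i ia x)) (chart i q).
    by apply: smooth_at_scalemx; [|apply: smooth_at_mulmx => //]; exact: smooth_at_cst.
  by under eq_fun do rewrite scaleN1r.
have yq : y (chart i q) = zeta by rewrite /y wE subrr mul0mx addr0.
have [r r0 rP] := nbhs_ex_norm (filterI (filterI (near_chart_dom iq)
  (near_chart_inv iq (near_in_vb_dom aq))) (filterI (smooth_at_open sy) GR)).
have lO : lifts_on rho [set x : V | `|x - chart i q| < r] i ia y w.
  move=> x /rP[[[ix xE] ax] [sx GRx]]; split=> //.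
  by rewrite /y mulmxDl -mulmxA GRx mulmx1 addrC subrK.
have jq' : vb_dom j (chart_inv i (chart i q)) by rewrite chartK.
have [_ dE] := line_derive l lO (nbhs_norm_lt _ r0) jq'.
rewrite /tangent_derive [X in X + _]dE yq chartK//.
have := conn_mx_sum D ia j l (X q) (s q); rewrite /conn_mx => cE.
by rewrite [X in X + _]cE addNr.
Qed.

End Invariance.

(** * The evaluation map *)

Section Evaluation.
Variables (R : realType) (M : manifold R) (A : vbundle M).
Variables (rho : bundle_hom A (tangent M)) (F : vbundle M).
Variable D : connection rho F.

Lemma parallel_sections_subspace : linear_subspace (parallel_sections D).
Proof.
split=> [|c s t [Gs Ds] [Gt Dt]].
  by split=> [|X GX]; [exact: Gamma0|exact: nabla0r].
split=> [|X GX]; first exact: Gamma_linear.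
by rewrite nabla_linearr// Ds// Dt// scaler0 addr0.
Qed.

Lemma Hol_parallel_section (s : sect F) p h : parallel_sections D s ->
  Hol D p h -> h (s p) = s p.
Proof.
move=> Ps [c [a [c0 [c1 [pa ->]]]]]; rewrite (ecast_sect (esym c0) s).
have pu : parallel_along D a (fun t => s (c t)).
  apply: (@par_at_parallel _ _ _ _ _ D (fun t => mkAF (a t) (s (c t)))) => t It.
  exact: parallel_section_par (regular_I01 It) (Apath_path_at pa It) Ps.
by rewrite (transportE pa pu) ecast_sect.
Qed.

Lemma par_at_lin (c : R -> M) (a : forall t, A (c t)) (u w : forall t, F (c t))
    (k : R) J t : regular J t ->
  par_at D J (fun t => mkAF (a t) (u t)) t ->
  par_at D J (fun t => mkAF (a t) (w t)) t ->
  par_at D J (fun t => mkAF (a t) (k *: u t + w t)) t.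
Proof.
move=> rt pu pw; have [Jt _] := rt.
have fE j s l : fcoord j (mkAF (a s) (k *: u s + w s)) 0 l =
    k * fcoord j (mkAF (a s) (u s)) 0 l + fcoord j (mkAF (a s) (w s)) 0 l.
  by rewrite /fcoord/= linearD linearZ !mxE.
split; first exact: par_path pu.
  have [j jp] := vb_cover F (c t); exists j => //; apply: rsmooth_mx => o l.
  rewrite ord1; under eq_fun do rewrite fE.
  apply: rsmoothD; last exact: (par_fcoord l Jt pw jp).
  by apply: rsmoothM; [exact: rsmooth_cst|exact: (par_fcoord l Jt pu jp)].
move=> i j ip jp l.
have [f sf fu] := par_fcoord l Jt pu jp; have [g sg gw] := par_fcoord l Jt pw jp.
have su : smooth_at (fun s => k * f s) t by exact: smooth_atZ.
rewrite (rderiveE rt (smooth_atD su sg)); last first.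
  by apply: filterS2 fu gw => s fs gs Js; rewrite fE fs// gs.
transitivity (k * 'D_1 f t + 'D_1 g t).
  rewrite (_ : (fun y => _) = (k *: f) + g)//.
  have df : derivable f t 1 by exact: smooth_at_derivable.
  have dg : derivable g t 1 by exact: smooth_at_derivable.
  by rewrite (deriveD (derivableZ (k := k) df) dg) (deriveZ k df).
rewrite -(rderiveE rt sf fu) -(rderiveE rt sg gw) (par_eq pu ip jp) (par_eq pw ip jp).
rewrite mulr_sumr -big_split/=; apply: eq_bigr => n _.
by rewrite fE mulrDr [k * (_ * _)]mulrCA.
Qed.

(** Transport may be a default value on other vectors, so its linearity cannot be invoked. Each of
    the two fixed vectors has a parallel extension along the loop, the zero section serving for the
    vector 0, and the linear combination of the extensions computes the transport. *)
Lemma Hol_fixed_subspace p : linear_subspace (Hol_fixed D p).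
Proof.
have zero_par : parallel_sections D 0 by have [] := parallel_sections_subspace.
split=> [h Hh|k v w fv fw h Hh].
  exact: Hol_parallel_section zero_par Hh.
have vE := fv h Hh; have wE := fw h Hh.
case: Hh vE wE => c [a [c0 [c1 [pa ->]]]] vE wE.
have lift (x : F p) : ecast o (F o) c1 (transport D a (ecast o (F o) (esym c0) x)) = x ->
    exists u, [/\ parallel_along D a u, u 0 = ecast o (F o) (esym c0) x &
      ecast o (F o) c1 (u 1) = x].
  move=> E; have [T0|nz] := eqVneq (transport D a (ecast o (F o) (esym c0) x)) 0.
    have vz : x = 0 by rewrite -E T0 ecast0.
    exists (fun t => 0); rewrite vz !ecast0; split=> //.
    apply: (@par_at_parallel _ _ _ _ _ D (fun t => mkAF (a t) 0)) => t It.
    exact: parallel_section_par (regular_I01 It) (Apath_path_at pa It) zero_par.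
  by have [u [pu u0 u1]] := transport_neq0 nz; exists u; rewrite u1.
have [u [pu u0 u1]] := lift v vE; have [u' [pu' u'0 u'1]] := lift w wE.
rewrite ecast_lin -u0 -u'0.
have pc : parallel_along D a (fun t => k *: u t + u' t).
  apply: (@par_at_parallel _ _ _ _ _ D (fun t => mkAF (a t) (k *: u t + u' t))) => t It.
  by apply: par_at_lin (regular_I01 It) _ _; exact: parallel_par_at It.
by rewrite (transportE pa pc) ecast_lin u1 u'1.
Qed.

Lemma parallel_section_unique (s s' : sect F) p : connected [set: M] ->
  transitive_anchor rho -> parallel_sections D s -> parallel_sections D s' ->
  s p = s' p -> s = s'.
Proof.
move=> cM tr Ps Ps' sp; apply: functional_extensionality_dep => q.
have [g [pg ge]] := flat_path_exists p q cM tr.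
have : mkAF (projT2 (g 1)) (s (projT1 (g 1))) = mkAF (projT2 (g 1)) (s' (projT1 (g 1))).
  apply: (@par_unique _ _ _ _ _ D [set: R] [set: R]
    (fun t => mkAF (projT2 (g t)) (s (projT1 (g t))))
    (fun t => mkAF (projT2 (g t)) (s' (projT1 (g t)))) 0) => //.
  - by move=> t _; exact: regularT.
  - by move=> t _; split=> //; apply: parallel_section_par => //; exact: regularT.
  - by rewrite (path_ends0 ge)/= sp.
by rewrite (path_ends1 ge)/= => /mkAF_inj.
Qed.

End Evaluation.

Theorem theorem3p1 (R : realType) (M : manifold R)
    (M_connected : connected [set: M])
    (A : vbundle M) (rho : bundle_hom A (tangent M))
    (rho_transitive : transitive_anchor rho)
    (F : vbundle M) (D : connection rho F) (p : M) :
  linear_iso_on (parallel_sections D) (Hol_fixed D p) (fun s : sect F => s p).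
Proof.
split.
- exact: parallel_sections_subspace.
- exact: Hol_fixed_subspace.
- by [].
- split.
  + by move=> s Ps h Hh; exact: Hol_parallel_section Ps Hh.
  + move=> s s'; rewrite !inE => Ps Ps' sp.
    exact: parallel_section_unique M_connected rho_transitive Ps Ps' sp.
  (* [holonomy_section] requires a nonzero vector, because a zero transport may be the default
     value; the vector 0 is the value of the zero section. *)
  + move=> v fv; have [->|v0] := eqVneq v 0.
      by exists 0 => //; have [] := parallel_sections_subspace D.
    have reach y := flat_path_exists p y M_connected rho_transitive.
    have [s [sp s_par]] := holonomy_section fv v0 reach.
    by exists s => //; exact: invariant_parallel s_par rho_transitive.
Qed.
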